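(* Let $\omega$ be a non-quasianalytic weight function, $T\in\mathcal{D}'_\omega(\mathbb{R}^N)$ and $1\le p<\infty$, and let $p'$ be the conjugate exponent of $p$. Then $T\in\mathcal{O}'_{M,\omega}(\mathbb{R}^N)$ if and only if there exists $m\in\mathbb{N}$ such that for every $n\in\mathbb{N}$ there exists $\{f_\alpha\}_{\alpha\in\mathbb{N}_0^N}\in\left(\oplus L^{p'}(\mathbb{R}^N,\exp(n\omega(x))\,dx)\right)_{\omega,m,p'}$ such that $$T=\sum_{\alpha\in\mathbb{N}_0^N}\partial^\alpha f_\alpha .$$
   Context: $\mathbb{N}=\{1,2,\dots\}$, $\mathbb{N}_0=\mathbb{N}\cup\{0\}$. A non-quasianalytic weight function is a continuous increasing (i.e. non-decreasing) function $\omega:[0,\infty)\to[0,\infty)$ such that: ($\alpha$) there is $K\ge1$ with $\omega(2t)\le K(1+\omega(t))$ for all $t\ge0$; ($\beta$) $\int_1^\infty\frac{\omega(t)}{1+t^2}\,dt<\infty$; ($\gamma$) there are $a\in\mathbb{R}$, $b>0$ with $\omega(t)\ge a+b\log(1+t)$ for all $t\ge0$; ($\delta$) $\varphi_\omega(t):=\omega(e^t)$ is convex. It is assumed (without loss of generality) that $\omega$ vanishes on $[0,1]$. For $x\in\mathbb{R}^N$, $\omega(x):=\omega(|x|)$. The Young conjugate is $\varphi^*_\omega(s):=\sup_{t\ge0}\{st-\varphi_\omega(t)\}$, $s\ge0$ (with $\exp(-\infty)=0$, $\exp(+\infty)=+\infty$, $0\cdot\infty=0$ if the supremum is $+\infty$).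 For compact $Q\subset\mathbb{R}^N$, $\mathcal{D}_\omega(Q)$ is the space of all $f\in C^\infty(\mathbb{R}^N)$ with support in $Q$ and $\sup_{\alpha\in\mathbb{N}_0^N}\sup_{x\in Q}|\partial^\alpha f(x)|\exp(-m\varphi^*_\omega(|\alpha|/m))<\infty$ for all $m\in\mathbb{N}$, with the Fréchet topology given by these norms; $\mathcal{D}_\omega(\mathbb{R}^N)$ is the inductive limit of the $\mathcal{D}_\omega(Q)$ over compact sets $Q$ and $\mathcal{D}'_\omega(\mathbb{R}^N)$ is its dual. For $m\in\mathbb{N}$, $n\in\mathbb{Z}$, $\mathcal{O}^m_{n,\omega}(\mathbb{R}^N)$ is the space of all $f\in C^\infty(\mathbb{R}^N)$ with $r_{m,n}(f):=\sup_{\alpha}\sup_{x}|\partial^\alpha f(x)|\exp\left(-n\omega(x)-m\varphi^*_\omega\left(\frac{|\alpha|}{m}\right)\right)<\infty$, normed by $r_{m,n}$. $\mathcal{O}_{M,\omega}(\mathbb{R}^N):=\bigcap_{m=1}^\infty\bigcup_{n=1}^\infty\mathcal{O}^m_{n,\omega}(\mathbb{R}^N)$ with the locally convex topology of $\mathrm{proj}_m\,\mathrm{ind}_n\,\mathcal{O}^m_{n,\omega}(\mathbb{R}^N)$; $\mathcal{O}'_{M,\omega}(\mathbb{R}^N)$ is its strong dual. The inclusion $\mathcal{D}_\omega(\mathbb{R}^N)\hookrightarrow\mathcal{O}_{M,\omega}(\mathbb{R}^N)$ is continuous with dense range (known), so $\mathcal{O}'_{M,\omega}(\mathbb{R}^N)\subset\mathcal{D}'_\omega(\mathbb{R}^N)$;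 $T\in\mathcal{O}'_{M,\omega}(\mathbb{R}^N)$ means that $T$ extends to a continuous linear functional on $\mathcal{O}_{M,\omega}(\mathbb{R}^N)$. For $1\le q<\infty$, $m\in\mathbb{N}$, $n\in\mathbb{Z}$, $\left(\oplus L^{q}(\mathbb{R}^N,\exp(n\omega(x))\,dx)\right)_{\omega,m,q}$ is the set of all families $\{f_\alpha\}_{\alpha\in\mathbb{N}_0^N}$ of Lebesgue measurable functions on $\mathbb{R}^N$ with $\sum_{\alpha}\|\exp(n\omega)f_\alpha\|_q^q\exp\left(qm\varphi^*_\omega\left(\frac{|\alpha|}{m}\right)\right)<\infty$; for $q=\infty$ the condition is $\sup_\alpha\|\exp(n\omega)f_\alpha\|_\infty\exp\left(m\varphi^*_\omega\left(\frac{|\alpha|}{m}\right)\right)<\infty$. The identity $T=\sum_\alpha\partial^\alpha f_\alpha$ means $\langle T,\phi\rangle=\sum_\alpha(-1)^{|\alpha|}\int_{\mathbb{R}^N}f_\alpha(x)\partial^\alpha\phi(x)\,dx$ for all $\phi\in\mathcal{D}_\omega(\mathbb{R}^N)$. *)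

(* Defs.v *)
From HB Require Import structures.
From mathcomp Require Import all_boot all_order all_algebra finmap.
From mathcomp Require Import complex.
From mathcomp Require Import all_classical all_reals all_analysis.

Set Implicit Arguments.
Unset Strict Implicit.
Unset Printing Implicit Defensive.

Import Order.TTheory GRing.Theory Num.Theory.
Import numFieldNormedType.Exports.

Local Open Scope classical_set_scope.
Local Open Scope ring_scope.

(* R^N is 'rV[R]_N for topology and differentiation; the library puts a product
   sigma-algebra on n.-tuples only, so the measure lives on N.-tuple R and
   functions on R^N are integrated after composition with [vec]. *)
Section borel_lebesgue_step.
Context {R : realType} (n : nat).
Variable m : {sigma_finite_measure set (n.-tuple (measurableTypeR R)) -> \bar R}.

Definition tcons (x : measurableTypeR R * n.-tuple (measurableTypeR R)) :
  n.+1.-tuple (measurableTypeR R) := [the n.+1.-tuple _ of x.1 :: x.2].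

Lemma measurable_tcons : measurable_fun [set: _] tcons.
Proof. exact: measurable_cons. Qed.

HB.instance Definition _ :=
  isMeasurableFun.Build _ _ _ _ tcons measurable_tcons.

Definition borel_lebesgue_step : set (n.+1.-tuple (measurableTypeR R)) -> \bar R :=
  pushforward (@lebesgue_measure R \x m)%E tcons.

Let step0 : borel_lebesgue_step set0 = 0%E.
Proof. exact: measure0. Qed.

Let step_ge0 A : (0 <= borel_lebesgue_step A)%E.
Proof. exact: measure_ge0. Qed.

Let step_sigma_additive : semi_sigma_additive borel_lebesgue_step.
Proof. exact: measure_semi_sigma_additive. Qed.

HB.instance Definition _ := isMeasure.Build _ _ _ borel_lebesgue_step
  step0 step_ge0 step_sigma_additive.

Let step_sigma_finite : sigma_finite [set: _] borel_lebesgue_step.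
Proof.
have /sigma_finiteP[F [TF ndF Foo]] := sigma_finiteT (@lebesgue_measure R).
have /sigma_finiteP[G [TG ndG Goo]] := sigma_finiteT m.
pose g (t : n.+1.-tuple (measurableTypeR R)) := (thead t, [tuple of behead t]).
have gK x : g (tcons x) = x.
  by case: x => a b; congr pair; apply: val_inj.
have mg : measurable_fun [set: _] g.
  apply/measurable_fun_pairP; split; first exact: measurable_tnth.
  exact: measurable_behead.
exists (fun k => g @^-1` (F k `*` G k)).
  rewrite -preimage_bigcup; apply/esym/seteqP; split=> // t _.
  have [i _ Fi] : (\bigcup_k F k) (g t).1 by rewrite -TF.
  have [j _ Gj] : (\bigcup_k G k) (g t).2 by rewrite -TG.
  exists (maxn i j) => //; split.
  - by move: Fi; exact/subsetPset/ndF/leq_maxl.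
  - by move: Gj; exact/subsetPset/ndG/leq_maxr.
move=> k; have [mF Fk] := Foo k; have [mG Gk] := Goo k; split.
  by rewrite -[X in measurable X]setTI; apply: mg => //; exact: measurableX.
rewrite /borel_lebesgue_step /pushforward -comp_preimage.
rewrite (_ : g \o tcons = id) ?preimage_id; last by rewrite funeqE => x /=.
by rewrite product_measure1E// lte_mul_pinfty// ge0_fin_numE.
Qed.

HB.instance Definition _ := Measure_isSigmaFinite.Build _ _ _
  borel_lebesgue_step step_sigma_finite.

End borel_lebesgue_step.

Fixpoint borel_lebesgue {R : realType} (n : nat) :
    {sigma_finite_measure set (n.-tuple (measurableTypeR R)) -> \bar R} :=
  if n is n'.+1 then borel_lebesgue_step (@borel_lebesgue R n')
  else \d_([tuple] : 0.-tuple (measurableTypeR R)).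


Definition lebesgueN {R : realType} (N : nat) :=
  @completed_measure_extension _ _ _ (@borel_lebesgue R N).

HB.instance Definition _ {R : realType} (N : nat) :=
  Measure.on (@lebesgueN R N).

Lemma lebesgueN_sigma_finite {R : realType} (N : nat) :
  sigma_finite [set: _] (@lebesgueN R N).
Proof.
exact/completed_measure_extension_sigma_finite/sigma_finiteT.
Qed.

HB.instance Definition _ {R : realType} (N : nat) :=
  Measure_isSigmaFinite.Build _ _ _ (@lebesgueN R N) (lebesgueN_sigma_finite N).

(* Its measurable sets are the Caratheodory measurable sets of the outer measure,
   i.e. the Lebesgue measurable sets, as for completed_lebesgue_measure on R. *)
Definition leb_space (R : realType) (N : nat) :=
  caratheodory_type (mu_ext (@borel_lebesgue R N)).

Definition vec {R : realType} {N : nat} (t : leb_space R N) : 'rV[R]_N :=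
  \row_i tnth (t : N.-tuple R) i.

Section functions.
Context {R : realType} {N : nat}.
Local Notation C := R[i].
Local Notation Rn := 'rV[R]_N.

Definition cabs (z : C) : R := complex.Re `|z|.

Definition re_part (f : Rn -> C) : Rn -> R := fun x => complex.Re (f x).
Definition im_part (f : Rn -> C) : Rn -> R := fun x => complex.Im (f x).

Definition enorm (x : Rn) : R := Num.sqrt (\sum_(i < N) x 0 i ^+ 2).

Definition cmeasurable (f : Rn -> C) : Prop :=
  measurable_fun [set: leb_space R N] (re_part f \o vec) /\
  measurable_fun [set: leb_space R N] (im_part f \o vec).

Definition cintegral (f : Rn -> C) : C :=
  Complex (\int[@lebesgueN R N]_(t in [set: leb_space R N]) re_part f (vec t))
          (\int[@lebesgueN R N]_(t in [set: leb_space R N]) im_part f (vec t)).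

Definition partial (i : 'I_N) (f : Rn -> C) : Rn -> C := fun x =>
  Complex ('D_(delta_mx 0 i) (re_part f) x) ('D_(delta_mx 0 i) (im_part f) x).

Definition multi_index := {ffun 'I_N -> nat}.

Definition mlen (a : multi_index) : nat := \sum_(i < N) a i.

Definition partials (a : multi_index) (f : Rn -> C) : Rn -> C :=
  foldr (fun i g => iter (a i) (partial i) g) f (enum 'I_N).

Definition smooth (f : Rn -> C) : Prop :=
  forall s : seq 'I_N, let g := foldr partial f s in
  [/\ continuous (re_part g), continuous (im_part g) &
      forall (i : 'I_N) (x : Rn), derivable (re_part g) x (delta_mx 0 i) /\
                                  derivable (im_part g) x (delta_mx 0 i)].

Definition supp (f : Rn -> C) : set Rn := closure [set x | f x != 0].

End functions.
Arguments multi_index : clear implicits.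

Record nonquasianalytic_weight {R : realType} (omega : R -> R) : Prop := {
  weight_ge0 : forall t : R, 0 <= t -> 0 <= omega t ;
  weight_continuous : {within `[0, +oo[, continuous omega} ;
  weight_nondecreasing :
    forall s t : R, 0 <= s -> s <= t -> omega s <= omega t ;
  weight_alpha : exists2 K : R, 1 <= K &
    forall t : R, 0 <= t -> omega (2 * t) <= K * (1 + omega t) ;
  weight_beta :
    (\int[@lebesgue_measure R]_(t in `[1%R, +oo[)
       (omega t / (1 + t ^+ 2))%:E < +oo)%E ;
  weight_gamma : exists a b : R, 0 < b /\
    forall t : R, 0 <= t -> a + b * ln (1 + t) <= omega t ;
  weight_delta :
    convex_function [set: R^o] (fun t : R^o => omega (expR t)) ;
  weight_eq0 : forall t : R, 0 <= t <= 1 -> omega t = 0 }.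

Section spaces.
Context {R : realType} {N : nat}.
Local Notation C := R[i].
Local Notation Rn := 'rV[R]_N.
Local Notation mI := (multi_index N).
Local Notation leb := (@lebesgueN R N).

(* A topological vector space of functions: its elements, and the filter of
   neighbourhoods of 0, which determines its (translation invariant) topology.
   Sets of functions are taken in the ambient type; only their trace on the
   elements matters. *)
Record fspace := FSpace {
  elements : set (Rn -> C) ;
  nbhs0 : set (set (Rn -> C)) }.

Definition fspace_of_norms {I : eqType} (E : set (Rn -> C))
    (r : I -> (Rn -> C) -> \bar R) : fspace :=
  FSpace E [set U | exists (s : seq I) (e : R), 0 < e /\
    forall f, E f -> (forall i, i \in s -> (r i f < e%:E)%E) -> U f].

Definition absolutely_convex (V : set (Rn -> C)) : Prop :=
  forall (a b : C) f g, cabs a + cabs b <= 1 -> V f -> V g ->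
    V (fun x => a * f x + b * g x).

(* The finest locally convex topology on the union of the E j, j in P, for
   which the inclusions are continuous *)
Definition ind_limit {J : Type} (P : set J) (E : J -> fspace) : fspace :=
  let X := \bigcup_(j in P) elements (E j) in
  FSpace X [set U | exists V, [/\ V `<=` X, absolutely_convex V, V `<=` U &
    forall j, P j -> nbhs0 (E j) V]].

(* The coarsest topology on the intersection of the E j, j in P, for which the
   inclusions are continuous *)
Definition proj_limit {J : eqType} (P : set J) (E : J -> fspace) : fspace :=
  let X := \bigcap_(j in P) elements (E j) in
  FSpace X [set U | exists (s : seq J) (V : J -> set (Rn -> C)),
    (forall j, j \in s -> P j /\ nbhs0 (E j) (V j)) /\
    forall f, X f -> (forall j, j \in s -> V j f) -> U f].

(* T is only meant on the elements of E; its other values are irrelevant. *)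
Definition in_dual (E : fspace) (T : (Rn -> C) -> C) : Prop :=
  (forall (a b : C) f g, elements E f -> elements E g ->
     T (fun x => a * f x + b * g x) = a * T f + b * T g) /\
  (forall f, elements E f -> forall e : R, 0 < e ->
     nbhs0 E [set h | cabs (T (fun x => f x + h x) - T f) < e]).

Variable omega : R -> R.

Definition omegaN (x : Rn) : R := omega (enorm x).

Definition young (s : R) : \bar R :=
  ereal_sup [set (s * t - omega (expR t))%:E | t in [set t : R | 0 <= t]].

(* m * young (|a| / m), with values in [0, +oo] *)
Definition young_weight (m : nat) (a : mI) : \bar R :=
  (m%:R%:E * young ((mlen a)%:R / m%:R))%E.

Definition D_norm (Q : set Rn) (m : nat) (f : Rn -> C) : \bar R :=
  ereal_sup [set z | exists (a : mI) (x : Rn), Q x /\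
    z = ((cabs (partials a f x))%:E * expeR (- young_weight m a))%E].

Definition D_on (Q : set Rn) : fspace :=
  fspace_of_norms
    [set f | [/\ smooth f, supp f `<=` Q &
                 forall m, (0 < m)%N -> (D_norm Q m f < +oo)%E]]
    (fun k : nat => D_norm Q k.+1).

Definition D_omega : fspace := ind_limit [set Q | compact Q] D_on.

Definition O_norm (m : nat) (n : int) (f : Rn -> C) : \bar R :=
  ereal_sup [set z | exists (a : mI) (x : Rn),
    z = ((cabs (partials a f x))%:E *
         expeR ((- (n%:~R * omegaN x))%:E - young_weight m a))%E].

Definition O_step (m : nat) (n : int) : fspace :=
  fspace_of_norms [set f | smooth f /\ (O_norm m n f < +oo)%E]
    (fun _ : unit => O_norm m n).

Definition O_M : fspace :=
  proj_limit [set m | (0 < m)%N] (fun m : nat =>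
    ind_limit [set n | (0 < n)%N] (fun n : nat => O_step m n%:Z)).

Definition in_dual_O_M (T : (Rn -> C) -> C) : Prop :=
  exists2 S, in_dual O_M S & forall phi, elements D_omega phi -> S phi = T phi.

Definition weighted_Lnorm (q : \bar R) (n : int) (f : Rn -> C) : \bar R :=
  Lnorm leb q
    (fun t => (expR (n%:~R * omegaN (vec t)) * cabs (f (vec t)))%:E).

Definition in_oplusL (q : \bar R) (m : nat) (n : int) (f : mI -> Rn -> C) :
    Prop :=
  (forall a, cmeasurable (f a)) /\
  match q with
  | r%:E => (\esum_(a in [set: mI])
      (weighted_Lnorm q n (f a) `^ r * expeR (r%:E * young_weight m a)) < +oo)%E
  | +oo%E => (ereal_sup [set
      weighted_Lnorm q n (f a) * expeR (young_weight m a) | a in [set: mI]]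
        < +oo)%E
  | -oo%E => False
  end.

(* Unordered sum of a family of complex numbers *)
Definition has_sum (u : mI -> C) (l : C) : Prop :=
  forall e : R, 0 < e -> exists F : {fset mI}, forall G : {fset mI},
    (F `<=` G)%fset -> cabs (\sum_(a <- G) u a - l) < e.

Definition is_sum_of_derivatives (T : (Rn -> C) -> C) (f : mI -> Rn -> C) :
    Prop :=
  forall phi, elements D_omega phi ->
    has_sum (fun a =>
      (-1) ^+ mlen a * cintegral (fun x => f a x * partials a phi x)) (T phi).

End spaces.

(* Main.v *)
(* Both conditions are equivalent to an estimate on test functions: for some m and
   every n, |T phi| is bounded by a multiple of the supremum over x and a of
   |d^a phi (x)| exp (- n omega x) c_m(|a|), where c_m(j) = exp (- m phi^*(j / m)).
   Condition (alpha) gives 2^j c_m(j) <= A c_M(j) for some M, which absorbs every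
   geometric factor, in particular the number of multi-indices of a given length.

   Continuity of T on the multiplier space gives the estimate at once. Conversely,
   let S_n be a Hahn-Banach extension of T to the n-th step, and let psi_j be test
   functions that are 1 at a point, dilated so much that they are very close to 1
   for the weighted norms. Then S f = S_1 (psi_0 f) + sum_j S_j ((psi_j+1 - psi_j) f)
   converges, is continuous on every step, and extends T.

   The Sobolev inequality replaces suprema over x by weighted L^1 norms. On families
   indexed by a and normed by the supremum of weighted L^1 norms, Hahn-Banach and
   the Radon-Nikodym theorem represent T by densities f_a bounded by a multiple of
   c_M(|a|) exp (- n omega), and these belong to all the weighted L^p' spaces since
   exp (- k omega) is integrable for large k. Conversely, Hoelder's inequality bounds
   each term of sum_a d^a f_a, with a loss of exp (k omega) only. *)

From HB Require Import structures.
Require Import Defs.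
From mathcomp Require Import all_boot all_order all_algebra finmap.
From mathcomp Require Import complex.
From mathcomp Require Import all_classical all_reals all_analysis.
From mathcomp Require Import ring lra zify.
From mathcomp Require Import measurable_realfun ess_sup_inf.

Set Implicit Arguments.
Unset Strict Implicit.
Unset Printing Implicit Defensive.

Import Order.TTheory GRing.Theory Num.Theory.
Import numFieldNormedType.Exports.

Local Open Scope classical_set_scope.
Local Open Scope ring_scope.

(** * The Hahn-Banach theorem *)

(** The extensions of [T] to the different steps are unrelated: they agree on test functions only,
    and nothing controls the growth of their norms. Hence the cutoffs are chosen after the
    extensions. On the n-th step, multiplication by psi_j+1 - psi_j acts in two ways: as a map into
    step n + 1 it is so small that it beats the norm of S_j once j >= n, and its compact support
    takes care of the finitely many j < n. A dilated cutoff is close to 1 for the norm of the first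
    step because of continuity near the origin and of exp (- omega) far away.

    One m must serve every n. So all losses in the weights c_m (Leibniz rule, extra derivatives of
    the Sobolev inequality, summation over multi-indices) are paid before n is known, whereas losses
    in the exponent of exp (omega) may depend on n.

    A functional bounded by a supremum over multi-indices need not be a series; it is one on jets of
    test functions, whose weighted norms decay geometrically in the order.

    Where phi^* is infinite, c_m is 0: the estimate says nothing about that derivative, and the
    coefficient f_a is forced to vanish almost everywhere. *)

Section hahn_banach.
Context {R : realType} {X : Type}.
Implicit Types (f g : X -> R) (E D : set (X -> R)) (q u : (X -> R) -> R).

(** Subspaces are predicates on plain functions, so that one theorem serves both for complex
    functions coded on [X * bool] and for families of functions coded on [J * T]. *)
Definition lin_closed E := forall (a : R) f g, E f -> E g -> E (fun x => a * f x + g x).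

Definition linear_on E u := forall (a : R) f g, E f -> E g ->
  u (fun x => a * f x + g x) = a * u f + u g.

Definition seminorm_on E q :=
  (forall f g, E f -> E g -> q (fun x => f x + g x) <= q f + q g) /\
  (forall (a : R) f, E f -> q (fun x => a * f x) <= `|a| * q f).

Lemma lin_closed0 E f : lin_closed E -> E f -> E (fun=> 0).
Proof.
move=> EL Ef; have := EL (-1) f f Ef Ef; congr (E _).
by apply/funext => x; rewrite mulN1r addNr.
Qed.

Lemma lin_closedZ E a f : lin_closed E -> E f -> E (fun x => a * f x).
Proof.
move=> EL Ef; have := EL a f _ Ef (lin_closed0 EL Ef); congr (E _).
by apply/funext => x; rewrite addr0.
Qed.

Lemma lin_closedD E f g : lin_closed E -> E f -> E g -> E (fun x => f x + g x).
Proof.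
move=> EL Ef Eg; have := EL 1 f g Ef Eg; congr (E _).
by apply/funext => x; rewrite mul1r.
Qed.

Lemma linear_on0 E u f : lin_closed E -> E f -> linear_on E u -> u (fun=> 0) = 0.
Proof.
move=> EL Ef uL; have E0 := lin_closed0 EL Ef.
transitivity (u (fun x => -1 * (fun=> 0) x + (fun=> 0) x)).
  by congr u; apply/funext => x; rewrite mulr0 addr0.
by rewrite uL//; ring.
Qed.

Lemma linear_onZ E u a f : lin_closed E -> linear_on E u -> E f ->
  u (fun x => a * f x) = a * u f.
Proof.
move=> EL uL Ef; have E0 := lin_closed0 EL Ef.
have := uL a _ _ Ef E0; rewrite (linear_on0 EL Ef uL) addr0 => <-; congr u.
by apply/funext => x; rewrite addr0.
Qed.

Lemma linear_onD E u f g : linear_on E u -> E f -> E g ->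
  u (fun x => f x + g x) = u f + u g.
Proof.
move=> uL Ef Eg; rewrite -[u f]mul1r -uL//; congr u.
by apply/funext => x; rewrite mul1r.
Qed.

Lemma linear_onB E u f g : lin_closed E -> linear_on E u -> E f -> E g ->
  u (fun x => f x - g x) = u f - u g.
Proof.
move=> EL uL Ef Eg; rewrite [RHS]addrC -mulN1r -uL//; congr u.
by apply/funext => x; rewrite mulN1r addrC.
Qed.

Lemma linear_on_sum E u (I : Type) (s : seq I) (F : I -> X -> R) :
  lin_closed E -> linear_on E u -> E (fun=> 0) -> (forall i, E (F i)) ->
  E (fun x => \sum_(i <- s) F i x) /\
  u (fun x => \sum_(i <- s) F i x) = \sum_(i <- s) u (F i).
Proof.
move=> EL uL E0 EF; elim: s => [|i s [IH1 IH2]].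
  rewrite big_nil (_ : (fun x => _) = (fun=> 0)); last first.
    by apply/funext => x; rewrite big_nil.
  by split=> //; exact: linear_on0 E0 uL.
rewrite (_ : (fun x => _) = (fun x => F i x + \sum_(i <- s) F i x)).
  split; first exact: lin_closedD.
  by rewrite (linear_onD uL)// IH2 big_cons.
by apply/funext => x; rewrite big_cons.
Qed.

(** Partial functionals are kept as graphs. Domination by [q] already makes such a graph single
    valued, so Zorn's lemma works on plain sets of pairs. *)
Let lin_graph E q (G : set ((X -> R) * R)) :=
  (forall a p r, G p -> G r -> G (fun x => a * p.1 x + r.1 x, a * p.2 + r.2)) /\
  (forall p, G p -> E p.1 /\ p.2 <= q p.1).

(** The difference of the two pairs lies over the zero function, where [q] is at most 0; exchanging
    the pairs gives equality. *)
Let lin_graph_fun E q G f r s : seminorm_on E q -> lin_graph E q G ->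
  G (f, r) -> G (f, s) -> r = s.
Proof.
move=> [_ qZ] [GL Gq]; wlog suff : r s / G (f, r) -> G (f, s) -> r <= s.
  by move=> H Gr Gs; apply/eqP; rewrite eq_le !H.
move=> Gr Gs; have := GL (-1) _ _ Gs Gr => /= /Gq/= [_].
have [Ef _] := Gq _ Gr.
have -> : (fun x => -1 * f x + f x) = (fun x => 0 * f x).
  by apply/funext => x; rewrite mulN1r addNr mul0r.
move=> /le_trans /(_ (qZ 0 _ Ef)); rewrite normr0 mul0r mulN1r; lra.
Qed.

Let lin_graph0 E q G p : lin_graph E q G -> G p -> G (fun=> 0, 0).
Proof.
move=> [GL _] Gp; have := GL (-1) _ _ Gp Gp; congr G; congr pair.
  by apply/funext => x; rewrite mulN1r addNr.
by rewrite mulN1r addNr.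
Qed.

(** Apply homogeneity to [a^-1]; at [a = 0] it is subadditivity that gives [0 <= q 0]. *)
Lemma seminorm_onZ E q a f : lin_closed E -> seminorm_on E q -> 0 <= a -> E f ->
  a * q f <= q (fun x => a * f x).
Proof.
move=> EL [qD qZ]; rewrite le_eqVlt => /predU1P[<-{a} Ef|a0 Ef].
  have E0 := lin_closed0 EL Ef.
  have := qD _ _ E0 E0.
  have -> : (fun x => (fun=> 0 : R) x + (fun=> 0) x) = (fun=> 0 : R) :> (X -> R).
    by apply/funext => x; rewrite addr0.
  have -> : (fun x => 0 * f x) = (fun=> 0) by apply/funext => x; rewrite mul0r.
  by rewrite mul0r; lra.
have := qZ a^-1 _ (lin_closedZ a EL Ef).
rewrite (_ : (fun x => _) = f).
  by rewrite gtr0_norm ?invr_gt0// ler_pdivlMl.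
by apply/funext => x; rewrite mulKf// gt_eqF.
Qed.

(* The value at [f0] must lie between two families of bounds. *)
Let lin_graph_extend E q G f0 : lin_closed E -> seminorm_on E q ->
  lin_graph E q G -> G (fun=> 0, 0) -> E f0 ->
  exists r0, lin_graph E q
    [set p | exists a p', G p' /\ p = (fun x => a * f0 x + p'.1 x, a * r0 + p'.2)].
Proof.
move=> EL Eq [GL Gq] G0 Ef0; have [qD qZ] := Eq.
pose L := [set p.2 - q (fun x => p.1 x - f0 x) | p in G].
have subE f g : E f -> E g -> E (fun x => f x - g x).
  move=> Ef Eg; have := EL (-1) _ _ Eg Ef; congr E.
  by apply/funext => x; rewrite mulN1r addrC.
have ubL p : G p -> ubound L (q (fun x => p.1 x + f0 x) - p.2).
  move=> Gp _ [p' Gp' <-].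
  have /Gq/= [_] := GL 1 _ _ Gp Gp'.
  have -> : (fun x => 1 * p.1 x + p'.1 x) = (fun x => (p.1 x + f0 x) + (p'.1 x - f0 x)).
    by apply/funext => x; ring.
  move=> /le_trans /(_ (qD _ _ _ _)).
  have E1 : E (fun x => p.1 x + f0 x).
    by apply: lin_closedD => //; exact: (Gq _ Gp).1.
  have E2 : E (fun x => p'.1 x - f0 x) by apply: subE => //; exact: (Gq _ Gp').1.
  by move=> /(_ E1 E2); lra.
have supL : has_sup L.
  split; first by eexists; exists (fun=> 0, 0).
  by eexists; exact: ubL G0.
exists (sup L); split.
  move=> a _ _ [b [p [Gp ->]]] [c [p' [Gp' ->]]] /=.
  exists (a * b + c), (fun x => a * p.1 x + p'.1 x, a * p.2 + p'.2); split.
    exact: GL.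
  by congr pair; [apply/funext => x /=; ring|rewrite /=; ring].
move=> _ [a [p [Gp ->]]] /=; have [Ep qp] := Gq _ Gp; split.
  exact: EL.
have GZ b p1 : G p1 -> G (fun x => b * p1.1 x, b * p1.2).
  move=> Gp1; have := GL b _ _ Gp1 G0; congr G; congr pair => /=.
    by apply/funext => x; rewrite addr0.
  by rewrite addr0.
have [a0|a0|->] := ltgtP a 0; last first.
- rewrite mul0r add0r (_ : (fun x => _) = p.1)//.
  by apply/funext => x; rewrite mul0r add0r.
- have /ubL ub := GZ a^-1 _ Gp.
  have : sup L <= q (fun x => a^-1 * p.1 x + f0 x) - a^-1 * p.2.
    exact: ge_sup supL.1 ub.
  rewrite -(ler_pM2l a0) mulrBr mulVKf ?gt_eqF// lerBrDr => /le_trans; apply.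
  apply: le_trans (seminorm_onZ EL Eq (ltW a0) _) _.
    by apply: lin_closedD => //; exact: lin_closedZ.
  rewrite (_ : (fun x => _) = (fun x => a * f0 x + p.1 x))//.
  by apply/funext => x; field; rewrite gt_eqF.
- have Gp' := GZ (- a^-1) _ Gp.
  have : - a^-1 * p.2 - q (fun x => - a^-1 * p.1 x - f0 x) <= sup L.
    by apply: ub_le_sup; [exact: supL.2|eexists; first exact: Gp'].
  have na0 : 0 < - a by rewrite oppr_gt0.
  rewrite -(ler_pM2l na0) mulrBr [_ * (_ * p.2)]mulrA mulrNN divff ?lt_eqF// mul1r.
  rewrite lerBlDr mulNr -lerBlDl opprK addrC => /le_trans; apply.
  apply: le_trans (seminorm_onZ EL Eq (ltW na0) _) _.
    by apply: subE => //; exact: lin_closedZ.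
  rewrite (_ : (fun x => _) = (fun x => a * f0 x + p.1 x))//.
  by apply/funext => x; field; rewrite lt_eqF.
Qed.

Theorem hahn_banach E D q u : lin_closed E -> seminorm_on E q ->
  D `<=` E -> D !=set0 -> lin_closed D -> linear_on D u ->
  (forall f, D f -> u f <= q f) ->
  exists U, [/\ linear_on E U, forall f, D f -> U f = u f &
    forall f, E f -> `|U f| <= q f].
Proof.
move=> EL Eq DE [d0 Dd0] DL uL uq.
pose G0 : set ((X -> R) * R) := [set p | D p.1 /\ p.2 = u p.1].
(* The condition bears on the union with [G0] rather than on [G] itself: the empty union, which
   Zorn's lemma also tests, then satisfies it, and the functional obtained from a maximal [G]
   extends [u]. *)
pose P (G : set ((X -> R) * R)) := lin_graph E q (G `|` G0).
have PG0 : lin_graph E q G0.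
  split=> [a p r [Dp p2] [Dr r2]|p [Dp ->]].
    by split=> /=; [exact: DL|rewrite p2 r2 uL].
  by split; [exact: DE|exact: uq].
have [F PF totF|G [PG Gmax]] := @Zorn_bigcup _ P.
  split=> [a p r|p].
    (* Both points lie in one member of the chain, enlarged by [G0]; when both come from [G0], the
       empty set stands in for that member. *)
    move=> Fp Fr; have [G [FG Gp Gr]] : exists G, [/\ F G \/ G = set0,
        (G `|` G0) p & (G `|` G0) r].
      case: Fp Fr => [[A FA Ap]|pG0] [[B FB Br]|rG0].
      + case: (totF _ _ FA FB) => AB.
          by exists B; split; left=> //; exact: AB.
        by exists A; split; left=> //; exact: AB.
      + by exists A; split; [left|left|right].
      + by exists B; split; [left|right|left].
      + by exists set0; split; right.
    have [GL _] : lin_graph E q (G `|` G0).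
      by case: FG => [/PF//|->]; rewrite set0U.
    case: (GL a _ _ Gp Gr); last by right.
    by case: FG => [FG ?|->//]; left; exists G.
  move=> [[A FA Ap]|pG0]; last exact: PG0.2.
  by apply: (PF _ FA).2; left.
set H := G `|` G0.
have H0 : H (fun=> 0, 0).
  by apply: (@lin_graph0 E q _ (d0, u d0) PG); right.
have Htot f : E f -> exists r, H (f, r).
  move=> Ef; apply: contrapT => nH.
  have [r0 PG'] := lin_graph_extend EL Eq PG H0 Ef.
  set G' := [set p | _] in PG'.
  have HG' : H `<=` G'.
    move=> [g r] Hg; exists 0, (g, r); split => //; congr pair => /=.
      by apply/funext => x; rewrite mul0r add0r.
    by rewrite mul0r add0r.
  have fG' : G' (f, r0).
    exists 1, (fun=> 0, 0); split => //; congr pair => /=.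
      by apply/funext => x; rewrite mul1r addr0.
    by rewrite mul1r addr0.
  apply: (Gmax G').
    split; first by move=> p Gp; apply: HG'; left.
    by move=> /(_ _ fG') Gf; apply: nH; exists r0; left.
  rewrite /P (_ : G' `|` G0 = G')//; apply/seteqP; split=> [p [//|pG0]|p]; last by left.
  by apply: HG'; right.
pose U f := xget 0 [set r | H (f, r)].
have HU f : E f -> H (f, U f).
  by move=> /Htot [r Hr]; rewrite /U; case: xgetP => // /(_ r).
have UE f r : H (f, r) -> U f = r.
  move=> Hr; have /= [Ef _] := PG.2 _ Hr.
  exact: lin_graph_fun Eq PG (HU _ Ef) Hr.
exists U; split.
- move=> a f g Ef Eg; apply: UE.
  exact: (PG.1 a _ _ (HU _ Ef) (HU _ Eg)).
- by move=> f Df; apply: UE; right.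
- move=> f Ef; have := (PG.2 _ (HU _ Ef)).2 => /= Ufq; rewrite ler_norml Ufq andbT.
  have Enf : E (fun x => (-1) * f x) by exact: lin_closedZ.
  have /PG.2/= [_] := PG.1 (-1) _ _ (HU _ Ef) H0.
  have -> : (fun x => -1 * f x + 0) = (fun x => -1 * f x).
    by apply/funext => x; rewrite addr0.
  by have := Eq.2 (-1) _ Ef; rewrite normrN1; lra.
Qed.

End hahn_banach.

(** * The weight sequence *)

Section weight_sequence.
Context {R : realType} (omega : R -> R).
Hypothesis homega : nonquasianalytic_weight omega.

Let young_weight_nat m j : \bar R := (m%:R%:E * young omega (j%:R / m%:R))%E.

(* exp (- m phi^*(j / m)), which is also the infimum over s >= 1 of
   exp (m omega s) / s ^ j. *)
Definition cw (m j : nat) : R := fine (expeR (- young_weight_nat m j)).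

Let young_ge0 s : (0 <= young omega s)%E.
Proof.
apply: ereal_sup_ubound; exists 0 => //=.
by rewrite expR0 mulr0 (weight_eq0 homega) ?subr0// ler01 lexx.
Qed.

Let young_weight_ge0 m j : (0 <= young_weight_nat m j)%E.
Proof. by apply: mule_ge0; rewrite ?lee_fin. Qed.

Lemma cwE m j : (cw m j)%:E = expeR (- young_weight_nat m j).
Proof.
rewrite fineK// ge0_fin_numE ?expeR_ge0//.
have := young_weight_ge0 m j.
by case: (young_weight_nat m j) => //= r; rewrite ltry.
Qed.

Lemma cw_young_weight N m (a : multi_index N) :
  expeR (- young_weight omega m a) = (cw m (mlen a))%:E.
Proof. by rewrite cwE. Qed.

(** [cw] vanishes exactly when the conjugate is [+oo]. The inverse weight is then [+oo], so a
    coefficient of finite weighted norm must be 0 there. *)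
Lemma expeR_young_weight N m (a : multi_index N) :
  expeR (young_weight omega m a) =
  if cw m (mlen a) == 0 then +oo%E else ((cw m (mlen a))^-1)%:E.
Proof.
have := cw_young_weight m a; have := young_weight_ge0 m (mlen a).
rewrite -/(young_weight omega m a); case: (young_weight omega m a) => //= [r _|_].
  move=> [<-]; rewrite gt_eqF ?expR_gt0//.
  by rewrite expRN invrK.
by move=> [<-]; rewrite eqxx.
Qed.

Lemma cw_ge0 m j : 0 <= cw m j.
Proof. by rewrite fine_ge0// expeR_ge0. Qed.

(** Substituting [s = expR t] and taking logarithms turns the supremum defining the conjugate into
    an infimum. Estimates on the weights go through this form, which stays valid when the conjugate
    is infinite. *)
Lemma cw_leP m j z : (0 < m)%N ->
  z <= cw m j <-> forall s, 1 <= s -> z <= expR (m%:R * omega s) / s ^+ j.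
Proof.
move=> m0; have m0R : (0 : R) < m%:R by rewrite ltr0n.
have [z0|z0] := leP z 0.
  split=> [_ s s1|_]; last exact: le_trans z0 (cw_ge0 _ _).
  apply: le_trans z0 _; rewrite divr_ge0 ?expR_ge0//.
  by rewrite exprn_ge0// (le_trans ler01).
have reparam s : 0 < s -> z <= expR (m%:R * omega s) / s ^+ j <->
    j%:R / m%:R * ln s - omega s <= - ln z / m%:R.
  move=> s0; rewrite ler_pdivlMr ?exprn_gt0//.
  have -> : z * s ^+ j = expR (ln z + j%:R * ln s).
    rewrite expRD lnK ?posrE//; congr (_ * _).
    by rewrite mulr_natl -lnXn// lnK// posrE exprn_gt0.
  rewrite ler_expR ler_pdivlMr//; split => h.
    rewrite mulrBl mulrAC divfK ?gt_eqF//; lra.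
  by move: h; rewrite mulrBl mulrAC divfK ?gt_eqF//; lra.
rewrite -lee_fin cwE -[X in (X%:E <= _)%E](@lnK _ z) ?posrE//.
rewrite -[(expR (ln z))%:E]/(expeR (ln z)%:E) lee_expeR leeNr -EFinN.
have -> : (young_weight_nat m j <= (- ln z)%:E)%E =
          (young omega (j%:R / m%:R) <= (- ln z / m%:R)%:E)%E.
  by rewrite (mulrC (- ln z)) EFinM lee_pdivlMl.
split=> [h s s1|h].
  have s0 : 0 < s by exact: lt_le_trans s1.
  apply/(reparam s s0); rewrite -lee_fin; apply: le_trans h.
  apply: ereal_sup_ubound; exists (ln s) => /=; first exact: ln_ge0.
  by rewrite lnK.
apply: ge_ereal_sup => _ [t /= t0 <-]; rewrite lee_fin.
have t1 : 1 <= expR t by apply: le_trans (expR_ge1Dx t); rewrite lerDl.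
by have /(reparam _ (expR_gt0 t)) := h _ t1; rewrite expRK.
Qed.

Lemma cw_le m j s : (0 < m)%N -> 1 <= s -> cw m j <= expR (m%:R * omega s) / s ^+ j.
Proof. by move=> m0; exact: (cw_leP j _ m0).1 (lexx _) s. Qed.

Let omega_ge0 s : 1 <= s -> 0 <= omega s.
Proof. by move=> s1; rewrite (weight_ge0 homega)// (le_trans ler01). Qed.

Lemma cw_le1 m j : (0 < m)%N -> cw m j <= 1.
Proof.
move=> m0; apply: le_trans (cw_le j m0 (lexx 1)) _.
by rewrite (weight_eq0 homega) ?ler01 ?lexx// mulr0 expR0 expr1n divr1.
Qed.

Lemma cw0 m : (0 < m)%N -> cw m 0 = 1.
Proof.
move=> m0; apply/eqP; rewrite eq_le cw_le1//=; apply/(cw_leP _ _ m0) => s s1.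
by rewrite expr0 divr1 -expR0 ler_expR mulr_ge0 ?omega_ge0.
Qed.

Lemma cw_mono m M j : (0 < m)%N -> (m <= M)%N -> cw m j <= cw M j.
Proof.
move=> m0 mM; have M0 : (0 < M)%N by exact: leq_trans mM.
apply/(cw_leP _ _ M0) => s s1; apply: le_trans (cw_le j m0 s1) _.
rewrite ler_wpM2r ?invr_ge0 ?exprn_ge0 ?(le_trans ler01)//.
by rewrite ler_expR ler_wpM2r ?omega_ge0// ler_nat.
Qed.

(** Test the infimum at [u = max s t]: there omega u <= omega s + omega t, while u^(i + j) >= s^i
    t^j. *)
Lemma cwD_le m i j : (0 < m)%N -> cw m (i + j) <= cw m i * cw m j.
Proof.
move=> m0; have cwD s t : 1 <= s -> 1 <= t -> cw m (i + j) <=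
    (expR (m%:R * omega s) / s ^+ i) * (expR (m%:R * omega t) / t ^+ j).
  move=> s1 t1; pose u := Num.max s t.
  have u1 : 1 <= u by rewrite le_max s1.
  have [su tu] : s <= u /\ t <= u by rewrite !le_max !lexx orbT.
  apply: le_trans (cw_le _ m0 u1) _.
  rewrite exprD mulrACA -invfM -expRD; apply: ler_pM; rewrite ?expR_ge0//.
  - by rewrite invr_ge0 mulr_ge0// exprn_ge0// (le_trans ler01).
  - rewrite ler_expR -mulrDr ler_wpM2l// /u.
    have := omega_ge0 s1; have := omega_ge0 t1.
    by case: (leP s t) => st; rewrite ?(max_idPr st) ?(max_idPl (ltW st)); lra.
  - have s0 := lt_le_trans ltr01 s1; have t0 := lt_le_trans ltr01 t1.
    have u0 := lt_le_trans ltr01 u1.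
    rewrite lef_pV2 ?posrE ?mulr_gt0 ?exprn_gt0//.
    by apply: ler_pM; rewrite ?exprn_ge0 ?(ltW s0) ?(ltW t0)//;
      apply: lerXn2r; rewrite ?nnegrE// ltW.
have [c0|c0] := eqVneq (cw m (i + j)) 0.
  by rewrite c0 mulr_ge0 ?cw_ge0.
have cgt0 : 0 < cw m (i + j) by rewrite lt_def c0 cw_ge0.
have gt0 s k : 1 <= s -> 0 < expR (m%:R * omega s) / s ^+ k.
  by move=> s1; rewrite divr_gt0 ?expR_gt0// exprn_gt0// (lt_le_trans ltr01).
(* The infimum over [s] is taken with [t] fixed, then the one over [t]. The second division needs
   [0 < cw m i], which the case [t = 1] of the first supplies. *)
have cj t : 1 <= t ->
    cw m (i + j) / (expR (m%:R * omega t) / t ^+ j) <= cw m i.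
  move=> t1; apply/(cw_leP _ _ m0) => s s1; rewrite ler_pdivrMr ?gt0//; exact: cwD.
have i0 : 0 < cw m i by apply: lt_le_trans (cj 1 (lexx 1)); rewrite divr_gt0 ?gt0.
rewrite mulrC -ler_pdivrMr//; apply/(cw_leP _ _ m0) => t t1.
by rewrite ler_pdivrMr// mulrC -ler_pdivrMr ?gt0//; exact: cj.
Qed.

(** Evaluate the infimum for [m] at [2 * s] instead of [s]: the power of 2 cancels, and (alpha)
    bounds m omega (2 s) by m K + m K omega s. Hence [M] at least m K and the constant exp (m K). *)
Lemma cw_geom m : (0 < m)%N -> exists M A, [/\ (m <= M)%N, 0 < A &
  forall j, 2 ^+ j * cw m j <= A * cw M j].
Proof.
move=> m0; have [K K1 HK] := weight_alpha homega.
have [M KM] : exists M : nat, m%:R * K <= M%:R.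
  by exists (Num.bound (m%:R * K)); apply/ltW/archi_boundP; rewrite mulr_ge0// (le_trans ler01).
have mM : (m <= M)%N.
  by rewrite -(ler_nat R) (le_trans _ KM)// ler_peMr.
exists M, (expR (m%:R * K)); split=> //; first exact: expR_gt0.
move=> j; have M0 : (0 < M)%N by exact: leq_trans mM.
rewrite -ler_pdivrMl ?expR_gt0//; apply/(cw_leP _ _ M0) => s s1.
have s0 : 0 < s by exact: lt_le_trans s1.
rewrite ler_pdivrMl ?expR_gt0//.
have s2 : 1 <= 2 * s by lra.
apply: (@le_trans _ _ (2 ^+ j * (expR (m%:R * omega (2 * s)) / (2 * s) ^+ j))).
  by rewrite ler_wpM2l ?exprn_ge0//; exact: cw_le.
have -> : 2 ^+ j * (expR (m%:R * omega (2 * s)) / (2 * s) ^+ j) =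
    expR (m%:R * omega (2 * s)) / s ^+ j.
  by rewrite exprMn; field; rewrite !expf_neq0 ?gt_eqF.
rewrite mulrA ler_wpM2r ?invr_ge0 ?exprn_ge0 ?(ltW s0)// -expRD ler_expR.
apply: (@le_trans _ _ (m%:R * (K * (1 + omega s)))).
  by rewrite ler_wpM2l// HK// ltW.
rewrite mulrA mulrDr mulr1 lerD2l ler_wpM2r ?omega_ge0//.
Qed.

(** Exponentiate (gamma), multiplied by some n >= k / b. *)
Lemma weight_log k : exists n C, [/\ (0 < n)%N, 0 < C &
  forall t, 0 <= t -> (1 + t) ^+ k <= C * expR (n%:R * omega t)].
Proof.
have [a [b [b0 Hab]]] := weight_gamma homega.
have [n kn] : exists n : nat, k%:R / b <= n.+1%:R.
  exists (Num.bound (k%:R / b)); rewrite ltW// (lt_trans (archi_boundP _))//.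
    by rewrite divr_ge0// ltW.
  by rewrite ltr_nat.
exists n.+1, (expR (- n.+1%:R * a)); split=> //; first exact: expR_gt0.
move=> t t0; have t1 : 0 < 1 + t by lra.
rewrite -expRD -[X in X ^+ _](@lnK _ (1 + t)) ?posrE// -expRM_natl ler_expR.
have := Hab _ t0; have : 0 <= ln (1 + t) by rewrite ln_ge0//; lra.
move: kn; rewrite ler_pdivrMr//; set l := ln _; set w := omega t.
move=> kn l0 abw.
have : k%:R * l <= n.+1%:R * b * l by rewrite ler_wpM2r.
have : n.+1%:R * (a + b * l) <= n.+1%:R * w by rewrite ler_wpM2l.
by lra.
Qed.

(** Raising the order by [i] divides by s^i, which [weight_log] bounds by an exponential of the
    weight. This pays for the N extra derivatives of the Sobolev inequality. *)
Lemma cw_shift m k : (0 < m)%N -> exists M B, [/\ (m <= M)%N, 0 < B &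
  forall i j, (i <= k)%N -> cw m j <= B * cw M (i + j)].
Proof.
move=> m0; have [n [C [n0 C0 HC]]] := weight_log k.
exists (m + n)%N, C; split=> // [|i j ik]; first exact: leq_addr.
have M0 : (0 < m + n)%N by rewrite addn_gt0 m0.
rewrite -ler_pdivrMl//; apply/(cw_leP _ _ M0) => s s1.
have s0 : 0 < s by exact: lt_le_trans s1.
rewrite ler_pdivrMl//; apply: le_trans (cw_le j m0 s1) _.
have -> : C * (expR ((m + n)%:R * omega s) / s ^+ (i + j)) =
    (expR (m%:R * omega s) / s ^+ j) * (C * expR (n%:R * omega s) / s ^+ i).
  by rewrite natrD mulrDl expRD exprD; field; rewrite !expf_neq0 ?gt_eqF.
rewrite ler_peMr ?divr_ge0 ?expR_ge0 ?exprn_ge0 ?(ltW s0)//.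
rewrite ler_pdivlMr ?exprn_gt0// mul1r; apply: le_trans (HC _ (ltW s0)).
apply: (@le_trans _ _ ((1 + s) ^+ i)).
  by apply: lerXn2r; rewrite ?nnegrE; lra.
by rewrite ler_weXn2l//; lra.
Qed.

Lemma weight_scale k : exists2 A, 0 < A &
  forall t, 0 <= t -> omega (2 ^+ k * t) <= A * (1 + omega t).
Proof.
have [K K1 HK] := weight_alpha homega; elim: k => [|k [A A0 IH]].
  by exists 1 => // t t0; rewrite expr0 !mul1r lerDr.
exists (K * (1 + A)) => [|t t0]; first by rewrite mulr_gt0 ?addr_gt0 ?(lt_le_trans ltr01 K1).
rewrite exprS -mulrA; apply: le_trans (HK _ _) _.
  by rewrite mulr_ge0// exprn_ge0.
rewrite -mulrA ler_wpM2l ?(le_trans ler01)//.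
have := IH _ t0; have := weight_ge0 homega t0; rewrite mulrDl mul1r; lra.
Qed.

(** For t >= 1 the shift is a dilation, since t + c <= (1 + c) t. For t < 1 the weight is 0 at t as
    it is at 1, so t is replaced by 1. *)
Lemma weight_shift c : exists2 A, 0 < A & forall s t, 0 <= s -> 0 <= t ->
  s <= t + c -> omega s <= A * (1 + omega t).
Proof.
wlog c0 : c / 0 <= c.
  move=> H; have [//|c0] := leP 0 c; first exact: H.
  have [A A0 HA] := H 0 (lexx _); exists A => // s t s0 t0 stc.
  by apply: HA => //; lra.
have [k kc] : exists k : nat, 1 + c <= 2 ^+ k.
  exists (Num.bound (1 + c)); apply/ltW.
  apply: lt_trans (archi_boundP _) _; first lra.
  by rewrite -natrX ltr_nat ltn_expl.
have [A A0 HA] := weight_scale k; exists A => // s t s0 t0 stc.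
have [t1|t1] := leP 1 t.
  apply: le_trans (HA _ t0); apply: (weight_nondecreasing homega) => //.
  apply: (le_trans stc); apply: (@le_trans _ _ ((1 + c) * t)).
    have : c <= c * t by rewrite ler_peMr.
    lra.
  by rewrite ler_wpM2r.
have -> : omega t = 0 by rewrite (weight_eq0 homega)// t0 ltW.
have -> : 0 = omega 1 by rewrite (weight_eq0 homega)// ler01 lexx.
apply: le_trans (HA _ ler01); apply: (weight_nondecreasing homega) => //.
by rewrite mulr1; lra.
Qed.

End weight_sequence.

(** * Smooth functions *)

Section line_derivative.
Context {R : realType} {V : normedModType R}.
Implicit Types (F : V -> R) (x u v : V).

Lemma is_derive_line F x v (s : R) : derivable F (x + s *: v) v ->
  is_derive s (1 : R) (fun t : R => F (x + t *: v)) ('D_v F (x + s *: v)).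
Proof.
move=> dF.
have E : (fun h : R => h^-1 *: (((fun t : R => F (x + t *: v)) \o shift s) (h *: (1 : R))
      - F (x + s *: v))) =
    (fun h : R => h^-1 *: ((F \o shift (x + s *: v)) (h *: v) - F (x + s *: v))).
  apply/funext => h /=; congr (_ *: (F _ - _)).
  by rewrite /shift/= scaler1 scalerDl addrCA.
by split; rewrite /derivable /derive E.
Qed.

Lemma mean_value_line F x v (h : R) : 0 < h ->
  (forall y, derivable F y v) ->
  exists2 s, 0 < s < h & F (x + h *: v) - F x = h * 'D_v F (x + s *: v).
Proof.
move=> h0 dF; have dl s := is_derive_line (dF (x + s *: v)).
have cl : {within `[0, h], continuous (fun t : R => F (x + t *: v))}.
  apply: derivable_within_continuous => s _; exact: ex_derive.
have [s hs Hs] := @MVT R (fun t : R => F (x + t *: v)) (fun t => 'D_v F (x + t *: v)) 0 h h0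
  (fun s _ => dl s) cl.
exists s; first by move: hs; rewrite in_itv.
by move: Hs; rewrite scale0r addr0 subr0 mulrC.
Qed.

(** The second difference of [F] over the parallelogram spanned by h u and h v is computed by two
    applications of the mean value theorem, in either order of the directions. *)
Lemma derive_comm_sub F x u v :
  (forall y, derivable F y u) -> (forall y, derivable F y v) ->
  (forall y, derivable ('D_u F) y v) -> (forall y, derivable ('D_v F) y u) ->
  forall h, 0 < h -> exists s t s' t',
    [/\ 0 < s < h, 0 < t < h, 0 < s' < h, 0 < t' < h &
    'D_v ('D_u F) (x + (s *: u + t *: v)) = 'D_u ('D_v F) (x + (s' *: u + t' *: v))].
Proof.
move=> dFu dFv dFuv dFvu h h0.
pose Q := F (x + h *: u + h *: v) - F (x + h *: u) - (F (x + h *: v) - F x).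
have key (G : V -> R) w z : (forall y, derivable G y w) ->
    (forall y, derivable ('D_w G) y z) -> exists s t, [/\ 0 < s < h, 0 < t < h &
    G (x + h *: w + h *: z) - G (x + h *: w) - (G (x + h *: z) - G x) =
    h * (h * 'D_z ('D_w G) (x + (s *: w + t *: z)))].
  move=> dw dwz.
  pose H := (fun y => G (y + h *: z)) - G.
  have dGs y : is_derive y w (fun y => G (y + h *: z)) ('D_w G (y + h *: z)).
    have E : (fun k : R => k^-1 *: (((fun y => G (y + h *: z)) \o shift y) (k *: w) -
        G (y + h *: z))) = (fun k : R => k^-1 *: ((G \o shift (y + h *: z)) (k *: w) -
        G (y + h *: z))).
      by apply/funext => k /=; rewrite /shift/= addrA.
    by have := dw (y + h *: z); split; rewrite /derivable /derive E.
  have dG y : is_derive y w G ('D_w G y) by exact: derivableP.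
  have dH y : is_derive y w H ('D_w G (y + h *: z) - 'D_w G y).
    exact: is_deriveB.
  have [|s hs Hs] := @mean_value_line H x w h h0; first by move=> y; exact: ex_derive.
  have [//|t ht Ht] := @mean_value_line ('D_w G) (x + s *: w) z h h0.
  exists s, t; split=> //.
  rewrite addrA -Ht.
  have -> : 'D_w G (x + s *: w + h *: z) - 'D_w G (x + s *: w) = 'D_w H (x + s *: w).
    by rewrite (@derive_val _ _ _ _ _ _ _ (dH _)).
  by rewrite -Hs.
have [s [t [hs ht E1]]] := key F u v dFu dFuv.
have [t' [s' [ht' hs' E2]]] := key F v u dFv dFvu.
exists s, t, s', t'; split; [exact: hs|exact: ht|exact: hs'|exact: ht'|].
apply: (mulfI (lt0r_neq0 h0)); apply: (mulfI (lt0r_neq0 h0)).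
rewrite (addrC (s' *: u)); apply: etrans (esym E1) _; apply: etrans _ E2.
by rewrite [x + h *: v + h *: u]addrAC; ring.
Qed.

Lemma derive_comm F x u v :
  (forall y, derivable F y u) -> (forall y, derivable F y v) ->
  (forall y, derivable ('D_u F) y v) -> (forall y, derivable ('D_v F) y u) ->
  {for x, continuous ('D_v ('D_u F))} -> {for x, continuous ('D_u ('D_v F))} ->
  'D_v ('D_u F) x = 'D_u ('D_v F) x.
Proof.
move=> dFu dFv dFuv dFvu c1 c2; apply/eqP; rewrite -subr_eq0 -normr_le0.
apply/ler_addgt0Pl => e e0; rewrite addr0.
have e2 : 0 < e / 2 by rewrite divr_gt0.
move: c1 => /cvgrPdist_le /(_ _ e2) /nbhs_normP[d1 /= d10 H1].
move: c2 => /cvgrPdist_le /(_ _ e2) /nbhs_normP[d2 /= d20 H2].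
pose d := Num.min d1 d2; have d0 : 0 < d by rewrite lt_min d10.
(* With this side the whole parallelogram stays in the ball of radius [d], where both mixed
   derivatives are within e / 2 of their values at [x]. *)
pose h := d / (`|u| + `|v| + 1).
have den : 0 < `|u| + `|v| + 1 by rewrite ltr_wpDl// addr_ge0.
have h0 : 0 < h by rewrite divr_gt0.
have small s t : 0 < s < h -> 0 < t < h -> `|x - (x + (s *: u + t *: v))| < d.
  move=> /andP[s0 sh] /andP[t0 th]; rewrite opprD addNKr normrN.
  apply: (le_lt_trans (ler_normD _ _)); rewrite !normrZ !gtr0_norm//.
  apply: (@le_lt_trans _ _ (h * (`|u| + `|v|))).
    by rewrite mulrDr lerD// ler_wpM2r// ltW.
  by rewrite /h mulrAC ltr_pdivrMr// ltr_pM2l//; lra.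
have [s [t [s' [t' [hs ht hs' ht' E]]]]] := derive_comm_sub x dFu dFv dFuv dFvu h0.
have := small _ _ hs ht; have := small _ _ hs' ht'.
rewrite !lt_min => /andP[_ /H2 /= A2] /andP[/H1 /= A1 _].
rewrite E in A1.
move: ('D_v _ x) ('D_u _ x) ('D_u _ _) A1 A2 => a b c A1 A2.
have -> : a - b = (a - c) - (b - c) by ring.
by apply: (le_trans (ler_normB _ _)); rewrite (splitr e); exact: lerD.
Qed.

End line_derivative.

Section cabs_theory.
Context {R : realType}.
Local Notation C := R[i].
Implicit Types z w : C.

Lemma cabsE z : cabs z = Num.sqrt (complex.Re z ^+ 2 + complex.Im z ^+ 2).
Proof. by rewrite /cabs normc_def. Qed.

Lemma cabs_ge0 z : 0 <= cabs z.
Proof. by rewrite cabsE sqrtr_ge0. Qed.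

Lemma cabsP z : (cabs z)%:C%C = `|z|.
Proof. by rewrite cabsE normc_def. Qed.

Lemma cabsM z w : cabs (z * w) = cabs z * cabs w.
Proof. by apply: (@complexI R); rewrite cabsP normrM -!cabsP rmorphM. Qed.

Lemma cabsD z w : cabs (z + w) <= cabs z + cabs w.
Proof. by rewrite -lecR rmorphD/= !cabsP ler_normD. Qed.

Lemma cabs0 : cabs (0 : C) = 0.
Proof. by rewrite cabsE/= expr0n addr0 sqrtr0. Qed.

Lemma cabsN z : cabs (- z) = cabs z.
Proof. by rewrite /cabs normrN. Qed.

Lemma cabs_real (k : R) : cabs k%:C%C = `|k|.
Proof. by rewrite cabsE/= expr0n addr0 sqrtr_sqr. Qed.

Lemma cabs_i : cabs ('i%C : C) = 1.
Proof. by rewrite cabsE/= expr0n add0r expr1n sqrtr1. Qed.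

Lemma cabs_sign n : cabs ((-1) ^+ n : C) = 1.
Proof.
by rewrite -signr_odd; case: odd; rewrite ?expr0 ?expr1 ?cabsN -[1]/(1%:C)%C cabs_real normr1.
Qed.

Lemma Re_le_cabs z : `|complex.Re z| <= cabs z.
Proof. by rewrite cabsE -sqrtr_sqr ler_wsqrtr// lerDl sqr_ge0. Qed.

Lemma Im_le_cabs z : `|complex.Im z| <= cabs z.
Proof. by rewrite cabsE -sqrtr_sqr ler_wsqrtr// lerDr sqr_ge0. Qed.

Lemma cabs_le z : cabs z <= `|complex.Re z| + `|complex.Im z|.
Proof.
rewrite cabsE -[leRHS]ger0_norm ?addr_ge0// -sqrtr_sqr ler_wsqrtr//.
rewrite sqrrD !real_normK ?num_real//.
by rewrite -addrA lerD2l lerDr mulrn_wge0 ?mulr_ge0.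
Qed.

Lemma cabs_sum (I : Type) (s : seq I) (F : I -> C) :
  cabs (\sum_(i <- s) F i) <= \sum_(i <- s) cabs (F i).
Proof.
elim/big_rec2: _ => [|i y1 y2 _ h]; first by rewrite cabs0.
by apply: le_trans (cabsD _ _) _; rewrite lerD2l.
Qed.

Lemma cReD z w : complex.Re (z + w) = complex.Re z + complex.Re w.
Proof. by case: z; case: w. Qed.

Lemma cImD z w : complex.Im (z + w) = complex.Im z + complex.Im w.
Proof. by case: z; case: w. Qed.

Lemma cReM z w : complex.Re (z * w) =
  complex.Re z * complex.Re w - complex.Im z * complex.Im w.
Proof. by case: z; case: w. Qed.

Lemma cImM z w : complex.Im (z * w) =
  complex.Re z * complex.Im w + complex.Im z * complex.Re w.
Proof. by case: z; case: w. Qed.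

Lemma complex_ext z w : complex.Re z = complex.Re w -> complex.Im z = complex.Im w -> z = w.
Proof. by case: z => a b; case: w => c d /= -> ->. Qed.

End cabs_theory.

Section smooth_functions.
Context {R : realType} {N : nat}.
Local Notation C := R[i].
Local Notation Rn := 'rV[R]_N.
Implicit Types (f g h : Rn -> C) (s : seq 'I_N) (i : 'I_N) (x y : Rn) (a b : C).
Local Notation e i := (delta_mx 0 i : Rn).

(** Derivatives are indexed by words in the coordinates: an induction on the word peels off one
    derivative at a time, from either end. Multi-indices return through [dseqE]. *)
Definition dseq s f := foldr partial f s.

Definition diff1 f := [/\ continuous (re_part f), continuous (im_part f) &
  forall i x, derivable (re_part f) x (e i) /\ derivable (im_part f) x (e i)].

Lemma smoothP f : smooth f <-> forall s, diff1 (dseq s f).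
Proof. by []. Qed.

Definition is_partial f i x (d : C) :=
  is_derive x (e i) (re_part f) (complex.Re d) /\
  is_derive x (e i) (im_part f) (complex.Im d).

Lemma diff1_is_partial f i x : diff1 f -> is_partial f i x (partial i f x).
Proof. by move=> [_ _ /(_ i x)[d1 d2]]; split; exact: derivableP. Qed.

Lemma is_partialE f i x d : is_partial f i x d -> partial i f x = d.
Proof.
by move=> [d1 d2]; apply: complex_ext => /=; rewrite derive_val.
Qed.

Lemma diff1_of f : continuous (re_part f) -> continuous (im_part f) ->
  (forall i x, exists d, is_partial f i x d) -> diff1 f.
Proof. by move=> c1 c2 H; split=> // i x; have [d [d1 d2]] := H i x; split; exact: ex_derive. Qed.

Lemma is_partial_lin a b f g i x d d' : is_partial f i x d -> is_partial g i x d' ->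
  is_partial (fun x => a * f x + b * g x) i x (a * d + b * d').
Proof.
move=> [f1 f2] [g1 g2]; split.
- have -> : re_part (fun x => a * f x + b * g x) =
    complex.Re a \*: re_part f - complex.Im a \*: im_part f +
    (complex.Re b \*: re_part g - complex.Im b \*: im_part g).
    by apply/funext => y; rewrite /re_part cReD !cReM.
  by rewrite cReD !cReM; apply: is_deriveD.
- have -> : im_part (fun x => a * f x + b * g x) =
    complex.Re a \*: im_part f + complex.Im a \*: re_part f +
    (complex.Re b \*: im_part g + complex.Im b \*: re_part g).
    by apply/funext => y; rewrite /im_part cImD !cImM.
  by rewrite cImD !cImM; apply: is_deriveD.
Qed.

Lemma is_partialM f g i x d d' : is_partial f i x d -> is_partial g i x d' ->
  is_partial (fun x => f x * g x) i x (d * g x + f x * d').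
Proof.
move=> [f1 f2] [g1 g2]; split.
- have -> : re_part (fun x => f x * g x) =
    re_part f * re_part g - im_part f * im_part g.
    by apply/funext => y; rewrite /re_part cReM.
  apply: is_derive_eq; rewrite cReD !cReM /GRing.scale/= /re_part /im_part; ring.
- have -> : im_part (fun x => f x * g x) =
    re_part f * im_part g + im_part f * re_part g.
    by apply/funext => y; rewrite /im_part cImM.
  apply: is_derive_eq; rewrite cImD !cImM /GRing.scale/= /re_part /im_part; ring.
Qed.

Lemma eq_continuous (u v : Rn -> R) : u =1 v -> continuous u -> continuous v.
Proof. by move=> /funext ->. Qed.

Lemma continuous_comb (a b : R) (u v : Rn -> R) : continuous u -> continuous v ->
  continuous (fun x => a * u x + b * v x).
Proof.
move=> cu cv x.
apply: (@continuousD R R _ (fun x => a * u x) (fun x => b * v x) x).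
  exact: (@cvgMl_tmp R _ (nbhs x) _ u a (u x) (cu x)).
exact: (@cvgMl_tmp R _ (nbhs x) _ v b (v x) (cv x)).
Qed.

Lemma continuous_prod_comb (a b : R) (u v u' v' : Rn -> R) :
  continuous u -> continuous v -> continuous u' -> continuous v' ->
  continuous (fun x => a * (u x * v x) + b * (u' x * v' x)).
Proof.
move=> cu cv cu' cv'; apply: (@continuous_comb a b (u \* v) (u' \* v')) => x.
  exact: (continuousM (cu x) (cv x)).
exact: (continuousM (cu' x) (cv' x)).
Qed.

Lemma diff1_lin a b f g : diff1 f -> diff1 g -> diff1 (fun x => a * f x + b * g x).
Proof.
move=> Hf Hg; have [f1 f2 _] := Hf; have [g1 g2 _] := Hg; apply: diff1_of.
- have -> : re_part (fun x => a * f x + b * g x) = (fun x =>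
    (complex.Re a * re_part f x - complex.Im a * im_part f x) +
    (complex.Re b * re_part g x - complex.Im b * im_part g x)).
    by apply/funext => y; rewrite /re_part cReD !cReM.
  apply: eq_continuous (@continuous_comb 1 1 _ _ (@continuous_comb (complex.Re a) (- complex.Im a) _ _ f1 f2)
    (@continuous_comb (complex.Re b) (- complex.Im b) _ _ g1 g2)) => x.
  by rewrite !mul1r !mulNr.
- have -> : im_part (fun x => a * f x + b * g x) = (fun x =>
    (complex.Re a * im_part f x + complex.Im a * re_part f x) +
    (complex.Re b * im_part g x + complex.Im b * re_part g x)).
    by apply/funext => y; rewrite /im_part cImD !cImM.
  apply: eq_continuous (@continuous_comb 1 1 _ _ (@continuous_comb (complex.Re a) (complex.Im a) _ _ f2 f1)
    (@continuous_comb (complex.Re b) (complex.Im b) _ _ g2 g1)) => x.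
  by rewrite !mul1r.
- move=> i x; eexists.
  by apply: is_partial_lin; exact: diff1_is_partial.
Qed.

Lemma diff1M f g : diff1 f -> diff1 g -> diff1 (fun x => f x * g x).
Proof.
move=> Hf Hg; have [f1 f2 _] := Hf; have [g1 g2 _] := Hg; apply: diff1_of.
- have -> : re_part (fun x => f x * g x) = (fun x =>
    re_part f x * re_part g x - im_part f x * im_part g x).
    by apply/funext => y; rewrite /re_part cReM.
  apply: eq_continuous (@continuous_prod_comb 1 (-1) _ _ _ _ f1 g1 f2 g2) => x.
  by rewrite !mul1r mulN1r.
- have -> : im_part (fun x => f x * g x) = (fun x =>
    re_part f x * im_part g x + im_part f x * re_part g x).
    by apply/funext => y; rewrite /im_part cImM.
  apply: eq_continuous (@continuous_prod_comb 1 1 _ _ _ _ f1 g2 f2 g1) => x.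
  by rewrite !mul1r.
- move=> i x; eexists.
  by apply: is_partialM; exact: diff1_is_partial.
Qed.

Lemma partial_lin a b f g i : diff1 f -> diff1 g ->
  partial i (fun x => a * f x + b * g x) =
  (fun x => a * partial i f x + b * partial i g x).
Proof.
move=> Hf Hg; apply/funext => x; apply: is_partialE.
by apply: is_partial_lin; exact: diff1_is_partial.
Qed.

Lemma partialM f g i : diff1 f -> diff1 g ->
  partial i (fun x => f x * g x) =
  (fun x => partial i f x * g x + f x * partial i g x).
Proof.
move=> Hf Hg; apply/funext => x; apply: is_partialE.
by apply: is_partialM; exact: diff1_is_partial.
Qed.

(** Closure properties of smooth functions follow from exhibiting a stable class, with no formula
    for the iterated derivatives. *)
Lemma smooth_coind (Q : set (Rn -> C)) : (forall f, Q f -> diff1 f) ->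
  (forall f i, Q f -> Q (partial i f)) -> forall f, Q f -> smooth f.
Proof.
move=> Qd Qp f Qf; apply/smoothP => s; apply: Qd.
by elim: s => //= i s IH; exact: Qp.
Qed.

Lemma smooth_diff1 f : smooth f -> diff1 f.
Proof. by move=> /smoothP /(_ [::]). Qed.

Lemma dseq_cat s s' f : dseq (s ++ s') f = dseq s (dseq s' f).
Proof. by rewrite /dseq foldr_cat. Qed.

Lemma dseq_rcons s i f : dseq (rcons s i) f = dseq s (partial i f).
Proof. by rewrite -cats1 dseq_cat. Qed.

Lemma smooth_dseq s f : smooth f -> smooth (dseq s f).
Proof. by move=> /smoothP Hf; apply/smoothP => s'; rewrite -dseq_cat. Qed.

Lemma smooth_partial i f : smooth f -> smooth (partial i f).
Proof. exact: (@smooth_dseq [:: i]). Qed.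

Lemma smooth_lin a b f g : smooth f -> smooth g -> smooth (fun x => a * f x + b * g x).
Proof.
move=> sf sg; apply: (@smooth_coind [set h | exists f g,
  [/\ smooth f, smooth g & h = fun x => a * f x + b * g x]]); last by exists f, g.
  by move=> _ [f' [g' [sf' sg' ->]]]; apply: diff1_lin; exact: smooth_diff1.
move=> _ i [f' [g' [sf' sg' ->]]]; exists (partial i f'), (partial i g').
rewrite partial_lin; [|exact: smooth_diff1 sf'|exact: smooth_diff1 sg'].
by split; [exact: smooth_partial sf'|exact: smooth_partial sg'|reflexivity].
Qed.

Lemma dseq_lin s a b f g : smooth f -> smooth g ->
  dseq s (fun x => a * f x + b * g x) = (fun x => a * dseq s f x + b * dseq s g x).
Proof.
move=> sf sg; elim: s => [//|i s IH]; rewrite [LHS]/= -/(dseq _ _) IH.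
by rewrite partial_lin; [|apply: smooth_diff1; exact: smooth_dseq..].
Qed.

Lemma smoothD f g : smooth f -> smooth g -> smooth (fun x => f x + g x).
Proof.
move=> sf sg; have := smooth_lin 1 1 sf sg; congr smooth.
by apply/funext => x; rewrite !mul1r.
Qed.

Lemma dseqD s f g : smooth f -> smooth g ->
  dseq s (fun x => f x + g x) = (fun x => dseq s f x + dseq s g x).
Proof.
move=> sf sg; have := dseq_lin s 1 1 sf sg.
have -> : (fun x => 1 * f x + 1 * g x) = (fun x => f x + g x).
  by apply/funext => x; rewrite !mul1r.
by move=> ->; apply/funext => x; rewrite !mul1r.
Qed.

(** Products alone are not stable under differentiation. Finite sums of products are, by the product
    rule, and form the class to which [smooth_coind] is applied. *)
Lemma smoothM f g : smooth f -> smooth g -> smooth (fun x => f x * g x).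
Proof.
move=> sf sg; pose Q : set (Rn -> C) := [set h | exists (l : seq ((Rn -> C) * (Rn -> C))),
  (forall p, List.In p l -> smooth p.1 /\ smooth p.2) /\
  h = fun x => \sum_(p <- l) p.1 x * p.2 x].
have Q0 : Q (fun=> 0).
  by exists [::]; split=> //; apply/funext => x; rewrite big_nil.
have diffQ h : Q h -> diff1 h.
  move=> [l [Hl ->]]; elim: l Hl => [_|p l IH Hl].
    have -> : (fun x : Rn => \sum_(p <- [::]) p.1 x * p.2 x : C) =
      (fun x => 0 * f x + 0 * f x).
      by apply/funext => x; rewrite big_nil !mul0r addr0.
    by apply: diff1_lin; exact: smooth_diff1.
  have -> : (fun x => \sum_(q <- p :: l) q.1 x * q.2 x) =
    (fun x => 1 * (p.1 x * p.2 x) + 1 * \sum_(q <- l) q.1 x * q.2 x).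
    by apply/funext => x; rewrite big_cons !mul1r.
  have [p1 p2] : smooth p.1 /\ smooth p.2 by apply: Hl; left.
  apply: diff1_lin; first by apply: diff1M; exact: smooth_diff1.
  by apply: IH => q ql; apply: Hl; right.
apply: (@smooth_coind Q diffQ); last first.
  exists [:: (f, g)]; split; first by move=> p [<-|[]]; split; [exact: sf|exact: sg].
  by apply/funext => x; rewrite big_seq1.
move=> _ i [l [Hl ->]]; elim: l Hl => [_|p l IH Hl].
  have -> : (fun x : Rn => \sum_(p <- [::]) p.1 x * p.2 x : C) =
    (fun x => 0 * f x + 0 * f x).
    by apply/funext => x; rewrite big_nil !mul0r addr0.
  rewrite partial_lin; [|exact: smooth_diff1..].
  by move: Q0; congr Q; apply/funext => x; rewrite !mul0r addr0.
have -> : (fun x => \sum_(q <- p :: l) q.1 x * q.2 x) =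
  (fun x => 1 * (p.1 x * p.2 x) + 1 * \sum_(q <- l) q.1 x * q.2 x).
  by apply/funext => x; rewrite big_cons !mul1r.
have [p1 p2] : smooth p.1 /\ smooth p.2 by apply: Hl; left.
have Hl' : forall q, List.In q l -> smooth q.1 /\ smooth q.2.
  by move=> q ql; apply: Hl; right.
rewrite partial_lin; last 2 first.
- by apply: diff1M; exact: smooth_diff1.
- by apply: diffQ; exists l.
rewrite partialM; [|exact: smooth_diff1..].
have [l' [Hl'' ->]] := IH Hl'.
exists [:: (partial i p.1, p.2), (p.1, partial i p.2) & l']; split.
  move=> q [<-|[<-|/Hl''//]].
    by split; [exact: smooth_partial p1|exact: p2].
  by split; [exact: p1|exact: smooth_partial p2].
by apply/funext => x; rewrite !big_cons !mul1r /= addrA.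
Qed.

Lemma smooth_cst (c : C) : smooth (fun _ : Rn => c).
Proof.
apply: (@smooth_coind [set h : Rn -> C | exists c : C, h = fun=> c]); last by exists c.
  move=> _ [d ->]; apply: diff1_of; [exact: cst_continuous..|].
  by move=> i x; exists 0; split; exact: is_derive_cst.
move=> _ i [d ->]; exists 0; apply/funext => x; apply: is_partialE.
by split; exact: is_derive_cst.
Qed.

Lemma partial_cst c i : partial i (fun=> c : C) = (fun=> 0) :> (Rn -> C).
Proof.
by apply/funext => x; apply: is_partialE; split; exact: is_derive_cst.
Qed.

Lemma dseq_cst c s : s != [::] -> dseq s (fun=> c : C) = (fun=> 0) :> (Rn -> C).
Proof.
elim: s => //= i [_ _|j s IH _]; first exact: partial_cst.
by rewrite IH// partial_cst.
Qed.

Lemma partialC f i j : smooth f -> partial i (partial j f) = partial j (partial i f).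
Proof.
move=> sf.
have d0' k y : derivable (re_part f) y (e k) /\ derivable (im_part f) y (e k).
  by have [_ _ H] := smooth_diff1 sf; exact: H.
have di' k l y : derivable (re_part (partial k f)) y (e l) /\
    derivable (im_part (partial k f)) y (e l).
  by have [_ _ H] := smooth_diff1 (smooth_partial k sf); exact: H.
have c k l : continuous (re_part (partial l (partial k f))).
  by have [H _ _] := smooth_diff1 (smooth_partial l (smooth_partial k sf)).
have c2 k l : continuous (im_part (partial l (partial k f))).
  by have [_ H _] := smooth_diff1 (smooth_partial l (smooth_partial k sf)).
apply/funext => x; apply: complex_ext => /=.
- apply: (@derive_comm R Rn (re_part f)).
  + move=> y; exact: (d0' j y).1.
  + move=> y; exact: (d0' i y).1.
  + move=> y; exact: (di' j i y).1.
  + move=> y; exact: (di' i j y).1.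
  + exact: c j i x.
  + exact: c i j x.
- apply: (@derive_comm R Rn (im_part f)).
  + move=> y; exact: (d0' j y).2.
  + move=> y; exact: (d0' i y).2.
  + move=> y; exact: (di' j i y).2.
  + move=> y; exact: (di' i j y).2.
  + exact: c2 j i x.
  + exact: c2 i j x.
Qed.

Lemma dseq_partial s f i : smooth f -> dseq s (partial i f) = partial i (dseq s f).
Proof.
move=> sf; elim: s => [//|j s IH]; rewrite [LHS]/= -/(dseq _ _) IH.
by rewrite partialC; [|exact: smooth_dseq].
Qed.

Lemma dseq_perm s s' f : smooth f -> perm_eq s s' -> dseq s f = dseq s' f.
Proof.
move=> sf; elim: s s' => [s' /perm_size/esym/size0nil -> //|i s IH s' ss'].
have is' : i \in s' by rewrite -(perm_mem ss') mem_head.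
move: ss'; case/splitPr: is' => s1 s2 ss'.
have /IH E : perm_eq s (s1 ++ s2).
  by rewrite -(perm_cons i) (perm_trans ss')// (perm_catCA s1 [:: i] s2).
rewrite [LHS]/= -/(dseq _ _) E -dseq_partial// !dseq_cat.
by rewrite [dseq (i :: s2) f]/= -/(dseq s2 f) dseq_partial.
Qed.

Definition mseq (a : multi_index N) : seq 'I_N :=
  flatten [seq nseq (a i) i | i <- enum 'I_N].

Lemma partialsE (a : multi_index N) f : partials a f = dseq (mseq a) f.
Proof.
rewrite /partials /mseq; elim: (enum _) => [//|i s IH] /=.
by rewrite dseq_cat -IH; elim: (a i) => [//|k IHk] /=; rewrite IHk.
Qed.

Lemma count_mseq (a : multi_index N) i : count_mem i (mseq a) = a i.
Proof.
rewrite /mseq count_flatten -map_comp.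
rewrite (eq_map (g := fun j => if j == i then a i else 0%N)); last first.
  by move=> j /=; rewrite count_nseq /=; case: eqP => [->|]; rewrite ?mul1n.
by rewrite sumnE big_map big_enum /= -big_mkcond /= big_pred1_eq.
Qed.

Lemma size_mseq (a : multi_index N) : size (mseq a) = mlen a.
Proof.
rewrite /mseq size_flatten /shape -map_comp sumnE big_map /mlen big_enum/=.
by apply: eq_bigr => i _; rewrite size_nseq.
Qed.

Lemma dseqE s f : smooth f -> exists a : multi_index N, dseq s f = partials a f /\ mlen a = size s.
Proof.
move=> sf; exists [ffun i => count_mem i s].
have p : perm_eq s (mseq [ffun i => count_mem i s : nat]).
  by apply/allP => i _ /=; rewrite count_mseq ffunE.
by rewrite -size_mseq (perm_size p) partialsE (dseq_perm sf p).
Qed.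

(** Only derivatives along the axes are at hand, and a dilation preserves the axes: the difference
    quotient at [x] is that of a function of one real variable at 0, to which the one-variable chain
    rule applies. *)
Lemma is_partial_affine f (x0 : Rn) (k : R) i x : k != 0 -> diff1 f ->
  is_partial (fun y => f (x0 + k *: y)) i x (k%:C%C * partial i f (x0 + k *: x)).
Proof.
move=> k0 Hf.
have key (F : Rn -> R) d : is_derive (x0 + k *: x) (e i) F d ->
    is_derive x (e i) (fun y => F (x0 + k *: y)) (k * d).
  move=> dF; have /is_derive_line : derivable F (x0 + k *: x + 0 *: e i) (e i).
    by rewrite scale0r addr0; exact: ex_derive.
  rewrite scale0r addr0 derive_val => D.
  have E : (fun h : R => h^-1 *: (((fun y => F (x0 + k *: y)) \o shift x) (h *: e i)
      - F (x0 + k *: x))) =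
    (fun h : R => h^-1 *: (((fun t : R => F (x0 + k *: x + (k * t) *: e i)) \o shift 0)
       (h *: 1) - F (x0 + k *: x + (k * 0) *: e i))).
    apply/funext => h /=; rewrite mulr0 scale0r addr0 /shift/= addr0 scaler1.
    by congr (_ *: (F _ - _)); rewrite scalerDr scalerA addrA addrAC.
  have D2 : is_derive (0 : R) (1 : R) (fun t : R => F (x0 + k *: x + (k * t) *: e i)) (k * d).
    have D' : is_derive (k * 0) (1 : R) (fun t : R => F (x0 + k *: x + t *: e i)) d.
      by rewrite mulr0; exact: D.
    have Dk : is_derive (0 : R) (1 : R) (fun t : R => k * t) k.
      by apply: is_derive_eq; rewrite /GRing.scale/= mulr1.
    by rewrite mulrC; exact: (is_derive1_comp D' Dk).
  have [D21 D22] := D2.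
  by split; rewrite /derivable /derive E.
have [p1 p2] := diff1_is_partial i (x0 + k *: x) Hf.
by split; rewrite ?cReM ?cImM /= ?mul0r ?subr0 ?addr0; exact: key.
Qed.

Lemma diff1_affine f (x0 : Rn) (k : R) : k != 0 -> diff1 f ->
  diff1 (fun y => f (x0 + k *: y)).
Proof.
move=> k0 Hf; have [c1 c2 _] := Hf.
have ca : continuous (fun y : Rn => x0 + k *: y).
  move=> y; apply: (@continuousD R Rn _ (fun=> x0) (fun y => k *: y) y).
    exact: cst_continuous.
  exact: scaler_continuous.
apply: diff1_of.
- move=> x; exact: (@continuous_comp _ _ _ (fun y => x0 + k *: y) (re_part f) x (ca x) (c1 _)).
- move=> x; exact: (@continuous_comp _ _ _ (fun y => x0 + k *: y) (im_part f) x (ca x) (c2 _)).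
- by move=> i x; eexists; exact: is_partial_affine.
Qed.

Lemma partial_affine f (x0 : Rn) (k : R) i : k != 0 -> diff1 f ->
  partial i (fun y => f (x0 + k *: y)) =
  (fun y => k%:C%C * partial i f (x0 + k *: y)).
Proof.
by move=> k0 Hf; apply/funext => x; apply: is_partialE; exact: is_partial_affine.
Qed.

Lemma partialZ a f i : diff1 f -> partial i (fun x => a * f x) = (fun x => a * partial i f x).
Proof.
move=> Hf; have := partial_lin a 0 i Hf Hf.
have -> : (fun x => a * f x + 0 * f x) = (fun x => a * f x).
  by apply/funext => x; rewrite mul0r addr0.
by move=> ->; apply/funext => x; rewrite mul0r addr0.
Qed.

Lemma diff1Z a f : diff1 f -> diff1 (fun x => a * f x).
Proof.
move=> Hf; have := diff1_lin a 0 Hf Hf.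
have -> : (fun x => a * f x + 0 * f x) = (fun x => a * f x).
  by apply/funext => x; rewrite mul0r addr0.
by [].
Qed.

Lemma smoothZ a f : smooth f -> smooth (fun x => a * f x).
Proof.
move=> sf; have := smooth_lin a 0 sf sf.
have -> : (fun x => a * f x + 0 * f x) = (fun x => a * f x).
  by apply/funext => x; rewrite mul0r addr0.
by [].
Qed.

Lemma dseqZ s a f : smooth f -> dseq s (fun x => a * f x) = (fun x => a * dseq s f x).
Proof.
move=> sf; elim: s => [//|i s IH]; rewrite [LHS]/= -/(dseq _ _) IH.
by rewrite partialZ; [|apply: smooth_diff1; exact: smooth_dseq].
Qed.

Lemma dseq_affine s f (x0 : Rn) (k : R) : k != 0 -> smooth f ->
  dseq s (fun y => f (x0 + k *: y)) =
  (fun y => (k ^+ size s)%:C%C * dseq s f (x0 + k *: y)).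
Proof.
move=> k0 sf; elim: s => [|i s IH].
  by apply/funext => x; rewrite expr0 mul1r.
rewrite [LHS]/= -/(dseq _ _) IH partialZ; last first.
  by apply: diff1_affine => //; apply/smooth_diff1/smooth_dseq.
rewrite partial_affine; [|exact: k0|by apply/smooth_diff1/smooth_dseq].
by apply/funext => x; rewrite mulrA -rmorphM/= exprSr.
Qed.

Lemma smooth_affine f (x0 : Rn) (k : R) : k != 0 -> smooth f ->
  smooth (fun y => f (x0 + k *: y)).
Proof.
move=> k0 sf; apply/smoothP => s; rewrite dseq_affine//.
by apply/diff1Z/diff1_affine => //; apply/smooth_diff1/smooth_dseq.
Qed.

End smooth_functions.

(** * Test functions and their seminorms *)

Section euclidean_norm.
Context {R : realType} {N : nat}.
Local Notation Rn := 'rV[R]_N.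
Implicit Types x y : Rn.

Lemma enorm_ge0 x : 0 <= enorm x.
Proof. exact: sqrtr_ge0. Qed.

Lemma coord_le_norm x i : `|x 0 i| <= `|x|.
Proof.
have /mapP[j Hj ->] : `|x 0 i| \in [seq `|x k.1 k.2| | k : 'I_1 * 'I_N].
  by apply/mapP; exists (ord0, i) => //=; rewrite mem_enum.
by rewrite [leRHS]/Num.Def.normr /= mx_normrE; apply/bigmax_geP; right => /=; exists j.
Qed.

Lemma coord_le_enorm x i : `|x 0 i| <= enorm x.
Proof.
rewrite -sqrtr_sqr ler_wsqrtr// (bigD1 i)//= lerDl.
by apply: sumr_ge0 => j _; exact: sqr_ge0.
Qed.

Lemma norm_le_enorm x : `|x| <= enorm x.
Proof.
rewrite [leLHS]/Num.Def.normr /= mx_normrE; apply/bigmax_leP; split; first exact: enorm_ge0.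
by move=> [i j] _ /=; rewrite (ord1 i); exact: coord_le_enorm.
Qed.

Lemma enorm_le_sum x : enorm x <= \sum_(i < N) `|x 0 i|.
Proof.
have s0 : 0 <= \sum_(i < N) `|x 0 i| by apply: sumr_ge0 => i _.
rewrite -[leRHS]ger0_norm// -sqrtr_sqr ler_wsqrtr//.
rewrite [leRHS]expr2 mulr_suml; apply: ler_sum => i _.
rewrite -[x 0 i ^+ 2]ger0_norm ?sqr_ge0// normrX expr2 ler_wpM2l//.
by rewrite (bigD1 i)//= lerDl; apply: sumr_ge0 => j _.
Qed.

Lemma enorm_le_norm x : enorm x <= N%:R * `|x|.
Proof.
apply: le_trans (enorm_le_sum x) _.
apply: (@le_trans _ _ (\sum_(i < N) `|x|)).
  by apply: ler_sum => i _; exact: coord_le_norm.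
by rewrite sumr_const card_ord mulr_natl.
Qed.

End euclidean_norm.

Section weight_growth.
Context {R : realType} (omega : R -> R).
Hypothesis homega : nonquasianalytic_weight omega.

Lemma weight_affine k c : exists2 A, 0 < A & forall s t, 0 <= s -> 0 <= t ->
  s <= 2 ^+ k * t + c -> omega s <= A * (1 + omega t).
Proof.
have [A A0 HA] := weight_shift homega c; have [B B0 HB] := weight_scale homega k.
exists (A * (1 + B)); first by rewrite mulr_gt0// addr_gt0.
move=> s t s0 t0 st; apply: le_trans (HA s (2 ^+ k * t) s0 _ st) _.
  by rewrite mulr_ge0// exprn_ge0.
rewrite -mulrA; apply: (ler_wpM2l (ltW A0)).
rewrite [leRHS]mulrDl mul1r lerD ?HB//.
by have := weight_ge0 homega t0; lra.
Qed.

(** The weight tends to infinity by (gamma). This is what makes the error of a cutoff negligible far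
    from the origin. *)
Lemma weight_coercive d : 0 < d -> exists B, forall t, B <= t -> 0 <= t ->
  expR (- omega t) <= d.
Proof.
move=> d0; have [n [C [n0 C0 HC]]] := weight_log homega 1.
exists (C / d ^+ n) => t Bt t0; rewrite leNgt; apply/negP => dlt.
have := HC _ t0; rewrite expr1.
have : expR (n%:R * omega t) <= d ^- n.
  rewrite expRM_natl -[expR (omega t)]invrK -expRN -exprVn.
  apply: lerXn2r; rewrite ?nnegrE ?invr_ge0 ?expR_ge0 ?ltW//.
  by rewrite ltf_pV2 ?posrE ?expR_gt0.
move=> /(ler_wpM2l (ltW C0)) h1 h2; have := le_trans (le_trans h2 h1) Bt; lra.
Qed.
End weight_growth.

Section support.
Context {R : realType} {N : nat}.
Local Notation C := R[i].
Local Notation Rn := 'rV[R]_N.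
Implicit Types (f g : Rn -> C) (s : seq 'I_N) (x y : Rn).

(** A pointwise form of compact support; the norm on row vectors is the maximum norm. *)
Definition supp_le (B : R) f := forall x, B < `|x| -> f x = 0.

Lemma vanish_dseq (Q : set Rn) f s : closed Q -> (forall x, ~ Q x -> f x = 0) ->
  forall x, ~ Q x -> dseq s f x = 0.
Proof.
move=> cQ fQ; elim: s => [//|i s IH] x nQx.
have nB : nbhs x (~` Q) by apply: open_nbhs_nbhs; split=> //; exact: closed_openC.
apply: complex_ext => /=.
- rewrite (@near_eq_derive _ _ _ _ (fun=> 0)) ?derive_cst//.
  by apply: filterS nB => y /IH fy; rewrite -[LHS]/(complex.Re (dseq s f y)) fy.
- rewrite (@near_eq_derive _ _ _ _ (fun=> 0)) ?derive_cst//.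
  by apply: filterS nB => y /IH fy; rewrite -[LHS]/(complex.Im (dseq s f y)) fy.
Qed.

Lemma closed_norm_le (B : R) : closed [set x : Rn | `|x| <= B].
Proof.
apply: (@preimage_closed _ _ (fun x : Rn => `|x|) [set r | r <= B]); last exact: closed_le.
by move=> y _; exact: norm_continuous.
Qed.

Lemma supp_le_dseq B f s : supp_le B f -> supp_le B (dseq s f).
Proof.
move=> fB x Bx; apply: (vanish_dseq s (@closed_norm_le B)); last first.
  by move=> /=; rewrite leNgt Bx.
by move=> y /negP; rewrite -ltNge; exact: fB.
Qed.

Lemma supp_leP f : (exists2 Q, compact Q & supp f `<=` Q) <-> exists B, supp_le B f.
Proof.
split=> [[Q cQ fQ]|[B fB]].
  have [M [_ MQ]] := compact_bounded cQ.
  exists (M + 1) => x Mx; apply: contrapT => fx.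
  have : `|x| <= M + 1.
    apply: MQ; first lra.
    by apply/fQ/subset_closure; exact/eqP.
  by rewrite leNgt Mx.
have cB := @closed_norm_le B.
exists [set x : Rn | `|x| <= B].
  apply: bounded_closed_compact => //.
  by exists B; split; [exact: num_real|move=> r Br x /= /le_trans -> //; exact: ltW].
rewrite [X in _ `<=` X](closure_id _).1//.
apply: closure_subset => x /eqP fx /=; rewrite leNgt; apply/negP => /fB.
exact: fx.
Qed.

End support.

Section seminorms.
Context {R : realType} {N : nat} (omega : R -> R).
Hypothesis homega : nonquasianalytic_weight omega.
Local Notation C := R[i].
Local Notation Rn := 'rV[R]_N.
Local Notation cw := (cw omega).
Local Notation w x := (omegaN omega x).
Implicit Types (f g : Rn -> C) (s : seq 'I_N) (x y : Rn) (m n : nat) (K : R).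

Lemma omegaN_ge0 x : 0 <= w x.
Proof. by rewrite (weight_ge0 homega)// enorm_ge0. Qed.

(** Seminorm inequalities are handled as real bounds over all words, which keeps extended reals and
    the possible infiniteness of the norms out of the estimates. *)
Definition D_bound m f K := forall s x, cabs (dseq s f x) * cw m (size s) <= K.

Definition O_bound m n f K := forall s x,
  cabs (dseq s f x) * expR (- (n%:R * w x)) * cw m (size s) <= K.

Lemma O_norm_le m n f K : smooth f ->
  (O_norm omega m n%:Z f <= K%:E)%E <-> O_bound m n f K.
Proof.
move=> sf.
have E (a : multi_index N) x : ((cabs (partials a f x))%:E *
    expeR ((- (n%:~R * w x))%:E - young_weight omega m a))%E =
    (cabs (dseq (mseq a) f x) * expR (- (n%:R * w x)) * cw m (size (mseq a)))%:E.
  by rewrite expeRD cw_young_weight// partialsE size_mseq muleA.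
split=> [H s x|H].
  have [a [aE asz]] := dseqE s sf.
  rewrite aE -asz partialsE -size_mseq -lee_fin -E; apply: le_trans H.
  by apply: ereal_sup_ubound; exists a, x.
by apply: ge_ereal_sup => _ [a [x ->]]; rewrite E lee_fin; exact: H.
Qed.

(** [0 <= K] covers the points off [Q], which the supremum does not see. *)
Lemma D_norm_le Q m f K : smooth f -> 0 <= K ->
  (forall x, ~ Q x -> forall s, dseq s f x = 0) ->
  (D_norm omega Q m f <= K%:E)%E <-> D_bound m f K.
Proof.
move=> sf K0 Qf.
have E (a : multi_index N) x : ((cabs (partials a f x))%:E *
    expeR (- young_weight omega m a))%E =
    (cabs (dseq (mseq a) f x) * cw m (size (mseq a)))%:E.
  by rewrite cw_young_weight// partialsE size_mseq.
split=> [H s x|H].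
  have [Qx|nQx] := pselect (Q x); last by rewrite Qf// cabs0 mul0r.
  have [a [aE asz]] := dseqE s sf.
  rewrite aE -asz partialsE -size_mseq -lee_fin -E; apply: le_trans H.
  by apply: ereal_sup_ubound; exists a, x.
by apply: ge_ereal_sup => _ [a [x [Qx ->]]]; rewrite E lee_fin; exact: H.
Qed.

Lemma O_norm_ge0 m n f : (0 <= O_norm omega m n f)%E.
Proof.
apply: le_trans (ereal_sup_ubound _); last first.
  by exists ([ffun=> 0%N] : multi_index N), (0 : Rn); reflexivity.
by apply: mule_ge0; rewrite ?lee_fin ?cabs_ge0 ?expeR_ge0.
Qed.

(** Meaningful under an [O_bound] only: [fine] sends an infinite norm to 0. *)
Definition onorm m n f : R := fine (O_norm omega m n%:Z f).

Lemma O_norm_fin m n f K : smooth f -> O_bound m n f K ->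
  O_norm omega m n%:Z f = (onorm m n f)%:E.
Proof.
move=> sf /(O_norm_le _ _ _ sf) fK; rewrite fineK// ge0_fin_numE ?O_norm_ge0//.
exact: le_lt_trans fK (ltry _).
Qed.

Lemma onorm_bound m n f K : smooth f -> O_bound m n f K -> O_bound m n f (onorm m n f).
Proof.
by move=> sf fK; apply/O_norm_le => //; rewrite (O_norm_fin sf fK).
Qed.

Lemma onorm_le m n f K : smooth f -> O_bound m n f K -> onorm m n f <= K.
Proof.
by move=> sf fK; rewrite -lee_fin -(O_norm_fin sf fK); apply/O_norm_le.
Qed.

Lemma onorm_ge0 m n f : 0 <= onorm m n f.
Proof. by rewrite fine_ge0// O_norm_ge0. Qed.

Lemma elements_O_step m n f :
  elements (O_step omega m n%:Z) f <-> smooth f /\ exists K, O_bound m n f K.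
Proof.
split=> [[sf foo]|[sf [K fK]]]; split=> //.
  exists (onorm m n f); apply/O_norm_le => //; rewrite fineK//.
  by rewrite ge0_fin_numE ?O_norm_ge0.
by rewrite (O_norm_fin sf fK) ltry.
Qed.

Lemma elements_D_omega f : elements (D_omega omega) f <->
  [/\ smooth f, exists B, supp_le B f & forall m, (0 < m)%N -> exists K, D_bound m f K].
Proof.
split=> [[Q cQ [sf fQ fD]]|[sf fB fD]].
  split=> //; first by apply/supp_leP; exists Q.
  move=> m m0; have Doo := fD m m0.
  have Qf x : ~ supp f x -> forall s, dseq s f x = 0.
    move=> nx s; apply: (vanish_dseq s (@closed_closure _ _)) nx => y ny.
    by apply: contrapT => fy; apply: ny; apply: subset_closure; exact/eqP.
  have [K [K0 HK]] : exists K, 0 <= K /\ (D_norm omega Q m f <= K%:E)%E.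
    move: Doo; case: (D_norm omega Q m f) => // [r _|_].
      by exists (Num.max 0 r); rewrite lee_fin !le_max !lexx orbT.
    by exists 0; rewrite leNye.
  have QQ x : ~ Q x -> forall s, dseq s f x = 0.
    by move=> nQx; apply: Qf => /fQ.
  by exists K; exact: (D_norm_le m sf K0 QQ).1 HK.
have [B fBB] := fB.
have Qf x : ~ [set x | `|x| <= B] x -> forall s, dseq s f x = 0.
  by move=> /negP; rewrite -ltNge => Bx s; exact: supp_le_dseq Bx.
have [Q cQ fQ] := (supp_leP f).2 fB.
exists Q => //; split=> // m m0; have [K HK] := fD m m0.
have K0 : 0 <= K.
  by apply: le_trans (HK [::] 0); rewrite mulr_ge0 ?cabs_ge0 ?cw_ge0.
have suppf x : ~ Q x -> forall s, dseq s f x = 0.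
  move=> nx s; apply: (vanish_dseq s (@closed_closure _ [set x | f x != 0])).
    move=> y ny; apply: contrapT => fy; apply: ny; apply: subset_closure; exact/eqP.
  by move=> /fQ.
exact: le_lt_trans ((D_norm_le m sf K0 suppf).2 HK) (ltry _).
Qed.

Lemma D_boundL a b m f g K L : smooth f -> smooth g -> D_bound m f K -> D_bound m g L ->
  D_bound m (fun x => a * f x + b * g x) (cabs a * K + cabs b * L).
Proof.
move=> sf sg fK gL s x; rewrite dseq_lin//.
apply: (@le_trans _ _ ((cabs a * cabs (dseq s f x) + cabs b * cabs (dseq s g x)) * cw m (size s))).
  by rewrite ler_wpM2r ?cw_ge0// (le_trans (cabsD _ _))// !cabsM.
by rewrite mulrDl -!mulrA lerD// ler_wpM2l ?cabs_ge0.
Qed.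

Lemma D_omegaL a b f g : elements (D_omega omega) f -> elements (D_omega omega) g ->
  elements (D_omega omega) (fun x => a * f x + b * g x).
Proof.
move=> /elements_D_omega[sf [B fB] fD] /elements_D_omega[sg [B' gB] gD].
apply/elements_D_omega; split; first exact: smooth_lin.
  exists (Num.max B B') => x; rewrite gt_max => /andP[/fB -> /gB ->].
  by rewrite !mulr0 addr0.
move=> m m0; have [K fK] := fD m m0; have [L gL] := gD m m0.
by exists (cabs a * K + cabs b * L); exact: D_boundL.
Qed.

Lemma D_omegaZ a f : elements (D_omega omega) f ->
  elements (D_omega omega) (fun x => a * f x).
Proof.
move=> Df; have := D_omegaL a 0 Df Df.
have -> : (fun x => a * f x + 0 * f x) = (fun x => a * f x).
  by apply/funext => x; rewrite mul0r addr0.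
by [].
Qed.

Lemma O_bound_mono m m' n n' f K : (0 < m)%N -> (m <= m')%N -> (n' <= n)%N ->
  O_bound m' n' f K -> O_bound m n f K.
Proof.
move=> m0 mm nn fK s x; apply: le_trans (fK s x).
rewrite -!mulrA ler_wpM2l ?cabs_ge0//; apply: ler_pM; rewrite ?expR_ge0 ?cw_ge0//.
  by rewrite ler_expR lerN2 ler_wpM2r ?omegaN_ge0// ler_nat.
exact: cw_mono.
Qed.

Lemma D_bound_O m n f K : D_bound m f K -> O_bound m n f K.
Proof.
move=> fK s x; apply: le_trans (fK s x); rewrite ler_wpM2r ?cw_ge0//.
rewrite ler_piMr ?cabs_ge0// -expR0 ler_expR oppr_le0.
by rewrite mulr_ge0 ?omegaN_ge0.
Qed.

Lemma D_omega_sub_O_step m n f : (0 < m)%N -> elements (D_omega omega) f ->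
  elements (O_step omega m n%:Z) f.
Proof.
move=> m0 /elements_D_omega[sf _ /(_ _ m0)[K fK]]; apply/elements_O_step; split=> //.
by exists K; exact: D_bound_O.
Qed.

Lemma D_omega_sub_O_M f : elements (D_omega omega) f -> elements (O_M omega) f.
Proof.
move=> Df; rewrite /O_M /= => m m0; exists 1%N => //.
exact: (@D_omega_sub_O_step m 1).
Qed.

(* Continuity of [T] for the topology of ind_n O^m_n, expressed on test functions. *)
Definition O_bounded (T : (Rn -> C) -> C) (m : nat) :=
  forall n, (0 < n)%N -> exists2 A, 0 <= A & forall f K,
    elements (D_omega omega) f -> O_bound m n f K -> cabs (T f) <= A * K.

Lemma O_boundZ m n f K a : smooth f -> O_bound m n f K ->
  O_bound m n (fun x => a * f x) (cabs a * K).
Proof.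
move=> sf fK s x; rewrite dseqZ// cabsM -!mulrA ler_wpM2l ?cabs_ge0// mulrA.
exact: fK.
Qed.

(** A basic neighbourhood of 0 in the projective limit constrains finitely many indices m. Since a
    bound for a larger index implies the same bound for a smaller one, a single index above all of
    them suffices. *)
Lemma in_dual_O_bounded T : in_dual_O_M omega T ->
  exists2 m, (0 < m)%N & O_bounded T m.
Proof.
move=> [S [SL Sc] ST].
have O0 : elements (O_M omega) (fun _ : Rn => 0 : C).
  apply/D_omega_sub_O_M/elements_D_omega; split; first exact: smooth_cst.
    by exists 0.
  move=> m m0; exists 0 => s x.
  have [->|s0] := eqVneq s [::]; first by rewrite cabs0 mul0r.
  by rewrite dseq_cst// cabs0 mul0r.
have S0 : S (fun=> 0) = 0.
  transitivity (S (fun x => 0 * (fun=> 0) x + 0 * (fun=> 0) x)).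
    by congr S; apply/funext => x; rewrite !mul0r addr0.
  by rewrite SL//; ring.
have [l [V [lV H]]] := Sc _ O0 _ ltr01.
(* The successor keeps [M] positive even when the list is empty. *)
pose M := (\max_(j <- l) j).+1.
exists M => // n n0.
have key : exists2 e : R, 0 < e & forall f, elements (D_omega omega) f ->
    O_bound M n f e -> cabs (T f) <= 1.
  have [e [e0 He]] : exists e : R, 0 < e /\ forall j, j \in l -> forall f,
      elements (O_step omega j n%:Z) f -> O_bound j n f e -> V j f.
    have {H} : forall j, j \in l -> exists e : R, 0 < e /\ forall f,
      elements (O_step omega j n%:Z) f -> O_bound j n f e -> V j f.
      move=> j jl; have [j0 [W [_ _ WV WO]]] := lV j jl.
      have [s [e [e0 We]]] := WO n n0.
      exists (e / 2); split; first by rewrite divr_gt0.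
      move=> f Ef fe; apply/WV/We => // -[] _.
      apply: (@le_lt_trans _ _ (e / 2)%:E); last by rewrite lte_fin; lra.
      by apply/O_norm_le => //; exact: Ef.1.
    elim: (l) => [|j l' IH] Hl; first by exists 1.
    have [e1 [e10 H1]] := Hl j (mem_head _ _).
    have [|e2 [e20 H2]] := IH; first by move=> k kl; apply: Hl; rewrite inE kl orbT.
    exists (Num.min e1 e2); split; first by rewrite lt_min e10.
    have mine k n' f : O_bound k n' f (Num.min e1 e2) -> O_bound k n' f e1 /\ O_bound k n' f e2.
      by move=> fe; split=> s x; have := fe s x; rewrite le_min => /andP[].
    move=> k; rewrite inE => /predU1P[->|kl] f Ef /mine[f1 f2].
      exact: H1.
    exact: (H2 k).
  exists e => // f Df fe.
  have Of := D_omega_sub_O_M Df.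
  have := H f Of; rewrite -(ST _ Df) => Hf.
  have {}Hf : cabs (S (fun x => 0 + f x) - S (fun=> 0)) < 1.
    apply: Hf => j jl; have [j0 _] := lV j jl; apply: (He j jl).
      exact: D_omega_sub_O_step.
    apply: O_bound_mono fe => //.
    by rewrite /M ltnW// ltnS; exact: leq_bigmax_seq.
  rewrite S0 subr0 in Hf; apply: ltW; move: Hf; congr (cabs (S _) < 1).
  by apply/funext => x; rewrite add0r.
have [e e0 He] := key; exists e^-1; first by rewrite invr_ge0 ltW.
move=> f K Df fK; have [sf _ _] := (elements_D_omega f).1 Df.
have K0 : 0 <= K.
  apply: le_trans (fK [::] 0); rewrite !mulr_ge0 ?cabs_ge0 ?expR_ge0 ?cw_ge0//.
have Of := D_omega_sub_O_M Df.
(* Homogeneity would divide by [K], which may be 0; hence [K + d], with [d] tending to 0 at the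
   end. *)
have KE : forall d, 0 < d -> cabs (T f) <= e^-1 * (K + d).
  move=> d d0; have Kd : 0 < K + d by lra.
  pose a : C := (e / (K + d))%:C%C.
  have ca : cabs a = e / (K + d) by rewrite cabs_real ger0_norm// divr_ge0 ?ltW.
  have Da : elements (D_omega omega) (fun x => a * f x) by exact: D_omegaZ.
  have Ta : T (fun x => a * f x) = a * T f.
    rewrite -(ST _ Da) -(ST _ Df).
    transitivity (S (fun x => a * f x + 0 * f x)).
      by congr S; apply/funext => x; rewrite mul0r addr0.
    by rewrite SL// mul0r addr0.
  have := He _ Da; rewrite Ta cabsM ca => /(_ _)H1.
  have {}H1 : e / (K + d) * cabs (T f) <= 1.
    apply: H1 => s x; apply: le_trans (O_boundZ a sf fK s x) _.
    by rewrite ca mulrAC ler_pdivrMr// ler_pM2l//; lra.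
  rewrite mulrC ler_pdivlMr// mulrC.
  by move: H1; rewrite mulrAC ler_pdivrMr// mul1r.
apply/ler_addgt0Pl => d d0; apply: le_trans (KE (e * d) _) _; first exact: mulr_gt0.
by rewrite mulrDr mulKf ?gt_eqF// addrC.
Qed.
End seminorms.

(** * Products and dilations of test functions *)

Section leibniz_and_cutoffs.
Context {R : realType} {N : nat} (omega : R -> R).
Hypothesis homega : nonquasianalytic_weight omega.
Local Notation C := R[i].
Local Notation Rn := 'rV[R]_N.
Local Notation cw := (cw omega).
Local Notation w x := (omegaN omega x).
Implicit Types (f g : Rn -> C) (s : seq 'I_N) (x y : Rn) (m n : nat) (K : R).

(** Leibniz rule by induction on the word: its last letter falls on either factor, which doubles the
    bound. [u] and [v] count the letters already moved onto [f] and [g], so the hypothesis on a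
    derivative of [f] is the one on [f] with [u] increased. On the empty word [cwD_le] splits the
    weight. *)
Let dseqM_shift m s f g x F G u v : (0 < m)%N -> smooth f -> smooth g ->
  (forall s, cabs (dseq s f x) * cw m (size s + u) <= F) ->
  (forall s, cabs (dseq s g x) * cw m (size s + v) <= G) ->
  cabs (dseq s (fun y => f y * g y) x) * cw m (size s + u + v) <= 2 ^+ size s * (F * G).
Proof.
move=> m0; elim/last_ind: s f g u v => [|s i IH] f g u v sf sg fF gG.
  rewrite expr0 mul1r /= cabsM add0n.
  apply: (@le_trans _ _ ((cabs (f x) * cw m u) * (cabs (g x) * cw m v))).
    by rewrite mulrACA ler_wpM2l ?mulr_ge0 ?cabs_ge0//; exact: cwD_le.
  by apply: ler_pM; rewrite ?mulr_ge0 ?cabs_ge0 ?cw_ge0//; [exact: (fF [::])|exact: (gG [::])].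
rewrite dseq_rcons partialM; [|exact: smooth_diff1..].
have sf' := smooth_partial i sf; have sg' := smooth_partial i sg.
rewrite dseqD; [|exact: smoothM|exact: smoothM].
have h1 : cabs (dseq s (fun y => partial i f y * g y) x) * cw m (size s + u.+1 + v) <=
    2 ^+ size s * (F * G).
  apply: IH => // s'; have := fF (rcons s' i).
  by rewrite dseq_rcons size_rcons addSnnS.
have h2 : cabs (dseq s (fun y => f y * partial i g y) x) * cw m (size s + u + v.+1) <=
    2 ^+ size s * (F * G).
  apply: IH => // s'; have := gG (rcons s' i).
  by rewrite dseq_rcons size_rcons addSnnS.
rewrite size_rcons; have -> : 2 ^+ (size s).+1 * (F * G) = 2 ^+ size s * (F * G) + 2 ^+ size s * (F * G).
  by rewrite exprS; ring.
rewrite !addSn; rewrite !addnS !addSn in h1 h2.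
apply: le_trans (lerD h1 h2); rewrite -mulrDl ler_wpM2r ?cw_ge0//.
exact: cabsD.
Qed.

(** [cw_geom] trades the 2^|s| terms of the Leibniz rule for a larger index. The estimate is made at
    a single point, so that growth and decay in [x] can be distributed freely over the two
    factors. *)
Lemma dseqM_bound m : (0 < m)%N -> exists M A, [/\ (m <= M)%N, 0 < A &
  forall f g x F G, smooth f -> smooth g ->
    (forall s, cabs (dseq s f x) * cw M (size s) <= F) ->
    (forall s, cabs (dseq s g x) * cw M (size s) <= G) ->
    forall s, cabs (dseq s (fun y => f y * g y) x) * cw m (size s) <= A * (F * G)].
Proof.
move=> m0; have [M [A [mM A0 HA]]] := cw_geom homega m0.
exists M, A; split=> // f g x F G sf sg fF gG s.
have M0 : (0 < M)%N by exact: leq_trans mM.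
have h : cabs (dseq s (fun y => f y * g y) x) * cw M (size s) <= 2 ^+ size s * (F * G).
  have := @dseqM_shift M s f g x F G 0 0 M0 sf sg; rewrite !addn0; apply.
    by move=> s'; rewrite addn0.
  by move=> s'; rewrite addn0.
have p2 : 0 < 2 ^+ size s :> R by rewrite exprn_gt0.
rewrite -(ler_pM2l p2).
apply: (@le_trans _ _ (cabs (dseq s (fun y => f y * g y) x) * (A * cw M (size s)))).
  by rewrite mulrCA ler_wpM2l ?cabs_ge0.
by rewrite mulrCA [leRHS]mulrCA ler_pM2l.
Qed.

Lemma D_omegaM f g : elements (D_omega omega) f -> elements (D_omega omega) g ->
  elements (D_omega omega) (fun x => f x * g x).
Proof.
move=> /elements_D_omega[//|sf [B fB] fD] /elements_D_omega[//|sg _ gD].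
apply/(elements_D_omega homega); split; first exact: smoothM.
  by exists B => x /fB ->; rewrite mul0r.
move=> m m0; have [M [A [mM A0 HA]]] := dseqM_bound m0.
have M0 : (0 < M)%N by exact: leq_trans mM.
have [K fK] := fD M M0; have [L gL] := gD M M0.
by exists (A * (K * L)) => s x; apply: HA.
Qed.

Lemma D_omega_decay m k f : (0 < m)%N -> elements (D_omega omega) f ->
  exists K, forall s x, cabs (dseq s f x) * cw m (size s) <= K * expR (- (k%:R * w x)).
Proof.
move=> m0 /elements_D_omega[//|sf [B fB] /(_ m m0)[K fK]].
have K0 : 0 <= K by apply: le_trans (fK [::] 0); rewrite mulr_ge0 ?cabs_ge0 ?cw_ge0.
(* N |B| bounds the Euclidean norm on the ball of radius B for the maximum norm. *)
exists (K * expR (k%:R * omega (N%:R * `|B|))) => s x.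
have [xB|Bx] := leP `|x| B; last first.
  rewrite (supp_le_dseq s fB Bx) cabs0 mul0r mulr_ge0 ?expR_ge0// mulr_ge0 ?expR_ge0//.
rewrite -mulrA -expRD; apply: le_trans (fK s x) _; rewrite ler_peMr//.
rewrite leNgt expR_lt1 -leNgt -mulrBr mulr_ge0// subr_ge0.
apply: (weight_nondecreasing homega); first exact: enorm_ge0.
apply: le_trans (enorm_le_norm x) _. apply: ler_wpM2l; first exact: ler0n.
exact: le_trans xB (ler_norm B).
Qed.

Lemma D_omega_affine f (x0 : Rn) (k : R) : 0 < k -> k <= 1 ->
  elements (D_omega omega) f -> elements (D_omega omega) (fun y => f (x0 + k *: y)).
Proof.
move=> k0 k1 /elements_D_omega[//|sf [B fB] fD].
have kn0 : k != 0 by rewrite gt_eqF.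
apply/(elements_D_omega homega); split; first exact: smooth_affine.
  exists ((B + `|x0|) / k) => x; rewrite ltr_pdivrMr// => Bx; apply: fB.
  rewrite -ltrBDr in Bx; apply: lt_le_trans Bx _.
  have := ler_normB (x0 + k *: x) x0; rewrite addrC addKr normrZ gtr0_norm//.
  by rewrite lerBlDr mulrC.
move=> m m0; have [K fK] := fD m m0; exists K => s x.
rewrite dseq_affine// cabsM cabs_real normrX gtr0_norm//.
apply: le_trans (fK s (x0 + k *: x)); rewrite ler_wpM2r ?cw_ge0//.
by rewrite ler_piMl ?cabs_ge0// exprn_ile1// ltW.
Qed.

Section cutoff.
Variables (psi : Rn -> C) (x0 : Rn).
Hypothesis Dpsi : elements (D_omega omega) psi.
Hypothesis psi0 : psi x0 != 0.

Definition cutoff (k : R) : Rn -> C := fun x => (psi x0)^-1 * psi (x0 + k *: x).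

Lemma D_omega_cutoff k : 0 < k -> k <= 1 -> elements (D_omega omega) (cutoff k).
Proof.
by move=> k0 k1; apply: D_omegaZ => //; exact: D_omega_affine.
Qed.

(** The function itself is close to 1 near the origin by continuity of [psi] at [x0]; far away exp
    (- omega) beats the uniform bound on [psi]. A derivative of order at least 1 carries a factor
    [k], as [k <= 1]. *)
Lemma cutoff_cvg m d : (0 < m)%N -> 0 < d -> exists k, [/\ 0 < k, k <= 1 &
  O_bound omega m 1 (fun x => cutoff k x - 1) d].
Proof.
move=> m0 d0; have [spsi _ /(_ m m0)[K psiK]] := (elements_D_omega homega _).1 Dpsi.
have K0 : 0 <= K by apply: le_trans (psiK [::] 0); rewrite mulr_ge0 ?cabs_ge0 ?cw_ge0.
pose c := cabs (psi x0)^-1; have c0 : 0 <= c by exact: cabs_ge0.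
have cut_le k x : 0 <= k -> cabs (cutoff k x - 1) <= c * K + 1.
  move=> k0; apply: le_trans (cabsD _ _) _; rewrite cabsN.
  rewrite -[1 in leLHS]/(1%:C)%C cabs_real normr1 lerD2r cabsM ler_wpM2l//.
  by have := psiK [::] (x0 + k *: x); rewrite cw0// mulr1.
have cK1 : 0 < c * K + 1 by rewrite ltr_wpDl ?mulr_ge0.
have [B HB] := weight_coercive homega (divr_gt0 d0 cK1).
have cpsi : {for x0, continuous (fun x => cabs ((psi x0)^-1 * psi x - 1))}.
  have [c1 c2 _] := smooth_diff1 spsi.
  have ch : smooth (fun x => (psi x0)^-1 * psi x + (-1) * 1).
    exact: (smooth_lin _ _ spsi (smooth_cst 1)).
  have [h1 h2 _] := smooth_diff1 ch.
  have -> : (fun x => cabs ((psi x0)^-1 * psi x - 1)) = (fun x => Num.sqrt (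
      re_part (fun x => (psi x0)^-1 * psi x + (-1) * 1) x ^+ 2 +
      im_part (fun x => (psi x0)^-1 * psi x + (-1) * 1) x ^+ 2)).
    by apply/funext => x; rewrite cabsE /re_part /im_part mulN1r.
  apply: (@continuous_comp _ _ _ _ (@Num.sqrt R)); last exact: sqrt_continuous.
  apply: (@continuousD R R _ _ _ x0).
    apply: (@continuousM R _ _ _ x0); exact: h1.
  apply: (@continuousM R _ _ _ x0); exact: h2.
have : \forall x \near x0, cabs ((psi x0)^-1 * psi x - 1) < d.
  move: cpsi => /cvgrPdist_lt /(_ _ d0); apply: filterS => x.
  rewrite mulVf// subrr cabs0 sub0r normrN ger0_norm//; exact: cabs_ge0.
move=> /nbhs_normP[r /= r0 Hr].
(* The second term keeps [x0 + k *: x] in the ball of continuity as long as |x| < B; the third makes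
   the derivatives smaller than [d]. *)
pose k := Num.min 1 (Num.min (r / (`|B| + 1)) (d / (c * K + 1))).
have k0 : 0 < k by rewrite !lt_min ltr01 !divr_gt0// ltr_wpDl.
have k1 : k <= 1 by rewrite ge_min lexx.
have kr : k * (`|B| + 1) <= r.
  by rewrite -ler_pdivlMr ?ltr_wpDl// ge_min ge_min lexx orbT.
have kd : k * (c * K + 1) <= d.
  by rewrite -ler_pdivlMr// ge_min ge_min lexx !orbT.
exists k; split=> // s x; rewrite mul1r.
have [->|s0] := eqVneq s [::].
  rewrite /= cw0// mulr1.
  have [Bx|xB] := leP B (enorm x).
    apply: (@le_trans _ _ ((c * K + 1) * (d / (c * K + 1)))).
      apply: ler_pM; rewrite ?cabs_ge0 ?expR_ge0//; first by apply: cut_le; exact: ltW.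
      by apply: HB => //; exact: enorm_ge0.
    by rewrite mulrCA divff ?mulr1// gt_eqF.
  apply: (@le_trans _ _ (cabs (cutoff k x - 1))).
    by rewrite ler_piMr ?cabs_ge0// expR_le1 oppr_le0 omegaN_ge0.
  apply/ltW/Hr => /=; rewrite opprD addNKr normrN normrZ gtr0_norm//.
  apply: lt_le_trans kr; rewrite ltr_pM2l//.
  apply: le_lt_trans (norm_le_enorm x) _; apply: lt_le_trans xB _.
  by apply: le_trans (ler_norm B) _; rewrite lerDl.
have saff : smooth (fun y => psi (x0 + k *: y)) by apply: smooth_affine => //; rewrite gt_eqF.
have -> : (fun x => cutoff k x - 1) =
    (fun x => (psi x0)^-1 * psi (x0 + k *: x) + (-1) * 1).
  by apply/funext => y; rewrite mulN1r.
rewrite dseq_lin//; last exact: smooth_cst.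
rewrite dseq_cst// mulr0 addr0 dseq_affine ?gt_eqF//.
rewrite !cabsM cabs_real normrX gtr0_norm// -/c.
apply: (@le_trans _ _ (k * (c * K))).
  rewrite mulrAC.
  apply: (@le_trans _ _ (c * (k ^+ size s * cabs (dseq s psi (x0 + k *: x))) * cw m (size s))).
    rewrite ler_piMr ?mulr_ge0 ?exprn_ge0 ?cabs_ge0 ?cw_ge0 ?(ltW k0)//.
    by rewrite expR_le1 oppr_le0 omegaN_ge0.
  rewrite mulrCA -!mulrA; apply: ler_pM; rewrite ?mulr_ge0 ?exprn_ge0 ?cabs_ge0 ?cw_ge0 ?(ltW k0)//.
    rewrite -[leRHS]expr1 ler_wiXn2l ?(ltW k0)//.
    by case: (s) s0.
  by rewrite ler_wpM2l.
by apply: le_trans kd; rewrite ler_pM2l//; lra.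
Qed.

End cutoff.
End leibniz_and_cutoffs.

(** * Extension of functionals *)

Section complex_hahn_banach.
Context {R : realType} {X : Type}.
Local Notation C := R[i].
Implicit Types (f g : X -> C) (E D : set (X -> C)).

Definition clin_closed E := forall a b f g, E f -> E g -> E (fun x => a * f x + b * g x).

Definition clinear_on E (S : (X -> C) -> C) := forall a b f g, E f -> E g ->
  S (fun x => a * f x + b * g x) = a * S f + b * S g.

(** A complex function on [X] is a real function on [X * bool], with the real part at [true]; the
    real theorem is applied there. *)
Let dec (F : X * bool -> R) : X -> C := fun x => Complex (F (x, true)) (F (x, false)).
Let enc f : X * bool -> R :=
  fun p => if p.2 then complex.Re (f p.1) else complex.Im (f p.1).

Let encK f : dec (enc f) = f.
Proof. by apply/funext => x; rewrite /dec /enc /=; case: (f x). Qed.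

Let dec_lin (a : R) F G : dec (fun x => a * F x + G x) =
  (fun x => a%:C%C * dec F x + 1 * dec G x).
Proof.
by apply/funext => x; apply: complex_ext; rewrite ?cReD ?cImD ?cReM ?cImM /=; ring.
Qed.

Lemma clin_closedZ E a f : clin_closed E -> E f -> E (fun x => a * f x).
Proof.
move=> EL Ef; have := EL a 0 f f Ef Ef.
have -> : (fun x => a * f x + 0 * f x) = (fun x => a * f x).
  by apply/funext => x; rewrite mul0r addr0.
by [].
Qed.

Lemma clinear_onZ E S a f : clinear_on E S -> E f -> S (fun x => a * f x) = a * S f.
Proof.
move=> SL Ef; rewrite -[RHS]addr0 -[0 in RHS](mul0r (S f)) -SL//; congr S.
by apply/funext => x; rewrite mul0r addr0.
Qed.

(** Extend the real part of [T] to a real functional V and put S f = V f - i V (i f). The factor 2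
    comes from adding the bounds on the two parts, which avoids rotating the value to the real
    axis. *)
Theorem complex_hahn_banach E D (q : (X -> C) -> R) T :
  clin_closed E -> clin_closed D -> D !=set0 -> D `<=` E -> clinear_on D T ->
  (forall f g, E f -> E g -> q (fun x => f x + g x) <= q f + q g) ->
  (forall a f, E f -> q (fun x => a * f x) <= cabs a * q f) ->
  (forall f, D f -> cabs (T f) <= q f) ->
  exists S, [/\ clinear_on E S, forall f, D f -> S f = T f &
    forall f, E f -> cabs (S f) <= 2 * q f].
Proof.
move=> EL DL [d0 Dd0] DE TL qD qZ Tq.
have [] := @hahn_banach R (X * bool) [set F | E (dec F)] [set F | D (dec F)]
  (fun F => q (dec F)) (fun F => complex.Re (T (dec F))).
- by move=> a F G EF EG; rewrite /= dec_lin; exact: EL.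
- split=> [F G EF EG|a F EF].
    have -> : dec (fun x => F x + G x) = (fun x => dec F x + dec G x) by [].
    exact: qD.
  have -> : dec (fun x => a * F x) = (fun x => a%:C%C * dec F x).
    by apply/funext => x; apply: complex_ext; rewrite ?cReM ?cImM /=; ring.
  by rewrite -cabs_real; exact: qZ.
- by move=> F; exact: DE.
- by exists (enc d0) => /=; rewrite encK.
- by move=> a F G DF DG; rewrite /= dec_lin; exact: DL.
- move=> a F G DF DG. rewrite dec_lin. rewrite TL//. rewrite cReD !cReM /=; ring.
- by move=> F DF; apply: le_trans (Tq _ DF); apply: le_trans (Re_le_cabs _); exact: ler_norm.
move=> U [UL UT Uq].
pose V f := U (enc f).
have VL (a b : R) f g : E f -> E g -> V (fun x => a%:C%C * f x + b%:C%C * g x) = a * V f + b * V g.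
  move=> Ef Eg.
  have EF : E (dec (enc f)) by rewrite encK.
  have EG : E (dec (enc g)) by rewrite encK.
  have h : E (dec (fun x => b * enc g x)).
    have -> : dec (fun x => b * enc g x) = (fun x => b%:C%C * g x).
      by apply/funext => x; apply: complex_ext; rewrite ?cReM ?cImM /enc /=; ring.
    exact: clin_closedZ.
  transitivity (U (fun x => a * enc f x + b * enc g x)).
    congr U; apply/funext => -[x [|]]; rewrite /enc /= ?cReD ?cImD ?cReM ?cImM /=; ring.
  rewrite UL//; congr (_ + _).
  apply: (@linear_onZ R (X * bool) [set F | E (dec F)] U) => //.
  by move=> c F G ? ?; rewrite /= dec_lin; exact: EL.
have Ei f : E f -> E (fun x => 'i%C * f x) by move=> Ef; exact: clin_closedZ.
exists (fun f => Complex (V f) (- V (fun x => 'i%C * f x))); split.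
- move=> a b f g Ef Eg.
  have Eaf : E (fun x => a * f x) by exact: clin_closedZ.
  have Ebg : E (fun x => b * g x) by exact: clin_closedZ.
  have VZ c h : E h -> V (fun x => c * h x) =
      complex.Re c * V h + complex.Im c * V (fun x => 'i%C * h x).
    move=> Eh; rewrite -VL//; last exact: Ei.
    congr V; apply/funext => x; rewrite mulrA -mulrDl; congr (_ * _).
    by apply: complex_ext; rewrite ?cReD ?cImD ?cReM ?cImM /=; ring.
  have VD h k : E h -> E k -> V (fun x => h x + k x) = V h + V k.
    move=> Eh Ek; have := VL 1 1 h k Eh Ek; rewrite !mul1r => <-.
    by congr V; apply/funext => x; rewrite !mul1r.
  have VZi c h : E h -> V (fun x => 'i%C * (c * h x)) =
      - complex.Im c * V h + complex.Re c * V (fun x => 'i%C * h x).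
    move=> Eh; transitivity (V (fun x => ('i%C * c) * h x)).
      by congr V; apply/funext => x; rewrite mulrA.
    by rewrite VZ// cReM cImM /=; ring.
  have -> : (fun x => 'i%C * (a * f x + b * g x)) = (fun x => 'i%C * (a * f x) + 'i%C * (b * g x)).
    by apply/funext => x; rewrite mulrDr.
  rewrite VD// VD//; [|exact: Ei..].
  rewrite (VZ a f)// (VZ b g)// (VZi a f)// (VZi b g)//.
  by apply: complex_ext; rewrite ?cReD ?cImD ?cReM ?cImM /=; ring.
- move=> f Df; have VE g : D g -> V g = complex.Re (T g).
    by move=> Dg; rewrite /V UT /= ?encK.
  rewrite !VE//; last exact: clin_closedZ.
  by rewrite (clinear_onZ _ TL)//; apply: complex_ext; rewrite //= cReM /=; ring.
- move=> f Ef; apply: le_trans (cabs_le _) _ => /=; rewrite normrN.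
  have Vq g : E g -> `|V g| <= q g.
    by move=> Eg; have := Uq (enc g); rewrite /= encK; exact.
  rewrite mulr_natl mulr2n lerD ?Vq//.
  apply: (le_trans (Vq _ (Ei _ Ef))); apply: le_trans (qZ _ _ Ef) _.
  by rewrite cabs_i mul1r.
Qed.

End complex_hahn_banach.

Section complex_limits.
Context {R : realType}.
Local Notation C := R[i].
Implicit Types (u v : nat -> C) (l : C).

Definition ccvg u l := ((fun n => complex.Re (u n)) @ \oo --> complex.Re l) /\
  ((fun n => complex.Im (u n)) @ \oo --> complex.Im l).

Lemma ccvg_unique u l l' : ccvg u l -> ccvg u l' -> l = l'.
Proof.
move=> [r1 i1] [r2 i2]; apply: complex_ext.
  exact: (cvg_unique _ r1 r2).
exact: (cvg_unique _ i1 i2).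
Qed.

Lemma ccvg_lin a b u v l l' : ccvg u l -> ccvg v l' ->
  ccvg (fun n => a * u n + b * v n) (a * l + b * l').
Proof.
move=> [r1 i1] [r2 i2]; split.
- have -> : (fun n => complex.Re (a * u n + b * v n)) = (fun n =>
    (complex.Re a * complex.Re (u n) - complex.Im a * complex.Im (u n)) +
    (complex.Re b * complex.Re (v n) - complex.Im b * complex.Im (v n))).
    by apply/funext => n /=; rewrite cReD !cReM.
  by rewrite cReD !cReM; apply: cvgD; apply: cvgB; apply: cvgMl_tmp.
- have -> : (fun n => complex.Im (a * u n + b * v n)) = (fun n =>
    (complex.Re a * complex.Im (u n) + complex.Im a * complex.Re (u n)) +
    (complex.Re b * complex.Im (v n) + complex.Im b * complex.Re (v n))).
    by apply/funext => n /=; rewrite cImD !cImM.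
  by rewrite cImD !cImM; apply: cvgD; apply: cvgD; apply: cvgMl_tmp.
Qed.

Lemma ccvgP u l : (forall e, 0 < e -> exists J, forall j, (J <= j)%N -> cabs (u j - l) <= e) ->
  ccvg u l.
Proof.
move=> H; split; apply/cvgrPdist_le => e e0; have [J HJ] := H e e0; exists J => // j /= Jj;
  rewrite distrC; apply: le_trans (HJ j Jj).
- by apply: le_trans (Re_le_cabs _); case: (u j) => ? ?; case: (l).
- by apply: le_trans (Im_le_cabs _); case: (u j) => ? ?; case: (l).
Qed.

Lemma abs_bounded_series_cvg (u : nat -> R) H :
  (forall J, \sum_(0 <= j < J) `|u j| <= H) -> exists2 l, series u @ \oo --> l & `|l| <= H.
Proof.
move=> uH.
have c : cvgn [normed series u].
  apply: nondecreasing_is_cvgn.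
    by apply/nondecreasing_seqP => n; rewrite [leRHS]seriesS lerDr /=.
  by exists H => _ [n _ <-]; exact: uH.
have cu : cvgn (series u) by exact: normed_cvg.
exists (limn (series u)) => //.
apply: le_trans (lim_series_norm c) _.
by apply: limr_le => //; apply: nearW => n; exact: uH.
Qed.

(** The first term [v] is kept apart because the telescoping series starts with a full cutoff. The
    factor 2 adds the bounds on real and imaginary parts. *)
Lemma ccvg_series (v : C) u H : (forall J, cabs v + \sum_(0 <= j < J) cabs (u j) <= H) ->
  exists2 l, ccvg (fun J => v + \sum_(0 <= j < J) u j) l & cabs l <= 2 * H.
Proof.
move=> uH.
have bnd (P : C -> R) : (forall z, `|P z| <= cabs z) -> forall J,
    \sum_(0 <= j < J) `|P (u j)| <= H - cabs v.
  move=> PH J; rewrite lerBrDl; apply: le_trans (uH J); rewrite lerD2l.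
  by apply: ler_sum => j _.
have [lr cr hr] := abs_bounded_series_cvg (bnd _ (@Re_le_cabs R)).
have [li ci hi] := abs_bounded_series_cvg (bnd _ (@Im_le_cabs R)).
exists (v + Complex lr li).
  split; rewrite ?cReD ?cImD /=.
  - have -> : (fun J => complex.Re (v + \sum_(0 <= j < J) u j)) =
      (fun J => complex.Re v + series (fun j => complex.Re (u j)) J).
      apply/funext => J /=; rewrite cReD /series /=; congr (_ + _).
      by elim/big_rec2: _ => //= j a b _ <-; rewrite cReD.
    by apply: cvgD => //; exact: cvg_cst.
  - have -> : (fun J => complex.Im (v + \sum_(0 <= j < J) u j)) =
      (fun J => complex.Im v + series (fun j => complex.Im (u j)) J).
      apply/funext => J /=; rewrite cImD /series /=; congr (_ + _).
      by elim/big_rec2: _ => //= j a b _ <-; rewrite cImD.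
    by apply: cvgD => //; exact: cvg_cst.
apply: le_trans (cabsD _ _) _; have := cabs_le (Complex lr li) => /=.
have := cabs_ge0 v; lra.
Qed.

End complex_limits.

(** * Gluing the extensions of [T] along cutoffs *)

Section extension.
Context {R : realType} {N : nat} (omega : R -> R).
Hypothesis homega : nonquasianalytic_weight omega.
Local Notation C := R[i].
Local Notation Rn := 'rV[R]_N.
Local Notation cw := (cw omega).
Local Notation w x := (omegaN omega x).
Implicit Types (f g : Rn -> C) (s : seq 'I_N) (x y : Rn) (m n : nat) (K : R).

Lemma O_bound_ge0 m n f K : O_bound omega m n f K -> 0 <= K.
Proof.
move=> fK; apply: le_trans (fK [::] 0).
by rewrite !mulr_ge0 ?cabs_ge0 ?expR_ge0 ?cw_ge0.
Qed.

Lemma O_boundL m n a b f g K L : smooth f -> smooth g ->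
  O_bound omega m n f K -> O_bound omega m n g L ->
  O_bound omega m n (fun x => a * f x + b * g x) (cabs a * K + cabs b * L).
Proof.
move=> sf sg fK gL s x; rewrite dseq_lin; [|exact: sf|exact: sg].
rewrite -mulrA; set c := _ * cw _ _.
have c0 : 0 <= c by rewrite mulr_ge0 ?expR_ge0 ?cw_ge0.
apply: (@le_trans _ _ ((cabs a * cabs (dseq s f x) + cabs b * cabs (dseq s g x)) * c)).
  by rewrite ler_wpM2r// (le_trans (cabsD _ _))// !cabsM.
by rewrite mulrDl -!mulrA lerD// ler_wpM2l ?cabs_ge0// /c mulrA; [exact: fK|exact: gL].
Qed.

Lemma O_step_clin m n : clin_closed (elements (O_step omega m n%:Z) : set (Rn -> C)).
Proof.
move=> a b f g /(elements_O_step homega)[sf [K fK]] /(elements_O_step homega)[sg [L gL]].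
apply/(elements_O_step homega); split; first exact: smooth_lin.
by eexists; exact: (O_boundL a b sf sg fK gL).
Qed.

Let D_nonempty : (elements (D_omega omega) : set (Rn -> C)) !=set0.
Proof.
exists (fun=> 0); apply/(elements_D_omega homega); split; first exact: smooth_cst.
  by exists 0.
move=> m m0; exists 0 => s x.
have [->|s0] := eqVneq s [::]; first by rewrite cabs0 mul0r.
by rewrite dseq_cst// cabs0 mul0r.
Qed.

Variables (T : (Rn -> C) -> C) (m : nat).
Hypothesis m0 : (0 < m)%N.
Hypothesis TL : clinear_on (elements (D_omega omega)) T.
Hypothesis TO : O_bounded omega T m.

(** The pair holds an extension to one step together with a bound for it, so that one use of
    [choice] selects both. The steps start at 1, hence the index [n.+1]. *)
Let extend_step n : exists S : ((Rn -> C) -> C) * R, [/\ 0 <= S.2,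
  clinear_on (elements (O_step omega m n.+1%:Z)) S.1,
  forall f, elements (D_omega omega) f -> S.1 f = T f &
  forall f K, smooth f -> O_bound omega m n.+1 f K -> cabs (S.1 f) <= S.2 * K].
Proof.
have [A A0 HA] := TO (ltn0Sn n).
have [|||S [SL ST Sq]] := @complex_hahn_banach R Rn (elements (O_step omega m n.+1%:Z))
  (elements (D_omega omega)) (fun f => A * onorm omega m n.+1 f) T (@O_step_clin m n.+1)
  (@D_omegaL _ _ _ homega) D_nonempty
  (fun f Df => D_omega_sub_O_step homega n.+1 m0 Df) TL.
- move=> f g /(elements_O_step homega)[sf [K fK]] /(elements_O_step homega)[sg [L gL]].
  rewrite -mulrDr ler_wpM2l//; apply: onorm_le => //; first exact: smoothD.
  have := O_boundL 1 1 sf sg (onorm_bound homega sf fK) (onorm_bound homega sg gL).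
  rewrite -[1]/(1%:C)%C cabs_real normr1 !mul1r.
  have -> : (fun x => 1%:C%C * f x + 1%:C%C * g x) = (fun x => f x + g x).
    by apply/funext => x; rewrite !mul1r.
  by [].
- move=> a f /(elements_O_step homega)[sf [K fK]].
  rewrite mulrCA ler_wpM2l//; apply: onorm_le => //; first exact: smoothZ.
  by apply: O_boundZ => //; exact: onorm_bound fK.
- move=> f Df; apply: HA => //.
  have /(elements_O_step homega)[sf [K fK]] := D_omega_sub_O_step homega n.+1 m0 Df.
  exact: onorm_bound fK.
exists (S, 2 * A); split=> //=; first by rewrite mulr_ge0.
move=> f K sf fK; apply: le_trans (Sq f _) _.
  by apply/(elements_O_step homega); split=> //; exists K.
by rewrite -mulrA ler_wpM2l// ler_wpM2l//; exact: onorm_le.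
Qed.

Variables (psi : Rn -> C) (x0 : Rn).
Hypothesis Dpsi : elements (D_omega omega) psi.
Hypothesis psi0 : psi x0 != 0.

Let half_sum J : \sum_(0 <= j < J) 2 ^- j <= 2 :> R.
Proof.
have -> : \sum_(0 <= j < J) 2 ^- j = 2 - 2 * 2 ^- J :> R.
  elim: J => [|J IH]; first by rewrite big_nil expr0 invr1; lra.
  rewrite big_nat_recr//= IH exprS; field.
  by rewrite expf_neq0.
have : 0 <= 2 ^- J :> R by rewrite invr_ge0 exprn_ge0.
lra.
Qed.

(* The differences of successive cutoffs [psi (x0 + e_j x) / psi x0] telescope to 1;
   the scales e_j tend to 0 so fast that extensions of [T] with arbitrary norms can be
   used on the successive pieces. *)
Lemma telescoping_extension : exists M S, [/\ (0 < M)%N,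
  clinear_on (\bigcup_(n in [set n | (0 < n)%N]) elements (O_step omega M n%:Z)) S,
  forall f, elements (D_omega omega) f -> S f = T f &
  forall n, (0 < n)%N -> exists2 H, 0 <= H & forall f K,
    smooth f -> O_bound omega M n f K -> cabs (S f) <= H * K].
Proof.
have [SB HSB] := choice extend_step.
pose S_ j := (SB j).1; pose B j := (SB j).2.
have B0 j : 0 <= B j by case: (HSB j).
have SL j : clinear_on (elements (O_step omega m j.+1%:Z)) (S_ j) by case: (HSB j).
have ST j f : elements (D_omega omega) f -> S_ j f = T f by case: (HSB j) => _ _ + _; exact.
have Sle j f K : smooth f -> O_bound omega m j.+1 f K -> cabs (S_ j f) <= B j * K.
  by case: (HSB j) => _ _ _; exact.
have [M [A [mM A0 HA]]] := dseqM_bound (N:=N) homega m0.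
have M0 : (0 < M)%N by exact: leq_trans mM.
(* The partial sums dominate [B j], so the term of index j will cost at most 2^-j; they increase, so
   [d] decreases and the difference of two successive cutoffs is bounded by [2 * d j]; the 1 keeps
   them positive. *)
pose Bsum j := 1 + \sum_(0 <= k < j.+1) B k.
have Bsum_gt0 j : 0 < Bsum j.
  by rewrite ltr_pwDl// sumr_ge0.
pose d j := 2 ^- j / (2 * A * Bsum j).
have d0 j : 0 < d j by rewrite divr_gt0 ?invr_gt0 ?exprn_gt0// !mulr_gt0.
have dS j : d j.+1 <= d j.
  rewrite /d; apply: ler_pM; rewrite ?invr_ge0 ?exprn_ge0 ?mulr_ge0 ?(ltW A0) ?(ltW (Bsum_gt0 _))//.
    by rewrite lef_pV2 ?posrE ?exprn_gt0// ler_weXn2l//; lra.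
  rewrite lef_pV2 ?posrE ?mulr_gt0// ler_pM2l ?mulr_gt0//.
  by rewrite /Bsum [in leRHS]big_nat_recr//= lerD2l lerDl.
have Bd j : B j * (A * (2 * d j)) <= 2 ^- j.
  have -> : B j * (A * (2 * d j)) = (B j / Bsum j) * 2 ^- j.
    by rewrite /d; field; rewrite !expf_neq0// !gt_eqF.
  rewrite ler_piMl ?invr_ge0 ?exprn_ge0// ler_pdivrMr// mul1r.
  rewrite /Bsum big_nat_recr//= addrA lerDr addr_ge0// sumr_ge0//.
have [k Hk] := choice (fun j => cutoff_cvg homega Dpsi psi0 M0 (d0 j)).
pose chi j := cutoff psi x0 (k j).
have k0 j : 0 < k j by case: (Hk j).
have k1 j : k j <= 1 by case: (Hk j).
have chi1 j : O_bound omega M 1 (fun x => chi j x - 1) (d j) by case: (Hk j).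
have Dchi j : elements (D_omega omega) (chi j) by exact: D_omega_cutoff.
have schi j : smooth (chi j) by case: ((elements_D_omega homega _).1 (Dchi j)).
have schi1 j : smooth (fun x => chi j x - 1).
  have := smooth_lin 1 (-1) (schi j) (smooth_cst 1).
  have -> : (fun x => 1 * chi j x + -1 * 1) = (fun x => chi j x - 1).
    by apply/funext => x; rewrite mul1r mulN1r.
  by [].
pose eta j := fun x => chi j.+1 x - chi j x.
have Deta j : elements (D_omega omega) (eta j).
  have := D_omegaL homega 1 (-1) (Dchi j.+1) (Dchi j).
  have -> : (fun x => 1 * chi j.+1 x + -1 * chi j x) = eta j.
    by apply/funext => x; rewrite mul1r mulN1r.
  by [].
have seta j : smooth (eta j) by case: ((elements_D_omega homega _).1 (Deta j)).
have etaM j : O_bound omega M 1 (eta j) (2 * d j).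
  have := O_boundL 1 (-1) (schi1 j.+1) (schi1 j) (chi1 j.+1) (chi1 j).
  have -> : (fun x => 1 * (chi j.+1 x - 1) + -1 * (chi j x - 1)) = eta j.
    by apply/funext => x; rewrite /eta; ring.
  rewrite cabsN -[1]/(1%:C)%C cabs_real normr1 !mul1r => h s x.
  by apply: le_trans (h s x) _; have := dS j; lra.
(* The exponents of the weight add up. With [eta j], of exponent 1, a function of the n-th step goes
   to step n + 1, hence to the step of [S_ j] as soon as n <= j. *)
have mulO n1 n2 n f g K L : (n1 + n2 <= n)%N -> smooth f -> smooth g ->
    O_bound omega M n1 f K -> O_bound omega M n2 g L ->
    O_bound omega m n (fun x => f x * g x) (A * (K * L)).
  move=> n12 sf sg fK gL.
  have K0 := O_bound_ge0 fK; have L0 := O_bound_ge0 gL.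
  have shift l h U : O_bound omega M l h U -> forall x s,
      cabs (dseq s h x) * cw M (size s) <= U * expR (l%:R * w x).
    move=> hU x s; have := hU s x.
    by rewrite mulrAC expRN ler_pdivrMr ?expR_gt0.
  move=> s x; have h := HA f g x _ _ sf sg (shift _ _ _ fK x) (shift _ _ _ gL x) s.
  rewrite mulrAC expRN ler_pdivrMr ?expR_gt0//; apply: le_trans h _.
  rewrite -!mulrA ler_pM2l// ler_wpM2l// mulrCA ler_wpM2l// -expRD ler_expR.
  by rewrite -mulrDl ler_wpM2r ?omegaN_ge0// -natrD ler_nat.
(* A factor decaying like exp (- n omega) cancels the growth of the n-th step, so the product lies
   in every step. This serves the finitely many indices j < n, where [S_ j] lives on too small a
   step. *)
have mulD n f g K L : smooth f -> smooth g -> 0 <= K -> O_bound omega M n g L ->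
    (forall s x, cabs (dseq s f x) * cw M (size s) <= K * expR (- (n%:R * w x))) ->
    forall l, O_bound omega m l (fun x => f x * g x) (A * (K * L)).
  move=> sf sg K0 gL fK l; apply: D_bound_O => // s x.
  have gL' s' : cabs (dseq s' g x) * cw M (size s') <= L * expR (n%:R * w x).
    have := gL s' x.
    by rewrite mulrAC expRN ler_pdivrMr ?expR_gt0.
  have := HA f g x _ _ sf sg (fun s => fK s x) gL' s.
  by rewrite mulrACA -expRD addNr expR0 mulr1.
have decay n f : elements (D_omega omega) f -> exists L, 0 <= L /\
    forall s x, cabs (dseq s f x) * cw M (size s) <= L * expR (- (n%:R * w x)).
  move=> Df; have [L HL] := D_omega_decay homega n M0 Df.
  exists L; split=> //; have := HL [::] 0.
  have e0 := expR_gt0 (- (n%:R * w (0 : Rn))).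
  rewrite -ler_pdivrMr//; apply: le_trans.
  by rewrite (divr_ge0 _ (ltW e0))// mulr_ge0 ?cabs_ge0 ?cw_ge0.
pose P f J := S_ 0%N (fun x => chi 0%N x * f x) +
  \sum_(0 <= j < J) S_ j (fun x => eta j x * f x).
have PH n : (0 < n)%N -> exists2 H, 0 <= H & forall f K, smooth f -> O_bound omega M n f K ->
    forall J, cabs (S_ 0%N (fun x => chi 0%N x * f x)) +
      \sum_(0 <= j < J) cabs (S_ j (fun x => eta j x * f x)) <= H * K.
  move=> n0; have [L0 [L00 HL0]] := decay n _ (Dchi 0%N).
  have [L HL] := choice (fun j => decay n _ (Deta j)).
  (* For j < n the term is bounded by means of the decay of [eta j], with no smallness; for j >= n
     its bound is 2^-j, and these add up to at most 2. *)
  pose a j := if (j < n)%N then B j * (A * L j) else 0.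
  have a0 j : 0 <= a j.
    by rewrite /a; case: ifP => // _; rewrite !mulr_ge0// ?(ltW A0)//; case: (HL j).
  exists (B 0%N * (A * L0) + (\sum_(0 <= j < n) a j + 2)).
    by rewrite !addr_ge0 ?sumr_ge0// !mulr_ge0// ltW.
  move=> f K sf fK J; have K0 := O_bound_ge0 fK; rewrite mulrDl lerD//.
    apply: le_trans (Sle 0%N _ (A * (L0 * K)) _ _) _.
    - exact: smoothM.
    - exact: mulD HL0 _.
    - by rewrite !mulrA.
  apply: (@le_trans _ _ ((\sum_(0 <= j < J) a j + \sum_(0 <= j < J) 2 ^- j) * K)).
    rewrite -big_split /= mulr_suml; apply: ler_sum => j _.
    rewrite /a; case: ifPn => jn.
      apply: le_trans (Sle j _ (A * (L j * K)) _ _) _.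
      - exact: smoothM.
      - by have [Lj0 HLj] := HL j; exact: mulD HLj _.
      - by rewrite mulrDl !mulrA lerDl mulr_ge0// invr_ge0 exprn_ge0.
    rewrite add0r; apply: le_trans (Sle j _ (A * (2 * d j * K)) _ _) _.
    - exact: smoothM.
    - by apply: mulO (etaM j) fK => //; rewrite add1n ltnS leqNgt.
    - have := ler_wpM2r K0 (Bd j); rewrite !mulrA.
      by [].
  rewrite ler_wpM2r// lerD ?half_sum//.
  have [Jn|nJ] := leqP J n.
    by rewrite (@big_cat_nat _ _ _ J 0 n)//= lerDl sumr_ge0.
  rewrite (@big_cat_nat _ _ _ n 0 J)//= ?(ltnW nJ)// gerDl.
  by rewrite big_nat big1// => j /andP[nj _]; rewrite /a ltnNge nj.
pose X : set (Rn -> C) := \bigcup_(n in [set n | (0 < n)%N]) elements (O_step omega M n%:Z).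
(* The value is 0 by default where the partial sums diverge; they converge on all of [X]. *)
pose S f := xget 0 [set l | ccvg (P f) l].
have SP n f K : (0 < n)%N -> smooth f -> O_bound omega M n f K -> ccvg (P f) (S f).
  move=> n0 sf fK; have [H H0 HP] := PH n n0.
  have [l cl _] := ccvg_series (HP f K sf fK).
  by rewrite /S; case: xgetP => // /(_ l).
have SX f : X f -> ccvg (P f) (S f).
  by move=> [n n0 /(elements_O_step homega)[sf [K fK]]]; exact: SP fK.
have DX f : elements (D_omega omega) f -> X f.
  by move=> Df; exists 1%N => //; exact: (@D_omega_sub_O_step _ _ _ homega M 1).
have Pstep j f g n K : elements (D_omega omega) g -> (0 < n)%N -> smooth f -> O_bound omega M n f K ->
    elements (O_step omega m j.+1%:Z) (fun x => g x * f x).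
  move=> Dg n0 sf fK; apply/(elements_O_step homega).
  have sg : smooth g by case: ((elements_D_omega homega _).1 Dg).
  have [L [L0 HL]] := decay n _ Dg.
  by split; [exact: smoothM|eexists; exact: (mulD n g f L K sg sf L0 fK HL)].
exists M, S; split=> //.
- move=> a b f g Xf Xg.
  have [n n0 /(elements_O_step homega)[sf [K fK]]] := Xf.
  have [n' n'0 /(elements_O_step homega)[sg [L gL]]] := Xg.
  have PL : P (fun x => a * f x + b * g x) = (fun J => a * P f J + b * P g J).
    have SLg j h : elements (D_omega omega) h -> S_ j (fun x => h x * (a * f x + b * g x)) =
        a * S_ j (fun x => h x * f x) + b * S_ j (fun x => h x * g x).
      move=> Dh; rewrite -SL; last 2 first.
      - exact: Pstep fK.
      - exact: Pstep gL.
      by congr (S_ j); apply/funext => x; ring.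
    apply/funext => J; rewrite /P SLg//.
    under eq_bigr do rewrite SLg//.
    by rewrite big_split /= -!mulr_sumr; ring.
  apply: (@ccvg_unique _ (P (fun x => a * f x + b * g x))).
    apply: (SP (maxn n n') _ (cabs a * K + cabs b * L)).
    - by rewrite leq_max n0.
    - exact: smooth_lin.
    - by apply: O_boundL => //; [apply: O_bound_mono fK|apply: O_bound_mono gL];
        rewrite ?leq_maxl ?leq_maxr.
  by rewrite PL; apply: ccvg_lin; exact: SX.
- move=> f Df; apply: (@ccvg_unique _ (P f)); first exact/SX/DX.
  (* On test functions all the [S_ j] coincide with [T], and the sum telescopes. *)
  have PE J : P f J = T (fun x => chi J x * f x).
    elim: J => [|J IH]; rewrite /P.
      by rewrite big_nil addr0 ST//; exact: D_omegaM.
    rewrite big_nat_recr//= addrA -/(P f J) IH ST; last exact: D_omegaM.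
    have := TL 1 1 (D_omegaM homega (Dchi J) Df) (D_omegaM homega (Deta J) Df).
    rewrite !mul1r => <-; congr T; apply/funext => x; rewrite /eta; ring.
  have [sf _ /(_ M M0)[K fK]] := (elements_D_omega homega _).1 Df.
  have fK0 : O_bound omega M 0 f K by exact: D_bound_O.
  have K0 := O_bound_ge0 fK0.
  apply: ccvgP => e e0.
  have [J HJ] : exists J, forall j, (J <= j)%N -> B 0%N * (A * (d j * K)) <= e.
    pose c := B 0%N * (A * (d 0%N * K)).
    have c0 : 0 <= c.
      by rewrite mulr_ge0 ?B0// mulr_ge0 ?(ltW A0)// mulr_ge0 ?(ltW (d0 0%N))//.
    have dj j : d j <= 2 ^- j * d 0%N.
      have : Bsum 0%N <= Bsum j.
        rewrite /Bsum lerD2l (@big_cat_nat _ _ _ 1 0 j.+1)//= lerDl sumr_ge0//.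
      move=> hB; rewrite /d expr0 invr1 mul1r ler_wpM2l ?invr_ge0 ?exprn_ge0//.
      by rewrite lef_pV2 ?posrE ?mulr_gt0// ler_pM2l ?mulr_gt0.
    exists (Num.bound (c / e)) => j Jj.
    apply: (@le_trans _ _ (2 ^- j * c)).
      have -> : 2 ^- j * c = B 0%N * (A * (2 ^- j * d 0%N * K)) by rewrite /c; ring.
      apply: (ler_wpM2l (B0 0%N)); apply: (ler_wpM2l (ltW A0)); exact: (ler_wpM2r K0).
    rewrite mulrC ler_pdivrMr ?exprn_gt0// mulrC -ler_pdivrMr//.
    apply/ltW; apply: lt_le_trans (archi_boundP _) _; first by rewrite divr_ge0// ltW.
    rewrite -natrX ler_nat (leq_trans Jj)// ltnW// ltn_expl//.
  exists J => j Jj; rewrite PE.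
  have D1 : elements (D_omega omega) (fun x => chi j x * f x) by exact: D_omegaM.
  (* A test function satisfies a bound of exponent 0 and [chi j - 1] one of exponent 1, so the
     product is in the first step, with a norm of order [d j], and [S_ 0] is continuous there. *)
  have -> : T (fun x => chi j x * f x) - T f = S_ 0%N (fun x => (chi j x - 1) * f x).
    have D2 := D_omegaL homega 1 (-1) D1 Df.
    have := TL 1 (-1) D1 Df; rewrite mul1r mulN1r => <-; rewrite -(ST 0%N _ D2).
    by congr (S_ _); apply/funext => x; ring.
  apply: le_trans (HJ j Jj); apply: Sle; first exact: smoothM.
  by apply: mulO (chi1 j) fK0.
- move=> n n0; have [H H0 HP] := PH n n0; exists (2 * H); first by rewrite mulr_ge0.
  move=> f K sf fK; have [l cl hl] := ccvg_series (HP f K sf fK).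
  by rewrite (ccvg_unique (SP n f K n0 sf fK) cl) -mulrA.
Qed.

End extension.

Section characterization.
Context {R : realType} {N : nat} (omega : R -> R).
Hypothesis homega : nonquasianalytic_weight omega.
Local Notation C := R[i].
Local Notation Rn := 'rV[R]_N.

(** One index [M] of the projective limit is enough for continuity. The set where S is smaller than
    [e] is absolutely convex and contains a ball of every step, hence is a neighbourhood of 0 in the
    inductive limit. *)
Lemma in_dual_O_M_of_extension (T S : (Rn -> C) -> C) M : (0 < M)%N ->
  clinear_on (\bigcup_(n in [set n | (0 < n)%N]) elements (O_step omega M n%:Z)) S ->
  (forall f, elements (D_omega omega) f -> S f = T f) ->
  (forall n, (0 < n)%N -> exists2 H, 0 <= H & forall f K,
    smooth f -> O_bound omega M n f K -> cabs (S f) <= H * K) ->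
  in_dual_O_M omega T.
Proof.
set X := \bigcup_(n in _) _ => M0 SL ST SH.
have MX f : elements (O_M omega) f -> X f by move=> /(_ M M0).
exists S => //; split; first by move=> a b f g /MX Xf /MX Xg; exact: SL.
move=> f Mf e e0.
exists [:: M], (fun=> [set h | X h /\ cabs (S h) < e]); split.
  move=> j; rewrite inE => /eqP ->; split=> //.
  exists [set h | X h /\ cabs (S h) < e]; split=> //.
  - by move=> h [].
  - move=> a b h k ab [Xh he] [Xk ke].
    have Xhk : X (fun x => a * h x + b * k x).
      have [n n0 /(elements_O_step homega)[sh [K hK]]] := Xh.
      have [n' n'0 /(elements_O_step homega)[sk [L kL]]] := Xk.
      exists (maxn n n'); first by rewrite /= leq_max n0.
      apply/(elements_O_step homega); split; first exact: smooth_lin.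
      exists (cabs a * K + cabs b * L); apply: (O_boundL a b sh sk).
        by apply: (O_bound_mono homega M0 _ _ hK); rewrite ?leq_maxl.
      by apply: (O_bound_mono homega M0 _ _ kL); rewrite ?leq_maxr.
    split=> //; rewrite SL//; apply: le_lt_trans (cabsD _ _) _; rewrite !cabsM.
    pose mx := Num.max (cabs (S h)) (cabs (S k)).
    apply: (@le_lt_trans _ _ ((cabs a + cabs b) * mx)).
      by rewrite mulrDl lerD// ler_wpM2l ?cabs_ge0// le_max lexx ?orbT.
    apply: (@le_lt_trans _ _ mx); last by rewrite gt_max he.
    by rewrite ler_piMl// le_max cabs_ge0.
  - move=> n n0; have [H H0 HS] := SH n n0.
    (* [H] may be 0, hence the denominator H + 1. *)
    exists [:: tt], (e / (H + 1)); have H1 : 0 < H + 1 by lra.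
    split; first by rewrite divr_gt0.
    move=> h Eh hlt; split; first by exists n.
    have /(elements_O_step homega)[sh [K hK]] := Eh.
    have := hlt tt (mem_head _ _); rewrite (O_norm_fin homega sh hK) lte_fin => lte.
    apply: le_lt_trans (HS h _ sh (onorm_bound homega sh hK)) _.
    apply: (@le_lt_trans _ _ ((H + 1) * onorm omega M n h)).
      by rewrite ler_wpM2r ?onorm_ge0//; lra.
    by rewrite mulrC -ltr_pdivlMr.
move=> h Mh /(_ M); rewrite inE eqxx => /(_ isT)[Xh he] /=.
have -> : (fun x => f x + h x) = (fun x => 1 * f x + 1 * h x).
  by apply/funext => x; rewrite !mul1r.
by rewrite (SL 1 1 _ _ (MX _ Mf) Xh) !mul1r [S f + _]addrC addrK.
Qed.

Theorem O_bounded_in_dual (T : (Rn -> C) -> C) m : (0 < m)%N -> in_dual (D_omega omega) T ->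
  O_bounded omega T m -> in_dual_O_M omega T.
Proof.
move=> m0 [TL _] TO.
have [[psi [x0 [Dpsi psi0]]]|triv] := pselect (exists (psi : Rn -> C) x0,
    elements (D_omega omega) psi /\ psi x0 != 0).
  have [M [S [M0 SL ST SH]]] := telescoping_extension homega m0 TL TO Dpsi psi0.
  exact: (in_dual_O_M_of_extension M0 SL ST SH).
(* Here 0 is the only test function; [T] vanishes on it by linearity, and the zero functional is an
   extension. *)
apply: (@in_dual_O_M_of_extension T (fun=> 0) 1) => //.
- by move=> a b f g _ _; rewrite !mulr0 addr0.
- move=> f Df; have f0 : f = (fun x => 0 * f x + 0 * f x) :> (Rn -> C).
    apply/funext => x; rewrite !mul0r addr0; apply: contrapT => fx.
    by apply: triv; exists f, x; split=> //; exact/eqP.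
  by rewrite [in RHS]f0 TL// !mul0r addr0.
- by move=> n _; exists 0 => // f K _ _; rewrite cabs0 mul0r.
Qed.

End characterization.

(** * Integration on R^N *)

Section continuous_measurable.
Context {R : realType} {N : nat}.
Local Notation Rn := 'rV[R]_N.

Let grid (k : nat) (x : Rn) : Rn := \row_i ((Num.floor (k.+1%:R * x 0 i))%:~R / k.+1%:R).

Let grid_close k x : `|x - grid k x| <= k.+1%:R^-1.
Proof.
rewrite [leLHS]/Num.Def.normr /= mx_normrE; apply/bigmax_leP; split; first by rewrite invr_ge0.
move=> [i j] _ /=; rewrite (ord1 i) !mxE.
have k0 : (0 : R) < k.+1%:R by rewrite ltr0n.
have -> : x 0 j - (Num.floor (k.+1%:R * x 0 j))%:~R / k.+1%:R =
    (k.+1%:R * x 0 j - (Num.floor (k.+1%:R * x 0 j))%:~R) / k.+1%:R.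
  by field; rewrite -natr1 in k0 *; rewrite gt_eqF.
rewrite normrM [X in _ * X]ger0_norm ?invr_ge0 ?(ltW k0)//.
rewrite ler_piMl ?invr_ge0 ?(ltW k0)//.
have := floor_itv (k.+1%:R * x 0 j); rewrite intrD1 => /andP[h1 h2].
by rewrite ger0_norm ?subr_ge0// lerBlDr addrC ltW.
Qed.

(* [F \o g] is the pointwise limit of the functions obtained by rounding [g] to
   finer and finer grids. *)
Lemma measurable_continuous_rV d (T : measurableType d) (g : T -> Rn) (F : Rn -> R) :
  (forall i, measurable_fun [set: T] (fun t => g t 0 i)) -> continuous F ->
  measurable_fun [set: T] (fun t => F (g t)).
Proof.
move=> mg cF; apply: (@measurable_fun_cvg _ _ _ _ (fun k t => F (grid k (g t)))).
  move=> k _ Y mY; rewrite setTI.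
  (* The rounded function is constant on each cell of the grid. Cells are indexed by integer
     vectors, so the preimage is a countable union of those cells whose value lies in [Y]. *)
  have -> : (fun t => F (grid k (g t))) @^-1` Y = \bigcup_(v : 'rV[int]_N)
    ((if `[< Y (F (\row_i ((v 0 i)%:~R / k.+1%:R))) >] then setT else set0) `&`
     \bigcap_(i in [set: 'I_N]) [set t | g t 0 i \in
       `[(v 0 i)%:~R / k.+1%:R, (v 0 i + 1)%:~R / k.+1%:R[]).
    have k0 : (0 : R) < k.+1%:R by rewrite ltr0n.
    apply/seteqP; split=> [t Yt|t [v _ [+ vt]]].
      exists (\row_i Num.floor (k.+1%:R * g t 0 i)) => //; split.
        case: asboolP => //; apply; move: Yt => /=; congr (Y (F _)).
        by apply/rowP => i; rewrite !mxE.
      move=> i _ /=; rewrite in_itv/= !mxE.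
      by rewrite ler_pdivrMr// ltr_pdivlMr// mulrC floor_itv.
    case: asboolP => // Yv _ /=; move: Yv; congr (Y (F _)).
    apply/rowP => i; rewrite !mxE; congr (_%:~R / _); apply/esym/eqP.
    have := vt i I; rewrite /= in_itv/= floor_eq.
    by rewrite ler_pdivrMr// ltr_pdivlMr// mulrC.
  apply: countable_bigcupT_measurable; first exact: countableP.
  move=> v; apply: measurableI; first by case: ifP => _; [exact: measurableT|exact: measurable0].
  apply: fin_bigcap_measurable; first exact: finite_finset.
  move=> i _; have := mg i measurableT _ (measurable_itv
    `[(v 0 i)%:~R / k.+1%:R, (v 0 i + 1)%:~R / k.+1%:R[).
  by rewrite setTI.
move=> t _; apply: (@cvg_comp _ _ _ (fun k => grid k (g t)) F _ _ _ _ (cF (g t))).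
apply/cvgrPdist_le => e e0.
near=> k; apply: le_trans (grid_close k (g t)) _.
rewrite -[leRHS]invrK lef_pV2 ?posrE ?invr_gt0 ?ltr0n//.
apply/ltW; apply: lt_le_trans (archi_boundP _) _; first by rewrite invr_ge0 ltW.
rewrite ler_nat leqW//; near: k; exact: nbhs_infty_ge.
Unshelve. all: by end_near. Qed.

End continuous_measurable.

Section lebesgue_measure_rV.
Context {R : realType}.
Local Notation tup n := (n.-tuple (measurableTypeR R)).
Local Open Scope ereal_scope.

Lemma measurable_leb_space n (A : set (tup n)) : measurable A ->
  measurable (A : set (leb_space R n)).
Proof. by move=> mA; apply: sub_caratheodory; exact: sub_sigma_algebra. Qed.

Lemma measurable_fun_leb_space n d (T : measurableType d) (f : tup n -> T) :
  measurable_fun [set: tup n] f -> measurable_fun [set: leb_space R n] f.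
Proof.
move=> mf _ Y mY; have := mf measurableT _ mY; rewrite !setTI.
exact: measurable_leb_space.
Qed.

Lemma lebesgueN_borel n (A : set (tup n)) : measurable A ->
  @lebesgueN R n A = @borel_lebesgue R n A.
Proof. by move=> mA; rewrite /lebesgueN /completed_measure_extension measurable_mu_extE. Qed.

(** The identity is measurable from the completed space to the Borel space and pushes one measure to
    the other; this allows Tonelli's theorem to be used on the Borel side. *)
Lemma ge0_integral_lebesgueN n (f : tup n -> \bar R) :
  measurable_fun [set: tup n] f -> (forall t, 0 <= f t) ->
  \int[@lebesgueN R n]_(t in [set: leb_space R n]) f t =
  \int[@borel_lebesgue R n]_t f t.
Proof.
move=> mf f0.
pose phi : leb_space R n -> tup n := id.
have mphi : measurable_fun [set: leb_space R n] phi.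
  by apply: measurable_fun_leb_space; exact: measurable_id.
have := @ge0_integral_pushforward _ _ _ _ R phi mphi (@lebesgueN R n) setT f measurableT mf.
rewrite preimage_setT => <-; last by move=> y _; exact: f0.
apply: eq_measure_integral => A mA _; exact: lebesgueN_borel.
Qed.

Lemma ge0_integral_borel_step n (f : tup n.+1 -> \bar R) :
  measurable_fun [set: tup n.+1] f -> (forall t, 0 <= f t) ->
  \int[@borel_lebesgue R n.+1]_t f t =
  \int[@borel_lebesgue R n]_t \int[@lebesgue_measure R]_s f (tcons (s, t)).
Proof.
move=> mf f0.
have mt := @measurable_tcons R n.
rewrite /= /borel_lebesgue_step ge0_integral_pushforward//.
rewrite preimage_setT.
have mft : measurable_fun [set: measurableTypeR R * tup n] (f \o @tcons R n).
  exact: measurableT_comp.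
by rewrite (@fubini_tonelli2 _ _ _ _ R lebesgue_measure (borel_lebesgue n)
  (f \o @tcons R n) mft)// => y; exact: f0.
Qed.

End lebesgue_measure_rV.

(** * Integrability of exp (- n omega) *)

Section weight_integrable.
Context {R : realType} (omega : R -> R).
Hypothesis homega : nonquasianalytic_weight omega.
Local Notation tup n := (n.-tuple (measurableTypeR R)).

Let cauchy (s : R) : R := (oneDsqr s)^-1.

Let cauchy_ge0 s : 0 <= cauchy s.
Proof. by rewrite invr_ge0 (le_trans ler01)// oneDsqr_ge1. Qed.

Let measurable_cauchy : measurable_fun [set: measurableTypeR R] cauchy.
Proof. by apply: continuous_measurable_fun; exact: continuous_oneDsqrV. Qed.

Let cauchy_fin : (\int[@lebesgue_measure R]_s (cauchy s)%:E < +oo)%E.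
Proof.
rewrite ge0_symfun_integralT//.
- rewrite -set_itvcy integral0y_oneDsqr -EFinM ltry//.
- exact: continuous_oneDsqrV.
- by move=> s; rewrite /cauchy /= /oneDsqr sqrrN.
Qed.

Let prodc n (t : tup n) : R := \prod_(s <- t) cauchy s.

Let prodc_ge0 n (t : tup n) : 0 <= prodc t.
Proof. by rewrite /prodc big_seq prodr_ge0. Qed.

Let measurable_prodc n : measurable_fun [set: tup n] (@prodc n).
Proof.
have -> : @prodc n = (fun t => \prod_(i < n) cauchy (tnth t i)).
  by apply/funext => t; rewrite /prodc big_tuple.
apply: measurable_prod => i _.
by apply: measurableT_comp => //; exact: measurable_tnth.
Qed.

Let prodc_fin n : (\int[@borel_lebesgue R n]_t (prodc t)%:E < +oo)%E.
Proof.
elim: n => [|n IH].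
  rewrite integral_dirac//=; last by apply/measurable_EFinP; exact: measurable_prodc.
  by rewrite diracT mul1e ltry.
rewrite ge0_integral_borel_step//; last first.
- by move=> t; rewrite lee_fin.
- by apply/measurable_EFinP; exact: measurable_prodc.
have c0 : (0 <= \int[@lebesgue_measure R]_s (cauchy s)%:E)%E.
  by apply: integral_ge0 => s _; rewrite lee_fin.
have prodc_cons s (t : tup n) : prodc (tcons (s, t)) = cauchy s * prodc t.
  by rewrite /prodc big_cons.
have E (t : tup n) : (\int[@lebesgue_measure R]_s (prodc (tcons (s, t)))%:E =
    (\int[@lebesgue_measure R]_s (cauchy s)%:E) * (prodc t)%:E)%E.
  under eq_integral do rewrite prodc_cons EFinM.
  rewrite ge0_integralZr//; first exact/measurable_EFinP.
    by move=> s _; rewrite lee_fin cauchy_ge0.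
  by rewrite lee_fin; exact: prodc_ge0.
under eq_integral do rewrite E.
rewrite /= ge0_integralZl//; last 2 first.
- by apply/measurable_EFinP; exact: measurable_prodc.
- by move=> t _; rewrite lee_fin; exact: prodc_ge0.
by apply: lte_mul_pinfty => //; rewrite ge0_fin_numE.
Qed.

Lemma measurable_vec_continuous N (F : 'rV[R]_N -> R) : continuous F ->
  measurable_fun [set: tup N] (fun t => F (\row_i tnth t i)).
Proof.
move=> cF; apply: (@measurable_continuous_rV R N _ _ (fun t : tup N => \row_i tnth t i) F) => //.
move=> i; rewrite (_ : (fun t => _) = (fun t : tup N => tnth t i)).
  exact: measurable_tnth.
by apply/funext => t; rewrite mxE.
Qed.

Lemma measurable_omegaN N :
  measurable_fun [set: tup N] (fun t => omegaN omega (\row_i tnth t i)).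
Proof.
(* [omega] is monotone on the half line only; composing with [Num.max 0] makes it monotone
   everywhere without changing it at norms. *)
have mo : measurable_fun [set: measurableTypeR R] (fun t : R => omega (Num.max 0 t)).
  apply: nondecreasing_measurable => //.
  move=> s t st; apply: (weight_nondecreasing homega); first by rewrite le_max lexx.
  by rewrite ge_max !le_max lexx st orbT.
have -> : (fun t : tup N => omegaN omega (\row_i tnth t i)) =
    (fun t : R => omega (Num.max 0 t)) \o
    (fun t : tup N => Num.sqrt (\sum_(i < N) tnth t i ^+ 2)).
  apply/funext => t /=; rewrite /omegaN max_r ?sqrtr_ge0//.
  by congr (omega (Num.sqrt _)); apply: eq_bigr => i _; rewrite mxE.
apply: measurableT_comp => //.
apply: (@measurableT_comp _ _ _ _ _ _ (@Num.sqrt R)).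
  by apply: continuous_measurable_fun; exact: sqrt_continuous.
apply: measurable_sum => i; apply: measurable_funX; exact: measurable_tnth.
Qed.

Definition wexp N n (t : leb_space R N) : R := expR (- (n%:R * omegaN omega (vec t))).

Lemma wexp_ge0 N n (t : leb_space R N) : 0 <= wexp n t.
Proof. exact: expR_ge0. Qed.

Lemma measurable_wexp_borel N n :
  measurable_fun [set: tup N] (fun t => expR (- (n%:R * omegaN omega (\row_i tnth t i)))).
Proof.
apply: (@measurableT_comp _ _ _ _ _ _ (@expR R)) => //.
apply: (@measurableT_comp _ _ _ _ _ _ (@GRing.opp R)) => //.
by apply: measurable_funM => //; exact: measurable_omegaN.
Qed.

Lemma measurable_wexp N n : measurable_fun [set: leb_space R N] (@wexp N n).
Proof. by apply: measurable_fun_leb_space; exact: measurable_wexp_borel. Qed.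

(** The comparison function is the product of the 1 / (1 + x_i^2), integrable by Tonelli. Its
    inverse is at most (1 + |x|)^(2 N), which [weight_log] bounds by an exponential of the
    weight. *)
Lemma wexp_integrable N : exists2 n, (0 < n)%N &
  (\int[@lebesgueN R N]_(t in [set: leb_space R N]) (wexp n t)%:E < +oo)%E.
Proof.
have [n [C [n0 C0 HC]]] := weight_log homega (2 * N); exists n => //.
rewrite (@ge0_integral_lebesgueN R N (fun t => (wexp n t)%:E)); last 2 first.
- by apply/measurable_EFinP; exact: measurable_wexp_borel.
- by move=> t; rewrite lee_fin wexp_ge0.
apply: (@le_lt_trans _ _ (\int[@borel_lebesgue R N]_t (C%:E * (prodc t)%:E)))%E; last first.
  rewrite ge0_integralZl//; last 3 first.
  - by apply/measurable_EFinP; exact: measurable_prodc.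
  - by move=> t _; rewrite lee_fin; exact: prodc_ge0.
  - by rewrite lee_fin ltW.
  by apply: lte_mul_pinfty => //; rewrite lee_fin ltW.
apply: ge0_le_integral => //.
- by move=> t _; rewrite lee_fin wexp_ge0.
- by apply/measurable_EFinP; exact: measurable_wexp_borel.
- apply: measurable_funeM; by apply/measurable_EFinP; exact: measurable_prodc.
move=> t _; rewrite -EFinM lee_fin.
rewrite /wexp expRN -[leRHS]invrK lef_pV2 ?posrE ?expR_gt0//; last first.
  rewrite invr_gt0 mulr_gt0// /prodc big_seq prodr_gt0// => s _.
  by rewrite invr_gt0 (lt_le_trans ltr01)// oneDsqr_ge1.
rewrite invfM ler_pdivrMl//; apply: le_trans (HC _ (enorm_ge0 _)).
rewrite /prodc big_tuple -prodfV exprM -[X in (_ ^+ 2) ^+ X]card_ord -prodr_const.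
apply: ler_prod => i _; rewrite invrK (le_trans ler01 (oneDsqr_ge1 _))/=.
rewrite /oneDsqr; have := coord_le_enorm (vec t) i; rewrite mxE => h.
have e0 := enorm_ge0 (vec t).
have : tnth (t : tup N) i ^+ 2 <= enorm (vec t) ^+ 2.
  rewrite -real_normK ?num_real//; apply: lerXn2r; rewrite ?nnegrE//.
by rewrite sqrrD expr1n mul1r; lra.
Qed.

End weight_integrable.

(** * A Sobolev inequality *)

Section one_dimensional.
Context {R : realType}.
Local Notation mu := (@lebesgue_measure R).

(* Integrate the derivative of (a + 1 - s) * u s. *)
Lemma norm_le_integral_unit (u du : R -> R) (a : R) :
  (forall s : R, is_derive s (1 : R) u (du s)) -> continuous du ->
  (`|u a|%:E <= \int[mu]_(s in `[a, (a + 1)%R]) (`|u s| + `|du s|)%:E)%E.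
Proof.
move=> Du cdu.
have cu : continuous u.
  move=> s; apply: differentiable_continuous; apply/derivable1_diffP.
  exact: (@ex_derive _ _ _ _ _ _ _ (Du s)).
pose v s := (a + 1 - s) * u s.
pose f s := (a + 1 - s) * du s - u s.
have Dv s : is_derive s (1 : R) v (f s).
  apply: is_derive_eq; rewrite /f /GRing.scale/=; ring.
have cv : continuous v.
  move=> s; apply: differentiable_continuous; apply/derivable1_diffP.
  exact: (@ex_derive _ _ _ _ _ _ _ (Dv s)).
have cl : continuous (fun s : R => a + 1 - s).
  by move=> s; apply: cvgB; [exact: cvg_cst|exact: cvg_id].
have cf : continuous f.
  move=> s; apply: cvgB; last exact: cu.
  by apply: cvgM; [exact: cl|exact: cdu].
have a1 : a < a + 1 by lra.
have cfw : {within `[a, a + 1], continuous f}.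
  by apply: continuous_subspaceT.
have dv : derivable_oo_LRcontinuous v a (a + 1).
  split.
  - by move=> s _; exact: (@ex_derive _ _ _ _ _ _ _ (Dv s)).
  - by apply: cvg_at_right_filter; exact: cv.
  - by apply: cvg_at_left_filter; exact: cv.
have dE : {in `]a, (a + 1)[, derive1 v =1 f}.
  by move=> s _; rewrite derive1E (@derive_val _ _ _ _ _ _ _ (Dv s)).
have := continuous_FTC2 a1 cfw dv dE.
rewrite /v subrr mul0r (_ : a + 1 - a = 1); last by ring.
rewrite mul1r sub0e => E.
have mf (D : set R) g : continuous g -> measurable_fun D (g : measurableTypeR R -> R).
  by move=> cg; apply: measurable_funTS; exact: continuous_measurable_fun.
have -> : (`|u a|%:E = `| \int[mu]_(s in `[a, (a + 1)%R]) (f s)%:E |)%E.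
  by rewrite E -EFinN /= normrN.
apply: le_trans (le_abse_integral _ _ _) _ => //.
  by apply/measurable_EFinP; exact: mf.
apply: ge0_le_integral => //.
- by apply/measurable_EFinP; apply: measurableT_comp => //; exact: mf.
- apply/measurable_EFinP; apply: measurable_funD;
    by apply: measurableT_comp => //; exact: mf.
move=> s /=; rewrite in_itv/= => /andP[as_ sa]; rewrite lee_fin.
apply: le_trans (ler_normB _ _) _; rewrite addrC lerD2l normrM ler_piMl//.
by rewrite ger0_norm; lra.
Qed.

End one_dimensional.

Section cube.
Context {R : realType} {N : nat}.
Local Notation C := R[i].
Local Notation Rn := 'rV[R]_N.
Local Notation mu := (@lebesgue_measure R).
Local Notation tup n := (n.-tuple (measurableTypeR R)).
Implicit Types (f g : Rn -> C) (x y : Rn).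

(** The one-dimensional inequality is applied to the real and the imaginary part separately; with
    this modulus the two results simply add up. *)
Definition cabs1 (z : C) : R := `|complex.Re z| + `|complex.Im z|.

Lemma cabs1_ge0 z : 0 <= cabs1 z.
Proof. by rewrite addr_ge0. Qed.

Lemma continuous_cabs1 f : smooth f -> continuous (fun x => cabs1 (f x)).
Proof.
move=> /smooth_diff1[c1 c2 _] x; rewrite /cabs1.
apply: (@continuousD R R _ (fun x => `|re_part f x|) (fun x => `|im_part f x|) x).
- exact: (@continuous_comp Rn R R (re_part f) (@Num.norm R R) x (c1 x)
    (@norm_continuous R R (re_part f x))).
- exact: (@continuous_comp Rn R R (im_part f) (@Num.norm R R) x (c2 x)
    (@norm_continuous R R (im_part f x))).
Qed.

Definition upd x (i : 'I_N) (s : R) : Rn := \row_j (if j == i then s else x 0 j).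

Lemma updE x i s : upd x i s = upd x i 0 + s *: delta_mx 0 i.
Proof.
apply/rowP => j; rewrite !mxE eqxx /=.
by case: eqP => _; rewrite ?mulr1 ?mulr0 ?add0r ?addr0.
Qed.

Lemma upd_id x i : upd x i (x 0 i) = x.
Proof. by apply/rowP => j; rewrite mxE; case: eqP => [->|]. Qed.

Lemma continuous_upd x i : continuous (upd x i).
Proof.
have -> : upd x i = (fun s => upd x i 0 + s *: delta_mx 0 i).
  by apply/funext => s; rewrite updE.
move=> s; apply: (@continuousD R Rn _ (fun=> upd x i 0) (fun s : R => s *: delta_mx 0 i) s).
  exact: cst_continuous.
exact: scalel_continuous.
Qed.

Lemma cabs1_le_integral_line f x i : smooth f ->
  ((cabs1 (f x))%:E <= \int[mu]_(s in `[(x 0 i)%R, (x 0 i + 1)%R])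
    (cabs1 (f (upd x i s)) + cabs1 (partial i f (upd x i s)))%:E)%E.
Proof.
move=> sf; have d1 := smooth_diff1 sf.
have [c1 c2 _] := d1; have [c3 c4 _] := smooth_diff1 (smooth_partial i sf).
have line (F dF : Rn -> R) : (forall y, is_derive y (delta_mx 0 i : Rn) F (dF y)) ->
    continuous dF ->
    ((`|F x|)%:E <= \int[mu]_(s in `[(x 0 i)%R, (x 0 i + 1)%R])
      (`|F (upd x i s)| + `|dF (upd x i s)|)%:E)%E.
  move=> DF cdF.
  have := @norm_le_integral_unit R (fun s => F (upd x i s)) (fun s => dF (upd x i s)) (x 0 i).
  rewrite upd_id; apply.
    move=> s; have -> : (fun s => F (upd x i s)) = (fun s => F (upd x i 0 + s *: delta_mx 0 i)).
      by apply/funext => r; rewrite -updE.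
    have := DF (upd x i s); rewrite updE => D.
    have := is_derive_line (@ex_derive _ _ _ _ _ _ _ D).
    by rewrite (@derive_val _ _ _ _ _ _ _ D).
  move=> s; apply: (@continuous_comp _ _ _ (upd x i) dF); first exact: continuous_upd.
  exact: cdF.
have m (D : set R) (F : Rn -> R) : continuous F ->
    measurable_fun D (fun s : measurableTypeR R => `|F (upd x i s)| : R).
  move=> cF; apply: measurable_funTS.
  apply: (@continuous_measurable_fun _ (fun s => `|F (upd x i s)|)) => s.
  have cs := @continuous_comp R Rn R (upd x i) F s (@continuous_upd x i s) (cF _).
  exact: (@continuous_comp R R R (fun s => F (upd x i s)) (@Num.norm R R) s cs
    (@norm_continuous R R _)).
have r1 := line (re_part f) (re_part (partial i f)) (fun y => (diff1_is_partial i y d1).1) c3.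
have r2 := line (im_part f) (im_part (partial i f)) (fun y => (diff1_is_partial i y d1).2) c4.
rewrite EFinD; apply: le_trans (leeD r1 r2) _.
rewrite -ge0_integralD//.
- rewrite le_eqVlt; apply/orP; left; apply/eqP; apply: eq_integral => s _.
  by rewrite -EFinD /cabs1 /re_part /im_part; congr (_%:E); ring.
- by apply/measurable_EFinP; apply: measurable_funD; exact: m.
- by apply/measurable_EFinP; apply: measurable_funD; exact: m.
Qed.

End cube.

Section sobolev_cube.
Context {R : realType} {N : nat}.
Local Notation C := R[i].
Local Notation Rn := 'rV[R]_N.
Local Notation mu := (@lebesgue_measure R).
Local Notation tup n := (n.-tuple (measurableTypeR R)).
Variables (g : Rn -> C) (x : Rn).
Hypothesis sg : smooth g.

Let coords (l : seq 'I_N) : seq R := [seq x 0 i | i <- l].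

(** With [enum 'I_N = l0 ++ l], the coordinates in [l0] are frozen at those of [x] and the others
    are read off [t]. The induction releases one coordinate at a time, starting from the last. *)
Let emb (l0 : seq 'I_N) (t : seq R) : Rn := \row_i nth 0 (coords l0 ++ t) i.

Definition unit_ind (a s : R) : R := (a <= s <= a + 1)%R%:R.

Let cubr (l : seq 'I_N) (t : seq R) : R := \prod_(p <- zip (coords l) t) unit_ind p.1 p.2.

(** The words using each letter of [l] at most once: the mixed derivatives created by one
    application of the one-dimensional inequality in each coordinate. *)
Definition subseqs (l : seq 'I_N) : seq (seq 'I_N) :=
  foldr (fun i L => L ++ [seq i :: s | s <- L]) [:: [::]] l.

Let G (l0 l : seq 'I_N) (t : seq R) : R :=
  cubr l t * \sum_(s <- subseqs l) cabs1 (dseq s g (emb l0 t)).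

Let unit_ind_ge0 a s : 0 <= unit_ind a s. Proof. exact: ler0n. Qed.

Let cubr_ge0 l t : 0 <= cubr l t.
Proof. by rewrite /cubr big_seq prodr_ge0. Qed.

Let G_ge0 l0 l t : 0 <= G l0 l t.
Proof. by rewrite mulr_ge0// sumr_ge0// => s _; exact: cabs1_ge0. Qed.

Let measurable_unit_ind a : measurable_fun [set: measurableTypeR R] (unit_ind a).
Proof.
have -> : unit_ind a = \1_(`[a, a + 1]%classic).
  by apply/funext => s; rewrite indicE /unit_ind mem_setE in_itv.
exact: measurable_indic.
Qed.

Let measurable_G (l0 l : seq 'I_N) : measurable_fun [set: tup (size l)] (fun t => G l0 l t).
Proof.
apply: measurable_funM.
  have -> : (fun t : tup (size l) => cubr l t) =
      (fun t : tup (size l) => \prod_(j < size l) unit_ind (nth 0 (coords l) j) (tnth t j)).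
    apply/funext => t; rewrite /cubr (big_nth (0, 0)) size_zip size_tuple size_map minnn big_mkord.
    by apply: eq_bigr => j _; rewrite nth_zip ?size_tuple ?size_map//= (tnth_nth 0).
  apply: measurable_prod => j _.
  by apply: measurableT_comp; [exact: measurable_unit_ind|exact: measurable_tnth].
apply: measurable_sum => s.
apply: (@measurable_continuous_rV R N _ _ (fun t : tup (size l) => emb l0 t)
  (fun y => cabs1 (dseq s g y))); last by apply: continuous_cabs1; exact: smooth_dseq.
move=> i; rewrite /emb.
have [il|li] := ltnP i (size (coords l0)).
  rewrite (_ : (fun t => _) = (fun=> nth 0 (coords l0) i)); first exact: measurable_cst.
  by apply/funext => t; rewrite mxE nth_cat il.
have [jl|lj] := ltnP (i - size (coords l0)) (size l).
  rewrite (_ : (fun t => _) = (fun t : tup (size l) => tnth t (Ordinal jl))).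
    exact: measurable_tnth.
  by apply/funext => t; rewrite mxE nth_cat ltnNge li/= (tnth_nth 0).
rewrite (_ : (fun t => _) = (fun=> 0)); first exact: measurable_cst.
by apply/funext => t; rewrite mxE nth_cat ltnNge li/= nth_default// size_tuple.
Qed.

Let enum_pos (l0 l : seq 'I_N) i : enum 'I_N = l0 ++ i :: l -> nat_of_ord i = size l0.
Proof.
move=> E; have := nth_enum_ord i (ltn_ord i).
have sz : (size l0 < N)%N.
  by rewrite -[X in (_ < X)%N]size_enum_ord E size_cat /= addnS ltnS leq_addr.
have := nth_enum_ord i sz; rewrite E nth_cat ltnn subnn /=.
by [].
Qed.

Let emb_rcons l0 l i t : enum 'I_N = l0 ++ i :: l -> emb (rcons l0 i) t 0 i = x 0 i.
Proof.
move=> E; rewrite mxE /coords map_rcons cat_rcons nth_cat size_map (enum_pos E) ltnn subnn.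
by [].
Qed.

Let emb_cons l0 l i s t : enum 'I_N = l0 ++ i :: l ->
  emb l0 (s :: t) = upd (emb (rcons l0 i) t) i s.
Proof.
move=> E; apply/rowP => j; rewrite !mxE /coords map_rcons cat_rcons !nth_cat size_map.
have [->|ji] := eqVneq j i; first by rewrite (enum_pos E) ltnn subnn.
case: ltnP => // lj; case k : (j - size l0)%N => [|k'] //=.
move: k => /eqP; rewrite subn_eq0 => jl.
by case/eqP: ji; apply: val_inj; apply/eqP; rewrite /= (enum_pos E) eqn_leq jl lj.
Qed.

(** The one-dimensional inequality in the coordinate [i], for every derivative of the sum. It leaves
    that derivative and adds the one with [i] in front, matching the two halves of
    [subseqs (i :: l)]. *)
Let G_step l0 l i (t : tup (size l)) : enum 'I_N = l0 ++ i :: l ->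
  ((G (rcons l0 i) l t)%:E <= \int[mu]_s (G l0 (i :: l) (tcons (s, t)))%:E)%E.
Proof.
move=> E; set y := emb (rcons l0 i) t.
have yi : y 0 i = x 0 i by exact: emb_rcons E.
pose H s := \sum_(r <- subseqs l) (cabs1 (dseq r g (upd y i s)) +
  cabs1 (partial i (dseq r g) (upd y i s))).
have GE s : G l0 (i :: l) (tcons (s, t)) = cubr l t * (unit_ind (x 0 i) s * H s).
  rewrite /G /= (emb_cons s t E) -/y big_cat /= big_map -big_split /= mulrA; congr (_ * _).
  by rewrite /cubr /= big_cons mulrC.
have cH h : smooth h -> measurable_fun [set: measurableTypeR R] (fun s => cabs1 (h (upd y i s))).
  move=> sh; apply: (@continuous_measurable_fun _ (fun s => cabs1 (h (upd y i s)))) => s.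
  have cF : continuous (fun z : Rn => cabs1 (h z)) by exact: continuous_cabs1.
  have cs := @continuous_comp R Rn R (upd y i) (fun z => cabs1 (h z)) s
    (@continuous_upd R N y i s) (cF _).
  exact: cs.
have mH1 r : measurable_fun [set: measurableTypeR R] (fun s =>
    cabs1 (dseq r g (upd y i s)) + cabs1 (partial i (dseq r g) (upd y i s))).
  have sr := smooth_dseq r sg.
  by apply: measurable_funD; apply: cH; [exact: sr|exact: smooth_partial].
have mH : measurable_fun [set: measurableTypeR R] H by apply: measurable_sum.
have H0 s : 0 <= H s by apply: sumr_ge0 => r _; rewrite addr_ge0 ?cabs1_ge0.
have sumH : ((\sum_(r <- subseqs l) cabs1 (dseq r g y))%:E <=
    \int[mu]_(s in `[(x 0%R i), (x 0 i + 1)%R]) (H s)%:E)%E.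
  rewrite /H; under eq_integral do rewrite -sumEFin.
  rewrite ge0_integral_sum//; last 2 first.
  - by move=> r; apply/measurable_EFinP; apply: measurable_funTS.
  - by move=> r s _; rewrite lee_fin addr_ge0 ?cabs1_ge0.
  rewrite -sumEFin; apply: lee_sum => r _.
  by rewrite -yi; apply: cabs1_le_integral_line; exact: smooth_dseq.
rewrite /G -/y; apply: (@le_trans _ _ ((cubr l t)%:E *
    \int[mu]_(s in `[(x 0%R i), (x 0 i + 1)%R]) (H s)%:E)%E).
  by rewrite EFinM; apply: lee_wpmul2l => //; rewrite lee_fin.
rewrite integral_mkcond -ge0_integralZl//; last 3 first.
- apply/(measurable_restrictT _ _).1 => //.
  by apply/measurable_EFinP; apply: measurable_funTS.
- by move=> s _; rewrite patchE; case: ifP => // _; rewrite lee_fin.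
- by rewrite lee_fin.
rewrite le_eqVlt; apply/orP; left; apply/eqP; apply: eq_integral => s _.
rewrite -[X in _ = X%:E]/(G l0 (i :: l) (tcons (s, t))) GE EFinM; congr (_ * _)%E; rewrite patchE mem_setE in_itv/= /unit_ind.
by case: ifP => _; rewrite ?mul1r ?mul0r.
Qed.

(** When [l] is empty all coordinates are frozen and both sides are the value at [x]; each letter
    put back adds one integration. *)
Let G_bound l l0 : enum 'I_N = l0 ++ l ->
  ((cabs1 (g x))%:E <= \int[@borel_lebesgue R (size l)]_t (G l0 l t)%:E)%E.
Proof.
elim: l l0 => [|i l IH] l0 E.
  have mG : measurable_fun [set: tup 0] (fun t : tup 0 => (G l0 [::] t)%:E).
    by apply/measurable_EFinP; exact: (@measurable_G l0 [::]).
  have D := @integral_dirac _ (tup 0) [tuple] R setT measurableT _ mG.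
  apply: (@le_trans _ _ (\d_([tuple] : tup 0) setT * (G l0 [::] [::])%:E)%E); last first.
    by rewrite -D.
  rewrite diracT mul1e lee_fin /G /cubr /= big_nil mul1r big_seq1 /=.
  rewrite (_ : emb l0 [::] = x)//; apply/rowP => i; rewrite mxE cats0.
  rewrite cats0 in E; rewrite -E /coords (nth_map i) ?size_enum_ord//.
  by rewrite nth_ord_enum.
have /IH E2 : enum 'I_N = rcons l0 i ++ l by rewrite cat_rcons.
apply: le_trans E2 _ => /=.
rewrite (@ge0_integral_borel_step R (size l) (fun t => (G l0 (i :: l) t)%:E)); last 2 first.
- by apply/measurable_EFinP; exact: (@measurable_G l0 (i :: l)).
- by move=> t; rewrite lee_fin.
apply: ge0_le_integral => //.
- by move=> t _; rewrite lee_fin.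
- by apply/measurable_EFinP; exact: measurable_G.
- have := @measurable_fun_fubini_tonelli_G _ _ (measurableTypeR R) (tup (size l)) R
    (@lebesgue_measure R) (fun p => (G l0 (i :: l) (tcons p))%:E).
  apply.
    apply/measurable_EFinP.
    apply: (@measurableT_comp _ _ _ _ _ _ (fun t : tup (size l).+1 => G l0 (i :: l) t)).
      exact: (@measurable_G l0 (i :: l)).
    exact: measurable_tcons.
  by move=> p; rewrite lee_fin.
- by move=> t _; exact: G_step.
Qed.

(** [K] is the indicator of the cube x + [0, 1]^N, known outside through these properties only. *)
Lemma cabs1_le_integral_cube : exists K : tup N -> R,
  [/\ measurable_fun [set: tup N] K, forall t, 0 <= K t <= 1,
   forall t, K t != 0 -> forall i, x 0 i <= tnth t i <= x 0 i + 1 &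
  ((cabs1 (g x))%:E <= \int[@borel_lebesgue R N]_t
    (K t * \sum_(s <- subseqs (enum 'I_N)) cabs1 (dseq s g (\row_i tnth t i)))%:E)%E].
Proof.
have szN : size (enum 'I_N) = N by rewrite size_enum_ord.
pose K (t : tup N) := cubr (enum 'I_N) t.
have KE t : K t = \prod_(i < N) unit_ind (x 0 i) (tnth t i).
  have szc : size (coords (enum 'I_N)) = N by rewrite /coords size_map.
  have szt : size t = N by exact: size_tuple.
  rewrite /K /cubr (big_nth (0, 0)) size_zip szc szt minnn big_mkord.
  apply: eq_bigr => j _; rewrite nth_zip ?szc ?szt//= (tnth_nth 0).
  by rewrite (nth_map j) ?szN// nth_ord_enum.
have embE (t : tup N) : emb [::] t = \row_i tnth t i.
  by apply/rowP => i; rewrite !mxE /= (tnth_nth 0).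
exists K; split.
- rewrite (_ : K = (fun t => \prod_(i < N) unit_ind (x 0 i) (tnth t i))); last exact/funext.
  apply: measurable_prod => j _.
  by apply: measurableT_comp; [exact: measurable_unit_ind|exact: measurable_tnth].
- move=> t; rewrite KE prodr_ge0//=; apply: prodr_ile1 => i _.
  by rewrite unit_ind_ge0/= /unit_ind; case: (_ <= _ <= _) => //; exact: ler01.
- move=> t; rewrite KE => K0 i; move: K0; rewrite (bigD1 i)//= mulf_eq0 negb_or => /andP[+ _].
  by rewrite /unit_ind; case: (_ <= _ <= _) => //; rewrite eqxx.
- have := @G_bound (enum 'I_N) [::] erefl; rewrite szN => /le_trans; apply.
  rewrite le_eqVlt; apply/orP; left; apply/eqP; apply: eq_integral => t _.
  by rewrite /G embE.
Qed.

End sobolev_cube.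

Section sobolev.
Context {R : realType} {N : nat} (omega : R -> R).
Hypothesis homega : nonquasianalytic_weight omega.
Local Notation C := R[i].
Local Notation Rn := 'rV[R]_N.
Local Notation cw := (cw omega).
Local Notation w x := (omegaN omega x).
Local Notation tup n := (n.-tuple (measurableTypeR R)).
Local Notation leb := (@lebesgueN R N).

Let subseqs_size l (s : seq 'I_N) : s \in subseqs l -> (size s <= size l)%N.
Proof.
elim: l s => [s|i l IH s] /=; first by rewrite inE => /eqP ->.
rewrite mem_cat => /orP[/IH/leqW//|/mapP[r /IH rl ->]] /=.
by rewrite ltnS.
Qed.

(** On the cube |y| <= N (|x| + 1) <= 2^N |x| + N, which is the form that [weight_affine]
    accepts. *)
Let omegaN_cube : exists2 A, 0 < A & forall x y : Rn,
  (forall i, x 0 i <= y 0 i <= x 0 i + 1) -> w y <= A * (1 + w x).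
Proof.
have [A A0 HA] := weight_affine homega N N%:R; exists A => // x y xy.
apply: HA; try exact: enorm_ge0.
apply: le_trans (enorm_le_sum y) _.
apply: (@le_trans _ _ (\sum_(i < N) (enorm x + 1))).
  apply: ler_sum => i _; have := xy i; have := coord_le_enorm x i.
  rewrite !ler_norml => /andP[h1 h2] /andP[h3 h4]; apply/andP; split; lra.
rewrite sumr_const card_ord -[(_ + _) *+ N]mulr_natl mulrDr mulr1 lerD2r ler_wpM2r ?enorm_ge0//.
by rewrite -natrX ler_nat ltnW// ltn_expl.
Qed.

Lemma measurable_cabs1 (f : Rn -> C) n : smooth f ->
  measurable_fun [set: tup N] (fun t => cabs1 (f (\row_i tnth t i)) * wexp omega n (t : leb_space R N)).
Proof.
move=> sf; apply: measurable_funM; last exact: (measurable_wexp_borel homega).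
exact: (measurable_vec_continuous (continuous_cabs1 sf)).
Qed.

(** [M] absorbs the extra derivatives and is chosen before [n], whereas [n'] absorbs the variation
    of the weight over a unit cube and may depend on [n]. *)
Lemma sobolev_O_bound m : (0 < m)%N -> exists2 M, (0 < M)%N &
  forall n, exists n' D, [/\ (0 < n')%N, 0 <= D & forall (f : Rn -> C) Q, smooth f -> 0 <= Q ->
    (forall s, (cw M (size s))%:E *
       \int[leb]_(t in [set: leb_space R N]) (cabs1 (dseq s f (vec t)) * wexp omega n t)%:E
         <= Q%:E)%E ->
    O_bound omega m n' f (D * Q)].
Proof.
move=> m0; have [A A0 HA] := omegaN_cube.
have [M [B [mM B0 HB]]] := cw_shift homega N m0.
exists M => [|n]; first exact: leq_trans mM.
have nA0 : 0 <= n%:R * A by rewrite mulr_ge0// ltW.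
have [n' nA] : exists n' : nat, n%:R * A <= n'%:R.
  by exists (Num.bound (n%:R * A)); apply/ltW/archi_boundP.
(* On the cube n omega y <= n A + n A omega x: the first summand gives [E], the second is absorbed
   by [n']. *)
pose E := expR (n%:R * A).
pose k := size (subseqs (enum 'I_N)).
exists n'.+1, (E * B *+ k); split=> //.
  by rewrite mulrn_wge0// mulr_ge0 ?expR_ge0 ?ltW.
move=> f Q sf Q0 HQ s x; set g := dseq s f.
have sg : smooth g by exact: smooth_dseq.
have [K [mK K01 Kx Kle]] := cabs1_le_integral_cube x sg.
have c0 : 0 <= cw m (size s) by exact: cw_ge0.
have e0 := expR_ge0 (- (n'.+1%:R * w x)).
pose S (t : tup N) := \sum_(r <- subseqs (enum 'I_N))
  cabs1 (dseq r g (\row_i tnth t i)) * wexp omega n (t : leb_space R N).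
have mT r : measurable_fun [set: tup N]
    (fun t => (cabs1 (dseq r g (\row_i tnth t i)) * wexp omega n (t : leb_space R N))%:E).
  by apply/measurable_EFinP; apply: measurable_cabs1; exact: smooth_dseq.
have T0 r (t : tup N) :
    0 <= cabs1 (dseq r g (\row_i tnth t i)) * wexp omega n (t : leb_space R N).
  by rewrite mulr_ge0 ?cabs1_ge0 ?wexp_ge0.
have mS : measurable_fun [set: tup N] S.
  by apply: measurable_sum => r; apply: measurable_cabs1; exact: smooth_dseq.
have S0 t : 0 <= S t by exact: sumr_ge0.
have mKS : measurable_fun [set: tup N] (fun t => (K t *
    \sum_(s <- subseqs (enum 'I_N)) cabs1 (dseq s g (\row_i tnth t i)))%:E).
  apply/measurable_EFinP; apply: measurable_funM => //.
  apply: measurable_sum => r.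
  exact: (measurable_vec_continuous (continuous_cabs1 (smooth_dseq r sg))).
have KS0 t : 0 <= K t * \sum_(s <- subseqs (enum 'I_N)) cabs1 (dseq s g (\row_i tnth t i)).
  rewrite mulr_ge0 ?sumr_ge0//; first by have /andP[] := K01 t.
  by move=> r _; exact: cabs1_ge0.
have h1 : ((cabs1 (g x) * expR (- (n'.+1%:R * w x)))%:E <=
    E%:E * \int[@borel_lebesgue R N]_t (S t)%:E)%E.
  rewrite -ge0_integralZl//; last 3 first.
  - by apply/measurable_EFinP.
  - by move=> t _; rewrite lee_fin.
  - by rewrite lee_fin expR_ge0.
  rewrite mulrC EFinM; apply: (@le_trans _ _ ((expR (- (n'.+1%:R * w x)))%:E * _)%E).
    by apply: lee_wpmul2l Kle; rewrite lee_fin.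
  rewrite -ge0_integralZl//; last by move=> t _; rewrite lee_fin.
  apply: ge0_le_integral => //.
  - by move=> t _; rewrite mule_ge0// lee_fin.
  - exact: measurable_funeM.
  - by apply: measurable_funeM; apply/measurable_EFinP.
  move=> t _; rewrite -!EFinM lee_fin /S.
  have [K0|K0] := eqVneq (K t) 0.
    by rewrite K0 mul0r mulr0 mulr_ge0 ?expR_ge0//; exact: S0.
  have wy : w (\row_i tnth t i) <= A * (1 + w x).
    by apply: HA => i; rewrite mxE; exact: Kx.
  rewrite -mulr_suml; set Z := \sum_(_ <- _) _.
  have Z0 : 0 <= Z by apply: sumr_ge0 => r _; exact: cabs1_ge0.
  rewrite mulrA [leRHS]mulrA [leRHS]mulrAC; apply: ler_wpM2r => //.
  apply: (@le_trans _ _ (expR (- (n'.+1%:R * w x)))).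
    by rewrite ler_piMr//; have /andP[] := K01 t.
  rewrite /wexp -expRD ler_expR.
  have wx0 : 0 <= w x by exact: omegaN_ge0.
  have a1 : n%:R * w (vec (t : leb_space R N)) <= n%:R * (A * (1 + w x)).
    by rewrite ler_wpM2l.
  have a2 : n%:R * A * w x <= n'%:R * w x by rewrite ler_wpM2r.
  have a3 : n'%:R * w x <= n'.+1%:R * w x by rewrite ler_wpM2r// ler_nat.
  rewrite (_ : n%:R * (A * (1 + w x)) = n%:R * A + n%:R * A * w x) in a1; last by ring.
  lra.
have h2 : ((cw m (size s))%:E * \int[@borel_lebesgue R N]_t (S t)%:E <= (B * Q *+ k)%:E)%E.
  rewrite /S; under eq_integral do rewrite -sumEFin.
  rewrite ge0_integral_sum//; last by move=> r t _; rewrite lee_fin.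
  rewrite ge0_sume_distrr; last by move=> r _; apply: integral_ge0 => t _; rewrite lee_fin.
  have -> : (B * Q *+ k)%:E = (\sum_(r <- subseqs (enum 'I_N)) (B * Q)%:E)%E.
    by rewrite sumEFin big_const_seq count_predT iter_addr addr0.
  rewrite big_seq [leRHS]big_seq; apply: lee_sum => r /subseqs_size.
  rewrite size_enum_ord => rN.
  apply: (@le_trans _ _ ((B * cw M (size r + size s))%:E * \int[@borel_lebesgue R N]_t
     (cabs1 (dseq r g (\row_i tnth t i)) * wexp omega n (t : leb_space R N))%:E)%E).
    apply: lee_wpmul2r; first by apply: integral_ge0 => t _; rewrite lee_fin.
    by rewrite lee_fin; exact: HB.
  rewrite !EFinM -muleA; apply: lee_wpmul2l; first by rewrite lee_fin ltW.
  have := HQ (r ++ s); rewrite size_cat.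
  rewrite (@ge0_integral_lebesgueN R N (fun t => (cabs1 (dseq (r ++ s) f (\row_i tnth t i)) *
    wexp omega n (t : leb_space R N))%:E)); last 2 first.
  - by apply/measurable_EFinP; apply: measurable_cabs1; exact: smooth_dseq.
  - by move=> t; rewrite lee_fin mulr_ge0 ?cabs1_ge0 ?wexp_ge0.
  by rewrite dseq_cat.
rewrite -lee_fin; apply: (@le_trans _ _ ((cabs1 (g x) * expR (- (n'.+1%:R * w x))) *
    cw m (size s))%:E).
  rewrite lee_fin ler_wpM2r// ler_wpM2r//; exact: cabs_le.
rewrite EFinM; apply: le_trans (lee_wpmul2r _ h1) _; first by rewrite lee_fin.
rewrite -muleA [(_ * (cw _ _)%:E)%E]muleC.
apply: (@le_trans _ _ (E%:E * (B * Q *+ k)%:E)%E).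
  by apply: lee_wpmul2l => //; rewrite lee_fin expR_ge0.
by rewrite -EFinM lee_fin mulrnAr mulrnAl mulrA.
Qed.

End sobolev.

(** * Densities of dominated functionals *)

Section bounded_measurable.
Context d (T : measurableType d) (R : realType).
Implicit Types g h w : T -> R.

(** True functions instead of classes modulo null sets. They include the indicators, which define a
    charge, and all derivatives of test functions. *)
Definition bmeas : set (T -> R) :=
  [set g : T -> R | measurable_fun [set: T] g /\ exists B, forall t, `|g t| <= B].

Lemma bmeas_lin : lin_closed bmeas.
Proof.
move=> a f g [mf [B fB]] [mg [B' gB]]; split.
  by apply: measurable_funD => //; apply: measurable_funM.
exists (`|a| * B + B') => t; apply: le_trans (ler_normD _ _) _.
by rewrite lerD// normrM ler_wpM2l.
Qed.

Lemma bmeas_indic A : measurable A -> bmeas (\1_A).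
Proof.
move=> mA; split; first exact: measurable_indic.
by exists 1 => t; rewrite indicE; case: (_ \in _); rewrite ?normr1 ?normr0.
Qed.

Lemma bmeas0 : bmeas (fun=> 0).
Proof. by split=> //; exists 0 => t; rewrite normr0. Qed.

(* Simple functions with values in a grid are uniformly dense. *)
Lemma bmeas_ext (V W : (T -> R) -> R) : linear_on bmeas V -> linear_on bmeas W ->
  (forall A, measurable A -> V (\1_A) = W (\1_A)) ->
  (exists C, forall g e, bmeas g -> (forall t, `|g t| <= e) -> `|V g| <= C * e) ->
  (exists C, forall g e, bmeas g -> (forall t, `|g t| <= e) -> `|W g| <= C * e) ->
  forall g, bmeas g -> V g = W g.
Proof.
move=> VL WL VW [C VC] [D WD] g bg; have [mg [B gB]] := bg.
pose L := Num.bound `|B|.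
have gL t : `|g t| < L%:R.
  apply: le_lt_trans (gB t) _; apply: le_lt_trans (ler_norm _) _.
  exact: archi_boundP.
apply/eqP; rewrite -subr_eq0 -normr_le0; apply/ler_addgt0Pl => e e0; rewrite addr0.
pose k := Num.bound ((`|C| + `|D|) / e).
have k0 : (0 : R) < k.+1%:R by rewrite ltr0n.
have ke : (`|C| + `|D|) * k.+1%:R^-1 <= e.
  rewrite ler_pdivrMr// mulrC -ler_pdivrMr//.
  apply/ltW; apply: lt_le_trans (archi_boundP _) _; last by rewrite ler_nat.
  by rewrite divr_ge0 ?addr_ge0// ltW.
(* |g| < L, so the integer parts of (k + 1) g lie between - M and M; the shift by [M] enumerates
   them by natural numbers up to 2 M. *)
pose M := (k.+1 * L)%N.
pose A (l : nat) := [set t | Num.floor (k.+1%:R * g t) = l%:Z - M%:Z].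
have mA l : measurable (A l).
  have -> : A l = g @^-1` `[(l%:R - M%:R) / k.+1%:R, (l%:R - M%:R + 1) / k.+1%:R[.
    apply/seteqP; split=> t; rewrite /A /= in_itv/= ler_pdivrMr// ltr_pdivlMr// [g t * _]mulrC.
      by move=> E; have := floor_itv (k.+1%:R * g t); rewrite E intrD1 intrB.
    by move=> H; apply: floor_def; rewrite intrD1 intrB.
  by rewrite -[X in measurable X]setTI; apply: mg => //; exact: measurable_itv.
pose s t := \sum_(l <- iota 0 (2 * M).+1) ((l%:R - M%:R) / k.+1%:R) * (\1_(A l) t : R).
have sE t : s t = (Num.floor (k.+1%:R * g t))%:~R / k.+1%:R.
  have fl := floor_itv (k.+1%:R * g t); rewrite intrD1 in fl; have /andP[f1 f2] := fl.
  set z := Num.floor _ in fl f1 f2 *.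
  have ML : M%:R = k.+1%:R * L%:R :> R by rewrite /M natrM.
  have /andP[g1 g2] : - M%:R < k.+1%:R * g t < M%:R.
    by rewrite -ltr_norml normrM gtr0_norm// ML ltr_pM2l.
  have z1 : - M%:Z <= z by rewrite /z floor_ge_int mulrNz ltW.
  have z2 : z <= M%:Z by rewrite -(ler_int R) ltW// (le_lt_trans f1).
  have [l lE] : exists l : nat, z = l%:Z - M%:Z.
    exists (absz (z + M%:Z)%R); rewrite gez0_abs; [ring|lia].
  have lM : (l < (2 * M).+1)%N by lia.
  rewrite /s (bigD1_seq l) ?iota_uniq ?mem_iota//=.
  rewrite big1_seq ?addr0.
    by rewrite indicE mem_set ?mulr1// lE intrB.
  move=> j /andP[jl _]; rewrite indicE memNset ?mulr0// /A /= -/z lE => E.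
  by case/eqP: jl; lia.
have gs t : `|g t - s t| <= k.+1%:R^-1.
  rewrite sE; have -> : g t - (Num.floor (k.+1%:R * g t))%:~R / k.+1%:R =
      (k.+1%:R * g t - (Num.floor (k.+1%:R * g t))%:~R) / k.+1%:R.
    by field; rewrite -natr1 in k0 *; rewrite gt_eqF.
  rewrite normrM [X in _ * X]ger0_norm ?invr_ge0 ?(ltW k0)//.
  rewrite ler_piMl ?invr_ge0 ?(ltW k0)//.
  have := floor_itv (k.+1%:R * g t); rewrite intrD1 => /andP[h1 h2].
  by rewrite ger0_norm ?subr_ge0// lerBlDr addrC ltW.
have bF l : bmeas (fun t => ((l%:R - M%:R) / k.+1%:R) * (\1_(A l) t : R)).
  by apply: (lin_closedZ _ bmeas_lin); exact: bmeas_indic.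
have [bs Vs] := linear_on_sum (iota 0 (2 * M).+1) bmeas_lin VL bmeas0 bF.
have [_ Ws] := linear_on_sum (iota 0 (2 * M).+1) bmeas_lin WL bmeas0 bF.
have VWs : V s = W s.
  rewrite /s Vs Ws; apply: eq_bigr => l _.
  rewrite (linear_onZ _ bmeas_lin VL (bmeas_indic (mA l))).
  by rewrite (linear_onZ _ bmeas_lin WL (bmeas_indic (mA l))) VW.
have bgs : bmeas (fun t => g t - s t).
  have := bmeas_lin (-1) bs bg.
  have -> : (fun t => -1 * s t + g t) = (fun t => g t - s t).
    by apply/funext => t; rewrite mulN1r addrC.
  by [].
have -> : V g - W g = V (fun t => g t - s t) - W (fun t => g t - s t).
  by rewrite (linear_onB bmeas_lin VL)// (linear_onB bmeas_lin WL)// VWs; ring.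
apply: le_trans (ler_normB _ _) _; apply: le_trans ke; rewrite mulrDl.
by apply: lerD; [apply: le_trans (VC _ _ bgs gs) _|apply: le_trans (WD _ _ bgs gs) _];
  rewrite ler_wpM2r ?ler_norm// invr_ge0 ltW.
Qed.

End bounded_measurable.

Section dominated_functional.
Context d (T : measurableType d) (R : realType).
Variable mu : {sigma_finite_measure set T -> \bar R}.
Implicit Types g h f w : T -> R.

Lemma integrable_bmeasM g w : bmeas g -> mu.-integrable [set: T] (EFin \o w) ->
  mu.-integrable [set: T] (EFin \o (g \* w)).
Proof.
move=> [mg [B gB]] iw; have mw : measurable_fun [set: T] w.
  by apply/measurable_EFinP; exact: measurable_int iw.
apply: (@le_integrable _ _ _ mu _ measurableT _ (fun t => (B%:E * (EFin \o w) t)%E)).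
- by apply/measurable_EFinP; exact: measurable_funM.
- move=> t _ /=; rewrite lee_fin !normrM ler_wpM2r//.
  by apply: le_trans (gB t) _; exact: ler_norm.
- exact: integrableZl.
Qed.

(** Integrate f - w over the set where it is positive: the integral is both nonnegative and
    nonpositive. *)
Lemma null_set_lt f w : mu.-integrable [set: T] (EFin \o f) ->
  mu.-integrable [set: T] (EFin \o w) ->
  (forall A, measurable A -> (\int[mu]_(t in A) (f t)%:E <= \int[mu]_(t in A) (w t)%:E)%E) ->
  mu.-negligible [set t | w t < f t].
Proof.
move=> if_ iw fw; set P := [set t | _].
have mf : measurable_fun [set: T] f by apply/measurable_EFinP; exact: measurable_int if_.
have mw : measurable_fun [set: T] w by apply/measurable_EFinP; exact: measurable_int iw.
have mP : measurable P.
  have -> : P = [set: T] `&` (fun t => w t < f t) @^-1` [set true] by rewrite setTI.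
  exact: measurable_fun_ltr.
have mfw : measurable_fun P (fun t => (f t - w t)%:E).
  by apply/measurable_EFinP/measurable_funTS/measurable_funB.
have ifP : mu.-integrable P (EFin \o f) by exact: integrableS if_.
have iwP : mu.-integrable P (EFin \o w) by exact: integrableS iw.
have z : (\int[mu]_(t in P) `|(f t - w t)%:E| = 0)%E.
  apply/eqP; rewrite eq_le integral_ge0 ?andbT//.
  under eq_integral.
    move=> t; rewrite inE /P /= => wf; rewrite gtr0_norm ?subr_gt0// EFinB. over.
  rewrite integralB_EFin// leeBlDr ?add0e ?fw//.
  exact: integrable_fin_num.
have /(ae_eq_integral_abs mu mP mfw) ae0 := z.
apply: negligibleS ae0 => t Pt /=.
by move=> /(_ Pt)[/eqP]; rewrite subr_eq0 => /eqP fwt; move: Pt; rewrite /P /= fwt ltxx.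
Qed.

Variables (w : T -> R) (W : (T -> R) -> R).
Hypothesis w0 : forall t, 0 <= w t.
Hypothesis iw : mu.-integrable [set: T] (EFin \o w).
Hypothesis WL : linear_on (@bmeas _ T R) W.
Hypothesis Ww : forall g, bmeas g -> (`|W g|%:E <= \int[mu]_t (`|g t| * w t)%:E)%E.

(** The charge of [W]. Domination by [w] makes it both countably additive and absolutely
    continuous. *)
Let nu (A : set T) : \bar R := (W (\1_A))%:E.

Let nu_le A : measurable A -> (`|nu A| <= \int[mu]_(t in A) (w t)%:E)%E.
Proof.
move=> mA; have h : (`|nu A| <= _)%E := Ww (bmeas_indic R mA); apply: (le_trans h).
rewrite [leRHS]integral_mkcond le_eqVlt; apply/orP; left; apply/eqP.
apply: eq_integral => t _; rewrite patchE indicE.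
by case: (_ \in _); rewrite ?normr1 ?normr0 ?mul1r ?mul0r.
Qed.

Let nu0 : nu set0 = 0.
Proof. by rewrite /nu indic0 (linear_on0 (@bmeas_lin _ T R) (bmeas0 T R) WL). Qed.

Let nu_fin A : measurable A -> nu A \is a fin_num.
Proof. by []. Qed.

Let nu_sigma_additive : semi_sigma_additive nu.
Proof.
move=> F mF tF mUF.
(* The indicator of the union of the sets of index at least n. It tends to 0 pointwise, so [W (g n)]
   tends to 0 by dominated convergence with majorant [w]. *)
pose g n t : R := \1_(\bigcup_k F k) t - \sum_(i <- iota 0 n) \1_(F i) t.
have gE n t : g n t = (if `[< exists2 k, (n <= k)%N & F k t >] then 1 else 0).
  rewrite /g; case: asboolP => [[k nk Fkt]|H].
    rewrite indicE mem_set; last by exists k.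
    rewrite big1_seq ?subr0// => i /andP[_]; rewrite mem_iota add0n => /andP[_ ik].
    rewrite indicE memNset// => Fit.
    have := tF i k I I; have : (F i `&` F k) !=set0 by exists t.
    by move=> h /(_ h) ik'; move: ik; rewrite ik' ltnNge nk.
  have [[k _ Fkt]|nU] := pselect ((\bigcup_k F k) t); last first.
    rewrite indicE memNset// big1_seq ?subr0// => i _; rewrite indicE memNset// => Fit.
    by apply: nU; exists i.
  rewrite indicE mem_set; last by exists k.
  have kn : (k < n)%N.
    by rewrite ltnNge; apply/negP => nk; apply: H; exists k.
  rewrite (bigD1_seq k) ?iota_uniq ?mem_iota//= indicE mem_set// big1_seq ?addr0 ?subrr//.
  move=> i /andP[ik _]; rewrite indicE memNset// => Fit.
  have := tF i k I I; have : (F i `&` F k) !=set0 by exists t.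
  by move=> h /(_ h) ik'; move: ik; rewrite ik' eqxx.
have bF i : bmeas (\1_(F i) : T -> R) by exact: bmeas_indic.
have SL n := linear_on_sum (iota 0 n) (@bmeas_lin _ T R) WL (bmeas0 T R) bF.
have bU : bmeas (\1_(\bigcup_k F k) : T -> R) by exact: bmeas_indic.
have bg n : bmeas (g n).
  have := @bmeas_lin _ T R (-1) _ _ (SL n).1 bU.
  have -> : (fun t => -1 * (\sum_(i <- iota 0 n) \1_(F i) t) + \1_(\bigcup_k F k) t) = g n.
    by apply/funext => t; rewrite mulN1r addrC.
  by [].
have Wg n : \sum_(0 <= i < n) nu (F i) = (W (\1_(\bigcup_k F k)) - W (g n))%:E.
  have -> : W (g n) = W (\1_(\bigcup_k F k)) - \sum_(i <- iota 0 n) W (\1_(F i)).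
    by rewrite -(SL n).2 -(linear_onB (@bmeas_lin _ T R) WL bU (SL n).1).
  by rewrite subKr /nu sumEFin /index_iota subn0.
have mg n : measurable_fun [set: T] (g n) by case: (bg n).
have mw : measurable_fun [set: T] w by apply/measurable_EFinP; exact: measurable_int iw.
have [] := @dominated_convergence _ T R mu setT measurableT
  (fun n t => (`|g n t| * w t)%:E) (cst 0%E) (fun t => (w t)%:E).
- by move=> n; apply/measurable_EFinP/measurable_funM => //; exact: measurableT_comp.
- by [].
- apply: aeW => t _; have [[k _ Fkt]|nU] := pselect ((\bigcup_k F k) t).
    apply: cvg_near_cst; near=> n; rewrite gE; case: asboolP => [[j nj Fjt]|_].
      have kj : k = j by apply: (tF k j I I); exists t.
      have : (k < n)%N by near: n; exists k.+1.
      by rewrite kj ltnNge nj.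
    by rewrite normr0 mul0r.
  apply: cvg_near_cst; near=> n; rewrite gE; case: asboolP => [[j nj Fjt]|_].
    by exfalso; apply: nU; exists j.
  by rewrite normr0 mul0r.
- exact: iw.
- apply: aeW => t n _; rewrite /= lee_fin ger0_norm ?mulr_ge0//.
  by rewrite ler_piMl// gE; case: ifP; rewrite ?normr1 ?normr0.
move=> _ _; rewrite integral_cst// mul0e => cv.
have cv0 : (W (g n))%:E @[n --> \oo] --> 0%E.
  apply: (@squeeze_cvge _ _ _ _ (fun n => - \int[mu]_t (`|g n t| * w t)%:E)%E _
    (fun n => \int[mu]_t (`|g n t| * w t)%:E)%E).
  - apply: nearW => n; have := Ww (bg n); move=> h; apply/andP; split.
      by rewrite leeNl; apply: le_trans h; rewrite -EFinN lee_fin -normrN ler_norm.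
    by apply: le_trans h; rewrite lee_fin ler_norm.
  - by rewrite -oppe0; apply: cvgeN.
  - exact: cv.
rewrite (_ : (fun n => _) = (fun n => (W (\1_(\bigcup_k F k)))%:E - (W (g n))%:E)%E); last first.
  by apply/funext => n; rewrite Wg EFinB.
rewrite -[X in _ --> X]sube0; apply: cvgeB => //; exact: cvg_cst.
Unshelve. all: by end_near. Qed.

HB.instance Definition _ := isCharge.Build _ T R nu nu0 nu_fin nu_sigma_additive.

(** Take the Radon-Nikodym derivative of the charge. The representation holds on indicators and
    passes to bounded functions by uniform density, both sides being continuous for the uniform
    norm. *)
Theorem dominated_functional_density : exists h : T -> R,
  [/\ measurable_fun [set: T] h, forall t, `|h t| <= w t &
  forall g, bmeas g -> W g = \int[mu]_t (g t * h t)].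
Proof.
have nu_mu : nu `<< mu.
  move=> N muN A mA AN; have muA : mu A = 0 by exact: muN.
  apply/eqP; rewrite -abse_eq0 eq_le abse_ge0 andbT; apply: le_trans (nu_le mA) _.
  rewrite null_set_integral//; apply: measurable_funTS; exact: measurable_int iw.
pose h0 := Radon_Nikodym nu mu.
have h0fin t : h0 t \is a fin_num by exact: Radon_Nikodym_fin_num.
have ih0 : mu.-integrable [set: T] h0 by exact: Radon_Nikodym_integrable.
pose h1 t := fine (h0 t).
have h1E : EFin \o h1 = h0 by apply/funext => t /=; rewrite fineK.
have ih1 : mu.-integrable [set: T] (EFin \o h1) by rewrite h1E.
have nuE A : measurable A -> nu A = (\int[mu]_(t in A) (h1 t)%:E)%E.
  move=> mA; rewrite (Radon_Nikodym_integral nu_mu mA).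
  by apply: eq_integral => t _; rewrite -[RHS]/((EFin \o h1) t) h1E.
have mw : measurable_fun [set: T] w by apply/measurable_EFinP; exact: measurable_int iw.
have mh1 : measurable_fun [set: T] h1 by apply/measurable_EFinP; exact: measurable_int ih1.
have n1 : mu.-negligible [set t | w t < h1 t].
  apply: null_set_lt => // A mA; rewrite -nuE//; apply: le_trans (nu_le mA).
  by rewrite lee_fin ler_norm.
have n2 : mu.-negligible [set t | w t < - h1 t].
  apply: (@null_set_lt (fun t => - h1 t)) => //.
    exact: (integrableN ih1).
  move=> A mA; have -> : (\int[mu]_(t in A) (- h1 t)%:E = - nu A)%E.
    rewrite nuE// -mulN1e -integralZl//; last exact: integrableS ih1.
    by apply: eq_integral => t _; rewrite EFinN mulN1e.
  by apply: le_trans (nu_le mA); rewrite -EFinN lee_fin -normrN ler_norm.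
(* The derivative is bounded by [w] only almost everywhere; replacing it by 0 on the exceptional
   null set gives the bound at every point. *)
pose h t := if `|h1 t| <= w t then h1 t else 0.
have mh : measurable_fun [set: T] h.
  apply: measurable_fun_ifT => //; apply: measurable_fun_ler => //.
  exact: measurableT_comp.
have hw t : `|h t| <= w t by rewrite /h; case: ifP; rewrite // normr0.
have ih : mu.-integrable [set: T] (EFin \o h).
  apply: (@le_integrable _ _ _ mu _ measurableT _ (EFin \o w)) => //.
    exact/measurable_EFinP.
  by move=> t _ /=; rewrite lee_fin [X in _ <= X]ger0_norm.
have hh1 : ae_eq mu setT (EFin \o h) (EFin \o h1).
  apply: negligibleS (negligibleU n1 n2) => t /= H.
  have [h1w|] := boolP (`|h1 t| <= w t).
    by exfalso; apply: H => _; rewrite /h h1w.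
  rewrite -ltNge lter_normr => /orP[]; [by left|by right].
have iwn B g : bmeas g -> (forall t, `|g t| <= B) ->
    (\int[mu]_t (`|g t| * w t)%:E <= (B * \int[mu]_t w t)%:E)%E.
  move=> bg gB; rewrite EFinM /Rintegral fineK; last exact: integrable_fin_num.
  have mg : measurable_fun [set: T] g by case: bg.
  rewrite -integralZl//; apply: ge0_le_integral => //.
  - by move=> t _; rewrite lee_fin mulr_ge0.
  - by apply/measurable_EFinP/measurable_funM => //; exact: measurableT_comp.
  - by apply: emeasurable_funM => //; apply/measurable_EFinP.
  - by move=> t _; rewrite -EFinM lee_fin ler_wpM2r.
exists h; split=> //; apply: bmeas_ext => //.
- move=> a f g bf bg; rewrite -RintegralZl//; last first.
    exact: (integrable_bmeasM bf ih).
  rewrite -RintegralD//; last 2 first.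
  - exact: (@integrableZl _ _ _ mu _ measurableT a _ (integrable_bmeasM bf ih)).
  - exact: (integrable_bmeasM bg ih).
  by apply: eq_Rintegral => t _; ring.
- move=> A mA; apply: EFin_inj; rewrite -[LHS]/(nu A) nuE//.
  have mA' : measurable_fun [set: T] (\1_A : T -> R) by exact: measurable_indic.
  rewrite /Rintegral fineK; last first.
    exact: integrable_fin_num (integrable_bmeasM (bmeas_indic R mA) ih).
  rewrite [LHS]integral_mkcond; transitivity (\int[mu]_t (\1_A t * h1 t)%:E)%E.
    apply: eq_integral => t _; rewrite patchE indicE.
    by case: (_ \in _); rewrite ?mul1r ?mul0r.
  apply: ae_eq_integral => //.
  - by apply/measurable_EFinP/measurable_funM.
  - by apply/measurable_EFinP/measurable_funM.
  - by apply: filterS hh1 => t /= H _; move: (H I) => [->].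
- exists (\int[mu]_t w t) => g e bg ge; rewrite mulrC -lee_fin.
  exact: le_trans (Ww bg) (iwn _ _ bg ge).
- exists (\int[mu]_t w t) => g e bg ge; rewrite mulrC -lee_fin.
  apply: le_trans (iwn _ _ bg ge).
  have igh := integrable_bmeasM bg ih; have mg : measurable_fun [set: T] g by case: bg.
  rewrite /Rintegral -abse_EFin fineK; last exact: integrable_fin_num igh.
  apply: le_trans (le_abse_integral _ measurableT _) _.
    by apply/measurable_EFinP/measurable_funM.
  apply: ge0_le_integral => //.
  - by apply: measurableT_comp => //; apply/measurable_EFinP/measurable_funM.
  - by apply/measurable_EFinP/measurable_funM => //; exact: measurableT_comp.
  - by move=> t _; rewrite /= lee_fin normrM ler_wpM2l.
Qed.

End dominated_functional.

(** * Functionals on families of weighted integrable functions *)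

Section weighted_families.
Context d (T : measurableType d) (R : realType).
Variable mu : {sigma_finite_measure set T -> \bar R}.
Variable w : T -> R.
Hypothesis w0 : forall t, 0 <= w t.
Hypothesis iw : mu.-integrable [set: T] (EFin \o w).

Definition wnorm1 (g : T -> R) : R := \int[mu]_t (`|g t| * w t).

Let iabs g : bmeas g -> mu.-integrable [set: T] (EFin \o ((fun t => `|g t|) \* w)).
Proof.
move=> [mg [B gB]]; apply: integrable_bmeasM => //; split.
  exact: measurableT_comp.
by exists B => t; rewrite normr_id.
Qed.

Lemma wnorm1E g : bmeas g -> (wnorm1 g)%:E = (\int[mu]_t (`|g t| * w t)%:E)%E.
Proof. by move=> bg; rewrite fineK//; exact: integrable_fin_num (iabs bg). Qed.

Lemma wnorm1_ge0 g : 0 <= wnorm1 g.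
Proof. by apply: Rintegral_ge0 => t _; rewrite mulr_ge0. Qed.

Lemma wnorm10 : wnorm1 (fun=> 0) = 0.
Proof.
rewrite /wnorm1 /Rintegral integral0_eq// => t _.
by rewrite normr0 mul0r.
Qed.

Lemma wnorm1Z a g : bmeas g -> wnorm1 (fun t => a * g t) = `|a| * wnorm1 g.
Proof.
move=> bg; rewrite /wnorm1 -RintegralZl//; last exact: iabs.
by apply: eq_Rintegral => t _; rewrite normrM mulrA.
Qed.

Lemma wnorm1D g h : bmeas g -> bmeas h ->
  wnorm1 (fun t => g t + h t) <= wnorm1 g + wnorm1 h.
Proof.
move=> bg bh; rewrite /wnorm1 -RintegralD//; [|exact: iabs|exact: iabs].
apply: le_Rintegral => //.
- apply: (iabs (g := fun t => g t + h t)).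
  exact: (lin_closedD (@bmeas_lin _ T R)).
- by apply: (integrableD measurableT (iabs bg) (iabs bh)).
by move=> t _; rewrite -mulrDl ler_wpM2r// ler_normD.
Qed.

Lemma wnorm1_le g (B : R) : bmeas g -> (forall t, `|g t| <= B) ->
  wnorm1 g <= B * \int[mu]_t w t.
Proof.
move=> bg gB; rewrite /wnorm1 -RintegralZl//; apply: le_Rintegral => //.
- exact: iabs.
- exact: (@integrableZl _ _ _ mu _ measurableT B _ iw).
by move=> t _; rewrite ler_wpM2r.
Qed.

Variables (J : eqType) (j0 : J) (c : J -> R).
Hypothesis c0 : forall j, 0 <= c j.
Implicit Types F : J * T -> R.

(** A family is one function on [J * T], the form that [hahn_banach] takes. Its norm is the supremum
    over [j] of the weighted norms. *)
Definition families : set (J * T -> R) := [set F |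
  (forall j, bmeas (fun t => F (j, t))) /\
  exists B, forall j, c j * wnorm1 (fun t => F (j, t)) <= B].

Let q F : R := sup (range (fun j => c j * wnorm1 (fun t => F (j, t)))).

Let qub F j : families F -> c j * wnorm1 (fun t => F (j, t)) <= q F.
Proof.
move=> [_ [B FB]]; apply: ub_le_sup; last by exists j.
by exists B => _ [i _ <-].
Qed.

Let qle F B : (forall j, c j * wnorm1 (fun t => F (j, t)) <= B) -> q F <= B.
Proof.
by move=> FB; apply: ge_sup; [exists (c j0 * wnorm1 (fun t => F (j0, t))), j0
  |move=> _ [i _ <-]].
Qed.

Lemma families_lin : lin_closed families.
Proof.
move=> a F G [bF [B FB]] [bG [B' GB]]; split.
  by move=> j; exact: (@bmeas_lin _ T R).
exists (`|a| * B + B') => j.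
apply: le_trans (_ : _ <= c j * (`|a| * wnorm1 (fun t => F (j, t)) +
    wnorm1 (fun t => G (j, t)))) _.
  rewrite ler_wpM2l// -wnorm1Z//; apply: wnorm1D => //.
  exact: (lin_closedZ a (@bmeas_lin _ T R)).
by rewrite mulrDr mulrCA lerD// ler_wpM2l.
Qed.

Definition single (j : J) (g : T -> R) : J * T -> R :=
  fun x => if x.1 == j then g x.2 else 0.

Lemma families_single j g : bmeas g -> families (single j g).
Proof.
move=> bg; split=> [i|].
  by rewrite /single /=; case: eqP => // _; exact: bmeas0.
exists (c j * wnorm1 g) => i; rewrite /single /=.
by case: eqP => [->//|_]; rewrite wnorm10 mulr0 mulr_ge0 ?wnorm1_ge0.
Qed.

(* Hahn-Banach extends [u] to all families; the extension is evaluated on families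
   with one nonzero member, and what is left over is controlled by the tail. *)
Theorem functional_on_families (D : set (J * T -> R)) (u : (J * T -> R) -> R) (K : R) :
  0 <= K -> D `<=` families -> D !=set0 -> lin_closed D -> linear_on D u ->
  (forall F Q, D F -> (forall j, c j * wnorm1 (fun t => F (j, t)) <= Q) -> u F <= K * Q) ->
  exists h : J -> T -> R,
  [/\ forall j, measurable_fun [set: T] (h j),
      forall j t, `|h j t| <= K * c j * w t &
      forall F (s : seq J) (Q : R), D F -> uniq s ->
        0 <= Q -> (forall j, j \notin s -> c j * wnorm1 (fun t => F (j, t)) <= Q) ->
        `|u F - \sum_(j <- s) \int[mu]_t (F (j, t) * h j t)| <= K * Q].
Proof.
move=> K0 DE D0 DL uL uK.
have Eq : seminorm_on families (fun F => K * q F).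
  split=> [F G EF EG|a F EF].
    rewrite -mulrDr ler_wpM2l//; apply: qle => j.
    apply: le_trans (_ : _ <= c j * (wnorm1 (fun t => F (j, t)) +
      wnorm1 (fun t => G (j, t)))) _.
      by rewrite ler_wpM2l// wnorm1D//; [case: EF|case: EG].
    by rewrite mulrDr lerD// qub.
  rewrite mulrCA ler_wpM2l//; apply: qle => j.
  have [bF _] := EF; rewrite (wnorm1Z a (bF j)) mulrCA.
  by apply: ler_wpM2l => //; exact: qub.
have [|U [UL Uu Uq]] := hahn_banach families_lin Eq DE D0 DL uL.
  by move=> F DF; apply: uK => // j; apply: qub; exact: DE.
have WL j : linear_on (@bmeas _ T R) (fun g => U (single j g)).
  move=> a f g bf bg; rewrite -UL; [|exact: families_single|exact: families_single].
  by congr U; apply/funext => x; rewrite /single; case: eqP; rewrite ?mulr0 ?addr0.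
have iKw j : mu.-integrable [set: T] (EFin \o (fun t => K * c j * w t)).
  exact: (@integrableZl _ _ _ mu _ measurableT (K * c j) _ iw).
have Kw0 j t : 0 <= K * c j * w t by rewrite !mulr_ge0.
(* A family whose only nonzero member is [g], at [j], has norm [c j * wnorm1 g]. This is where the
   factor [c j] in the bound on the density comes from. *)
have Ww j g : bmeas g ->
    (`|U (single j g)|%:E <= \int[mu]_t (`|g t| * (K * c j * w t))%:E)%E.
  move=> bg; apply: le_trans (_ : _ <= (K * c j * wnorm1 g)%:E)%E _.
    rewrite lee_fin; apply: le_trans (Uq _ (families_single j bg)) _.
    rewrite -mulrA ler_wpM2l//; apply: qle => i; rewrite /single /=.
    by case: eqP => [->//|_]; rewrite wnorm10 mulr0 mulr_ge0 ?wnorm1_ge0.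
  rewrite EFinM wnorm1E// -integralZl//; last exact: iabs.
  rewrite le_eqVlt; apply/orP; left; apply/eqP; apply: eq_integral => t _.
  by rewrite -EFinM; congr EFin; ring.
have dens j := dominated_functional_density (Kw0 j) (iKw j) (WL j) (Ww j).
have [h hP] := choice dens.
exists h; split=> [j|j t|F s Q DF us Q0 sQ]; [by case: (hP j)|by case: (hP j)|].
have EF := DE _ DF; have bF j : bmeas (fun t => F (j, t)) by case: EF.
pose G j := single j (fun t => F (j, t)).
have EG j : families (G j) by exact: families_single.
have [Es Us] := linear_on_sum s families_lin UL
  (lin_closed0 families_lin EF) EG.
have -> : \sum_(j <- s) \int[mu]_t (F (j, t) * h j t) =
    U (fun x => \sum_(j <- s) G j x).
  by rewrite Us; apply: eq_bigr => j _; case: (hP j) => _ _ <-.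
rewrite -Uu// -(linear_onB families_lin UL EF Es).
have Er := families_lin (-1) Es EF.
have -> : (fun x => F x - \sum_(j <- s) G j x) =
    (fun x => -1 * (\sum_(j <- s) G j x) + F x).
  by apply/funext => x; ring.
apply: le_trans (Uq _ Er) _; rewrite ler_wpM2l//; apply: qle => i.
have [si|si] := boolP (i \in s).
  rewrite (_ : (fun t => _) = (fun=> 0)) ?wnorm10 ?mulr0//.
  apply/funext => t; rewrite (bigD1_seq i)//= big1 ?addr0.
    by rewrite /G /single /= eqxx; ring.
  by move=> j ji; rewrite /G /single /= eq_sym (negbTE ji).
rewrite (_ : (fun t => _) = (fun t => F (i, t))) ?sQ//.
apply/funext => t; rewrite big1_seq ?mulr0 ?add0r// => j /andP[_ js].
by rewrite /G /single /=; case: eqP => // ij; move: si; rewrite ij js.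
Qed.

End weighted_families.

(** * Jets of test functions and the representation of [T] *)

Section representation.
Context {R : realType} {N : nat} (omega : R -> R).
Hypothesis homega : nonquasianalytic_weight omega.
Local Notation C := R[i].
Local Notation Rn := 'rV[R]_N.
Local Notation mI := (multi_index N).
Local Notation ls := (leb_space R N).
Local Notation cw := (cw omega).
Local Notation leb := (@lebesgueN R N).
Local Notation we n := (@wexp R omega N n).

Definition unvec (x : Rn) : ls := [tuple x 0 i | i < N].

Lemma vecK (t : ls) : unvec (vec t) = t.
Proof. by apply: eq_from_tnth => i; rewrite tnth_mktuple mxE. Qed.

Lemma unvecK (x : Rn) : vec (unvec x) = x.
Proof. by apply/rowP => i; rewrite mxE tnth_mktuple. Qed.

Lemma bounded_of_supp (B : R) (F : Rn -> R) : continuous F ->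
  (forall x, B < `|x| -> F x = 0) -> exists K, forall x, `|F x| <= K.
Proof.
move=> cF FB; pose Q := [set x : Rn | `|x| <= B].
have cQ : compact Q.
  apply: bounded_closed_compact; last exact: closed_norm_le.
  by exists B; split; [exact: num_real|move=> r Br x /= /le_trans -> //; exact: ltW].
have [M [_ MQ]] : bounded_set (F @` Q).
  apply: compact_bounded; apply: continuous_compact => //.
  exact: continuous_subspaceT.
exists (Num.max 0 (M + 1)) => x; rewrite le_max; have [xB|xB] := leP `|x| B.
  by apply/orP; right; apply: (MQ (M + 1)); [rewrite ltrDl|exists x].
by rewrite FB// normr0 lexx.
Qed.

Definition jet (phi : Rn -> C) : (mI * bool) * ls -> R := fun x =>
  let z := partials x.1.1 phi (vec x.2) in
  if x.1.2 then complex.Re z else complex.Im z.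

(** Reads the function back from the two members of order 0, so a functional of [phi] is a
    functional of its jet. *)
Definition of_jet (F : (mI * bool) * ls -> R) : Rn -> C := fun x =>
  Complex (F (([ffun=> 0%N], true), unvec x)) (F (([ffun=> 0%N], false), unvec x)).

Lemma jetK phi : of_jet (jet phi) = phi.
Proof.
apply/funext => x; rewrite /of_jet /jet /= unvecK.
have -> : partials [ffun=> 0%N] phi = phi.
  rewrite partialsE; have /size0nil -> // : size (mseq ([ffun=> 0%N] : mI)) = 0%N.
  by rewrite size_mseq /mlen big1// => i _; rewrite ffunE.
by case: (phi x).
Qed.

Lemma jet_lin (a : R) phi psi : smooth phi -> smooth psi ->
  (fun x => a * jet phi x + jet psi x) = jet (fun x => a%:C%C * phi x + 1 * psi x).
Proof.
move=> sphi spsi; apply/funext => -[[b l] t]; rewrite /jet /= !partialsE dseq_lin//.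
rewrite mul1r; case: l; first by rewrite cReD cReM /= mul0r subr0.
by rewrite cImD cImM /= mul0r addr0.
Qed.

Lemma bmeas_jet j phi : elements (D_omega omega) phi -> bmeas (fun t => jet phi (j, t)).
Proof.
case: j => a l /(elements_D_omega homega)[sphi [B phiB] _].
have [c1 c2 _] := smooth_diff1 (smooth_dseq (mseq a) sphi).
have vB x : B < `|x| -> partials a phi x = 0.
  by rewrite partialsE; exact: supp_le_dseq.
rewrite /jet /= partialsE; case: l.
- have [K HK] := bounded_of_supp c1 (B := B) (fun x xB => ltac:(by rewrite /re_part -partialsE vB)).
  split; last by exists K => t; exact: HK.
  apply: measurable_fun_leb_space; exact: (measurable_vec_continuous c1).
- have [K HK] := bounded_of_supp c2 (B := B) (fun x xB => ltac:(by rewrite /im_part -partialsE vB)).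
  split; last by exists K => t; exact: HK.
  apply: measurable_fun_leb_space; exact: (measurable_vec_continuous c2).
Qed.

Lemma normr_jet_le j phi t : `|jet phi (j, t)| <= cabs (partials j.1 phi (vec t)).
Proof.
by case: j => a [] /=; rewrite /jet /=; [exact: Re_le_cabs|exact: Im_le_cabs].
Qed.

Lemma finite_mlen_le k : exists F : {fset mI}, forall a, (mlen a <= k)%N -> a \in F.
Proof.
pose g (b : {ffun 'I_N -> 'I_k.+1}) : mI := [ffun i => nat_of_ord (b i)].
exists (seq_fset tt [seq g b | b <- enum {: {ffun 'I_N -> 'I_k.+1}}]) => a ak.
have aik i : (a i < k.+1)%N.
  by rewrite ltnS (leq_trans _ ak)// /mlen (bigD1 i)//= leq_addr.
rewrite seq_fsetE; apply/mapP; exists [ffun i => Ordinal (aik i)]; first by rewrite mem_enum.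
by apply/ffunP => i; rewrite !ffunE.
Qed.

Lemma wexp_mono n k t : we (n + k)%N t <= we n t.
Proof.
rewrite /wexp ler_expR lerN2 ler_wpM2r ?(omegaN_ge0 homega)//.
by rewrite ler_nat leq_addr.
Qed.

Lemma integrable_wexp n : (\int[leb]_(t in [set: ls]) (we n t)%:E < +oo)%E ->
  leb.-integrable [set: ls] (EFin \o we n).
Proof.
move=> foo; apply/integrableP; split.
  by apply/measurable_EFinP; exact: measurable_wexp.
under eq_integral => t _ do rewrite /= ger0_norm ?wexp_ge0//.
exact: foo.
Qed.

(** [cw_geom] gains a factor 2^-|a|, paid for by the bound on [phi] at a larger index. This decay
    makes the remainder of the series vanish. *)
Lemma jet_tail m n phi : (0 < m)%N -> leb.-integrable [set: ls] (EFin \o we n) ->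
  elements (D_omega omega) phi -> exists2 Q, 0 <= Q & forall j k, (k <= mlen j.1)%N ->
    cw m (mlen j.1) * wnorm1 leb (we n) (fun t => jet phi (j, t)) <= Q / 2 ^+ k.
Proof.
move=> m0 iw Dphi; have [M [A [mM A0 HA]]] := cw_geom homega m0.
have [_ _ /(_ _ (leq_trans m0 mM))[K phiK]] := (elements_D_omega homega _).1 Dphi.
have K0 : 0 <= K.
  by apply: le_trans (phiK [::] 0); rewrite mulr_ge0 ?cabs_ge0 ?cw_ge0.
have iw0 : 0 <= \int[leb]_t we n t.
  by apply: Rintegral_ge0 => t _; exact: wexp_ge0.
exists (A * K * \int[leb]_t we n t) => [|j k kj]; first by rewrite !mulr_ge0// ltW.
have bj := bmeas_jet j Dphi; have c0 := cw_ge0 omega m (mlen j.1).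
have bc : bmeas (fun t => cw m (mlen j.1) * jet phi (j, t)).
  exact: (lin_closedZ _ (@bmeas_lin _ _ R)).
rewrite mulrAC -[X in X * wnorm1 _ _ _](ger0_norm c0) -(wnorm1Z iw)//.
apply: (wnorm1_le (@wexp_ge0 R omega N n) iw bc) => t.
rewrite normrM (ger0_norm c0) ler_pdivlMr ?exprn_gt0//.
apply: le_trans (_ : _ <= 2 ^+ mlen j.1 * cw m (mlen j.1) * cabs (partials j.1 phi (vec t))) _.
  rewrite [leLHS](_ : _ = 2 ^+ k * cw m (mlen j.1) * `|jet phi (j, t)|); last by ring.
  apply: ler_pM => //; rewrite ?mulr_ge0// ?exprn_ge0//.
    by rewrite ler_wpM2r// ler_weXn2l// ler1n.
  exact: normr_jet_le.
apply: le_trans (_ : _ <= A * cw M (mlen j.1) * cabs (partials j.1 phi (vec t))) _.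
  by rewrite ler_wpM2r ?cabs_ge0.
rewrite -mulrA ler_pM2l// mulrC partialsE -size_mseq; exact: phiK.
Qed.

Lemma jet_families m n phi : (0 < m)%N -> leb.-integrable [set: ls] (EFin \o we n) ->
  elements (D_omega omega) phi ->
  families leb (we n) (fun j : mI * bool => cw m (mlen j.1)) (jet phi).
Proof.
move=> m0 iw Dphi; have [Q Q0 HQ] := jet_tail m0 iw Dphi.
split=> [j|]; first exact: bmeas_jet.
by exists Q => j; have := HQ j 0%N (leq0n _); rewrite expr0 divr1.
Qed.

Lemma D_omega0 : elements (D_omega omega) (fun _ : Rn => 0 : C).
Proof.
have d0 s : dseq s (fun _ : Rn => 0 : C) = (fun=> 0) :> (Rn -> C).
  by case: s => [//|i s]; exact: dseq_cst.
apply/(elements_D_omega homega); split; first exact: smooth_cst.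
  by exists 0.
by move=> m _; exists 0 => s x; rewrite d0 cabs0 mul0r.
Qed.

(* Only the real part of [T] is extended by Hahn-Banach; the imaginary part is
   recovered from [T (i phi) = i (T phi)]. *)
Theorem O_bounded_representation (T : (Rn -> C) -> C) m : (0 < m)%N ->
  in_dual (D_omega omega) T ->
  O_bounded omega T m -> exists2 M, (0 < M)%N & forall n, exists f (A : R),
  [/\ 0 <= A, forall a, cmeasurable (f a),
      forall a x, cabs (f a x) <= A * cw M (mlen a) * expR (- (n%:R * omegaN omega x)) &
      is_sum_of_derivatives omega T f].
Proof.
move=> m0 [TL _] Tb; have [M M0 HM] := @sobolev_O_bound R N _ homega m m0.
have [n0 _ n0oo] := wexp_integrable homega N.
(* Of the exponent n + n0, the part n0 ensures integrability; the part n is kept for the bound on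
   the densities. *)
exists M => // n; pose l := (n + n0)%N.
have iw : leb.-integrable [set: ls] (EFin \o we l).
  apply: (le_integrable measurableT _ _ (integrable_wexp n0oo)).
    by apply/measurable_EFinP; exact: measurable_wexp.
  by move=> t _; rewrite /= lee_fin !ger0_norm ?wexp_ge0// /l addnC wexp_mono.
have [n' [D [n'0 D0 HD]]] := HM l; have [A A0 HA] := Tb _ n'0.
pose c (j : mI * bool) := cw M (mlen j.1).
have c0 j : 0 <= c j by exact: cw_ge0.
have Dsm (phi : Rn -> C) : elements (D_omega omega) phi -> smooth phi.
  by case/(elements_D_omega homega).
pose DD := [set F | exists2 phi, elements (D_omega omega) phi & F = jet phi].
pose u F := complex.Re (T (of_jet F)).
(* The 2 accounts for the two members, real and imaginary, attached to each multi-index. *)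
pose K := A * D * 2.
have K0 : 0 <= K by rewrite !mulr_ge0.
have DDL : lin_closed DD.
  move=> a _ _ [phi Dphi ->] [psi Dpsi ->].
  rewrite (jet_lin a (Dsm _ Dphi) (Dsm _ Dpsi)).
  by exists (fun x => a%:C%C * phi x + 1 * psi x); first exact: D_omegaL.
have uL : linear_on DD u.
  move=> a _ _ [phi Dphi ->] [psi Dpsi ->].
  rewrite (jet_lin a (Dsm _ Dphi) (Dsm _ Dpsi)) /u !jetK TL//.
  by rewrite mul1r cReD cReM /= mul0r subr0.
have uK F Q : DD F -> (forall j, c j * wnorm1 leb (we l) (fun t => F (j, t)) <= Q) ->
    u F <= K * Q.
  move=> [phi Dphi ->] HQ; have sphi := Dsm _ Dphi.
  have Q0 : 0 <= Q.
    apply: le_trans (HQ ([ffun=> 0%N], true)).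
    by rewrite mulr_ge0 ?c0 ?wnorm1_ge0// => t; exact: wexp_ge0.
  rewrite /u jetK; apply: le_trans (ler_norm _) _; apply: le_trans (Re_le_cabs _) _.
  rewrite /K -!mulrA; apply: HA => //; apply: HD => //; first by rewrite mulr_ge0.
  move=> s; have [a [-> <-]] := dseqE s sphi.
  have b1 := bmeas_jet (a, true) Dphi; have b2 := bmeas_jet (a, false) Dphi.
  have -> : (\int[leb]_(t in [set: ls]) (cabs1 (partials a phi (vec t)) * we l t)%:E =
    (wnorm1 leb (we l) (fun t => jet phi ((a, true), t)) +
     wnorm1 leb (we l) (fun t => jet phi ((a, false), t)))%:E)%E.
    have mw := @measurable_wexp R omega homega N l.
    rewrite EFinD (wnorm1E iw b1) (wnorm1E iw b2).
    rewrite -(@ge0_integralD _ _ _ leb _ measurableT).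
    - by apply: eq_integral => t _; rewrite -EFinD -mulrDl.
    - by move=> t _; rewrite lee_fin mulr_ge0 ?wexp_ge0.
    - apply/measurable_EFinP/measurable_funM; last exact: mw.
      by apply: measurableT_comp; [exact: normr_measurable|case: b1].
    - by move=> t _; rewrite lee_fin mulr_ge0 ?wexp_ge0.
    - apply/measurable_EFinP/measurable_funM; last exact: mw.
      by apply: measurableT_comp; [exact: normr_measurable|case: b2].
  rewrite -EFinM lee_fin mulrDr.
  by have := lerD (HQ (a, true)) (HQ (a, false)); rewrite /c /= mulr_natl mulr2n.
have [| |h [mh hK hS]] := functional_on_families (@wexp_ge0 R omega N l) iw
  ([ffun=> 0%N], true) c0 K0 _ _ DDL uL uK.
- by move=> _ [phi Dphi ->]; exact: jet_families.
- by exists (jet (fun=> 0)), (fun=> 0) => //; exact: D_omega0.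
have ih j : leb.-integrable [set: ls] (EFin \o h j).
  apply: (le_integrable measurableT _ _
    (@integrableZl _ _ _ leb _ measurableT (K * c j) _ iw)).
    exact/measurable_EFinP.
  move=> t _; rewrite /= lee_fin [leRHS]ger0_norm ?mulr_ge0 ?wexp_ge0//; exact: hK.
pose sg (a : mI) : R := (-1) ^+ mlen a.
have sg1 a : `|sg a| = 1 by rewrite normrX normrN1 expr1n.
have sgsg a : sg a * sg a = 1 by rewrite -expr2 sqrr_sign.
(* The minus sign gives Re (f_a z) = sg (h_true Re z + h_false Im z), the pairing used on jets, and
   [sg] cancels the sign (-1)^|a| of the transposed derivative. *)
pose f a x : C := Complex (sg a * h (a, true) (unvec x)) (- (sg a * h (a, false) (unvec x))).
pose S phi a := \sum_(b <- [:: true; false]) \int[leb]_t (jet phi ((a, b), t) * h (a, b) t).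
have iS phi a : elements (D_omega omega) phi -> leb.-integrable [set: ls] (EFin \o (fun t =>
    jet phi ((a, true), t) * h (a, true) t + jet phi ((a, false), t) * h (a, false) t)).
  move=> Dphi; apply: (@integrableD _ _ _ leb _ measurableT
    (fun t => (jet phi ((a, true), t) * h (a, true) t)%:E)
    (fun t => (jet phi ((a, false), t) * h (a, false) t)%:E)).
  - exact: (integrable_bmeasM (bmeas_jet _ Dphi) (ih _)).
  - exact: (integrable_bmeasM (bmeas_jet _ Dphi) (ih _)).
have SE phi a : elements (D_omega omega) phi ->
    S phi a = \int[leb]_t (jet phi ((a, true), t) * h (a, true) t +
                           jet phi ((a, false), t) * h (a, false) t).
  move=> Dphi; rewrite /S big_cons big_seq1 -RintegralD//.
  - exact: (integrable_bmeasM (bmeas_jet _ Dphi) (ih _)).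
  - exact: (integrable_bmeasM (bmeas_jet _ Dphi) (ih _)).
(* Every finite set containing all multi-indices of length below [k] leaves an error of at most K Q
   / 2^k, which is unordered convergence. *)
have tail (phi : Rn -> C) e : elements (D_omega omega) phi -> 0 < e -> exists k,
    forall G : {fset mI}, (forall a, (mlen a < k)%N -> a \in G) ->
    `|complex.Re (T phi) - \sum_(a <- G) S phi a| < e.
  move=> Dphi e0; have [Q Q0 HQ] := jet_tail M0 iw Dphi.
  pose k := Num.bound (K * Q / e); exists k => G kG.
  pose s := [seq (a, b) | a <- (G : seq mI), b <- [:: true; false]].
  have us : uniq s.
    by apply: allpairs_uniq => [|//|[a b] [a' b'] _ _ [-> ->]]; rewrite ?fset_uniq.
  have sk j : j \notin s -> c j * wnorm1 leb (we l) (fun t => jet phi (j, t)) <= Q / 2 ^+ k.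
    move=> js; apply: HQ; rewrite leqNgt; apply: contra js => jk.
    by case: j jk => a b /= ak; apply: allpairs_f; [exact: kG|case: b].
  have Dj : DD (jet phi) by exists phi.
  have Q20 : 0 <= Q / 2 ^+ k by rewrite divr_ge0// exprn_ge0.
  have := hS _ s _ Dj us Q20 sk; rewrite /u jetK big_allpairs_dep /=.
  move=> /le_lt_trans; apply; rewrite mulrA ltr_pdivrMr ?exprn_gt0// [ltRHS]mulrC -ltr_pdivrMr//.
  apply: lt_trans (archi_boundP _) _; first by rewrite divr_ge0 ?mulr_ge0// ltW.
  by rewrite -natrX ltr_nat ltn_expl.
exists f, (2 * K); split.
- by rewrite mulr_ge0.
- move=> a; split; rewrite /re_part /im_part /f /comp /=.
    have -> : (fun t : ls => sg a * h (a, true) (unvec (vec t))) =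
        (fun t => sg a * h (a, true) t) by apply/funext => t; rewrite vecK.
    by apply: measurable_funM.
  have -> : (fun t : ls => - (sg a * h (a, false) (unvec (vec t)))) =
      (fun t => - sg a * h (a, false) t) by apply/funext => t; rewrite vecK mulNr.
  by apply: measurable_funM.
- move=> a x; apply: le_trans (cabs_le _) _; rewrite /= normrN !normrM !sg1 !mul1r.
  have wl : we l (unvec x) <= expR (- (n%:R * omegaN omega x)).
    by have := wexp_mono n n0 (unvec x); rewrite /wexp unvecK.
  have hb b : `|h (a, b) (unvec x)| <= K * cw M (mlen a) * expR (- (n%:R * omegaN omega x)).
    by apply: le_trans (hK _ _) _; rewrite ler_wpM2l// mulr_ge0// c0.
  by apply: le_trans (lerD (hb true) (hb false)) _; rewrite le_eqVlt; apply/orP; left; apply/eqP; ring.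
- move=> phi Dphi e e0; have sphi := Dsm _ Dphi.
  have Dipsi := D_omegaL homega 'i%C 0 Dphi Dphi; set ipsi := (fun x => _) in Dipsi.
  pose g a (x : Rn) := f a x * partials a phi x.
  have gE a t : partials a phi (vec t) =
      Complex (jet phi ((a, true), t)) (jet phi ((a, false), t)).
    by rewrite /jet /=; case: (partials a phi (vec t)).
  have gE' a t : jet ipsi ((a, true), t) = - jet phi ((a, false), t) /\
      jet ipsi ((a, false), t) = jet phi ((a, true), t).
    rewrite /jet /= !partialsE dseq_lin// mul0r addr0 cReM cImM /=.
    by rewrite !mul0r !mul1r sub0r add0r.
  have sgE a : (-1) ^+ mlen a = (sg a)%:C%C :> C by rewrite /sg rmorphXn rmorphN1.
  have ReS a : complex.Re ((-1) ^+ mlen a * cintegral (g a)) = S phi a.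
    rewrite sgE cReM /= mul0r subr0 (SE _ _ Dphi).
    have -> : \int[leb]_t re_part (g a) (vec t) = \int[leb]_t (sg a *
        (jet phi ((a, true), t) * h (a, true) t + jet phi ((a, false), t) * h (a, false) t)).
      by apply: eq_Rintegral => t _; rewrite /re_part /g gE cReM /= vecK; ring.
    by rewrite RintegralZl ?mulrA ?sgsg ?mul1r//; exact: iS.
  have ImS a : complex.Im ((-1) ^+ mlen a * cintegral (g a)) = - S ipsi a.
    rewrite sgE cImM /= mul0r addr0 (SE _ _ Dipsi).
    have -> : \int[leb]_t im_part (g a) (vec t) = \int[leb]_t (- sg a *
        (jet ipsi ((a, true), t) * h (a, true) t + jet ipsi ((a, false), t) * h (a, false) t)).
      apply: eq_Rintegral => t _; rewrite /im_part /g gE cImM /= vecK.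
      by have [-> ->] := gE' a t; ring.
    by rewrite RintegralZl ?mulrA ?mulrN ?sgsg ?mulN1r//; exact: iS.
  have [k1 H1] := tail _ _ Dphi (divr_gt0 e0 (ltr0Sn _ 1)).
  have [k2 H2] := tail _ _ Dipsi (divr_gt0 e0 (ltr0Sn _ 1)).
  have [F HF] := finite_mlen_le (maxn k1 k2); exists F => G FG.
  have RS : complex.Re (\sum_(a <- G) (-1) ^+ mlen a * cintegral (g a)) =
      \sum_(a <- G) S phi a.
    by rewrite (big_morph _ (@cReD R) erefl); apply: eq_bigr => a _; exact: ReS.
  have IS : complex.Im (\sum_(a <- G) (-1) ^+ mlen a * cintegral (g a)) =
      - \sum_(a <- G) S ipsi a.
    by rewrite (big_morph _ (@cImD R) erefl) -sumrN; apply: eq_bigr => a _; exact: ImS.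
  have TE : complex.Re (T ipsi) = - complex.Im (T phi).
    by rewrite TL// mul0r addr0 cReM /= mul0r mul1r sub0r.
  have GF k a : (k <= maxn k1 k2)%N -> (mlen a < k)%N -> a \in G.
    by move=> kk ak; apply: (fsubsetP FG); apply: HF; rewrite ltnW// (leq_trans ak).
  have := H1 G (fun a => GF k1 a (leq_maxl _ _)).
  have := H2 G (fun a => GF k2 a (leq_maxr _ _)).
  rewrite TE -opprD normrN => L2 L1.
  apply: le_lt_trans (cabs_le _) _; rewrite [ltRHS]splitr.
  have ReN (z : C) : complex.Re (- z) = - complex.Re z by case: z.
  have ImN (z : C) : complex.Im (- z) = - complex.Im z by case: z.
  rewrite cReD cImD RS IS ltrD//.
  - by rewrite ReN distrC.
  - by rewrite ImN -opprD normrN addrC.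
Qed.
End representation.

(** * Weighted sums of derivatives *)

Section weighted_sums.
Context {R : realType} {N : nat} (omega : R -> R).
Hypothesis homega : nonquasianalytic_weight omega.
Local Notation C := R[i].
Local Notation Rn := 'rV[R]_N.
Local Notation mI := (multi_index N).
Local Notation ls := (leb_space R N).
Local Notation cw := (cw omega).
Local Notation leb := (@lebesgueN R N).
Local Notation we n := (@wexp R omega N n).

Lemma geometric_half_le k : \sum_(j < k) (2 ^- j : R) <= 2.
Proof.
have : \sum_(j < k) (2 ^- j : R) = 2 - 2 * 2 ^- k.
  elim: k => [|k IH]; first by rewrite big_ord0 expr0 invr1; ring.
  by rewrite big_ord_recr /= IH exprS; field; rewrite expf_neq0.
by move=> ->; rewrite gerBl mulr_ge0// invr_ge0 exprn_ge0.
Qed.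

(** Enlarge [G] to a box: the sum over the box is a product of N geometric sums, each at most 2. *)
Lemma sum_half_mlen_le (G : {fset mI}) : \sum_(a <- G) (2 ^- mlen a : R) <= 2 ^+ N.
Proof.
have g0 (a : mI) : 0 <= (2 ^- mlen a : R) by rewrite invr_ge0 exprn_ge0.
pose k := (\max_(a <- (G : seq mI)) mlen a).+1.
pose u (b : {ffun 'I_N -> 'I_k}) : mI := [ffun i => nat_of_ord (b i)].
pose H := [seq u b | b <- enum {: {ffun 'I_N -> 'I_k}}].
have uinj : injective u.
  move=> b b' /ffunP E; apply/ffunP => i; apply: val_inj.
  by have := E i; rewrite !ffunE.
have GH : {subset (G : seq mI) <= H}.
  move=> a aG; have aik i : (a i < k)%N.
    rewrite ltnS; apply: leq_trans (_ : mlen a <= _)%N.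
      by rewrite /mlen (bigD1 i)//= leq_addr.
    by rewrite (big_rem a)//= leq_maxl.
  apply/mapP; exists [ffun i => Ordinal (aik i)]; first by rewrite mem_enum.
  by apply/ffunP => i; rewrite !ffunE.
apply: le_trans (_ : _ <= \sum_(a <- H) 2 ^- mlen a) _.
  have uH : uniq H by rewrite map_inj_uniq// enum_uniq.
  rewrite [leRHS](bigID (fun a => a \in G))/= -[leLHS]addr0 lerD//; last first.
    by apply: sumr_ge0.
  rewrite -[leRHS]big_filter le_eqVlt; apply/orP; left; apply/eqP.
  apply: perm_big; apply: uniq_perm; [exact: fset_uniq|exact: filter_uniq|].
  move=> a; rewrite mem_filter; apply/idP/andP => [aG|[//]].
  by split=> //; exact: GH.
rewrite /H big_map big_enum /=.
apply: le_trans (_ : _ <= \prod_(i < N) \sum_(j < k) (2 ^- j : R)) _.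
  rewrite bigA_distr_bigA /= le_eqVlt; apply/orP; left; apply/eqP; apply: eq_bigr => b _.
  by rewrite prodfV -expr_sum /mlen; congr (_ ^- _); apply: eq_bigr => i _; rewrite ffunE.
apply: le_trans (_ : _ <= \prod_(i < N) (2 : R)) _; last by rewrite prodr_const card_ord.
apply: ler_prod => i _; rewrite geometric_half_le andbT.
by apply: sumr_ge0 => j _; rewrite invr_ge0 exprn_ge0.
Qed.

Lemma expeR_Myoung_weight r m (a : mI) : 0 < r ->
  expeR (r%:E * young_weight omega m a) = (expeR (young_weight omega m a) `^ r)%E.
Proof.
move=> r0; case: (young_weight omega m a) => [y| |].
- rewrite -[LHS]/(expR (r * y))%:E -[RHS]/((expR y)%:E `^ r)%E.
  by rewrite poweR_EFin /powR gt_eqF ?expR_gt0// expRK.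
- by rewrite gt0_muley ?lte_fin// -[expeR +oo]/(+oo : \bar R)%E poweRyr ?gt_eqF.
- by rewrite gt0_muleNy ?lte_fin// -[expeR -oo]/(0 : \bar R)%E poweR0r ?gt_eqF.
Qed.

(** Moves the weight to the other side, conventions included: if [cw] is 0, both inequalities say
    that [X] is 0. *)
Lemma mule_young_weight_le (X : \bar R) (L : R) m (a : mI) :
  (0 <= X)%E -> 0 <= L ->
  (X * expeR (young_weight omega m a) <= L%:E)%E <->
  (X <= (L * cw m (mlen a))%:E)%E.
Proof.
move=> X0 L0; rewrite expeR_young_weight//; case: ifPn => [/eqP ->|c0].
  rewrite mulr0; split=> [XL|X0'].
    by rewrite leNgt; apply/negP => Xp; move: XL; rewrite gt0_muley.
  have -> : X = 0%E by apply/eqP; rewrite eq_le X0' X0.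
  by rewrite mul0e lee_fin.
have cp : 0 < cw m (mlen a) by rewrite lt_neqAle eq_sym c0 cw_ge0.
by rewrite lee_pdivrMr// EFinM.
Qed.

Lemma measurable_cabs f : cmeasurable f ->
  measurable_fun [set: ls] (fun t => cabs (f (vec t))).
Proof.
move=> [m1 m2]; have -> : (fun t : ls => cabs (f (vec t))) = (fun t =>
    (re_part f (vec t) ^+ 2 + im_part f (vec t) ^+ 2) `^ 2^-1).
  by apply/funext => t; rewrite cabsE powR12_sqrt// addr_ge0 ?sqr_ge0.
apply: (@measurableT_comp _ _ _ _ _ _ (@powR R ^~ 2^-1)); first exact: measurable_powR.
by apply: measurable_funD; apply: measurable_funX.
Qed.

Definition weighted (n : nat) (f : Rn -> C) (t : ls) : R :=
  expR (n%:R * omegaN omega (vec t)) * cabs (f (vec t)).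

Lemma weighted_ge0 n f t : 0 <= weighted n f t.
Proof. by rewrite mulr_ge0 ?expR_ge0 ?cabs_ge0. Qed.

Lemma measurable_weighted n f : cmeasurable f -> measurable_fun [set: ls] (weighted n f).
Proof.
move=> mf; apply: measurable_funM; last exact: measurable_cabs.
apply: (@measurableT_comp _ _ _ _ _ _ (@expR R)); first exact: measurable_expR.
apply: measurable_funM; first exact: measurable_cst.
apply: measurable_fun_leb_space; exact: (@measurable_omegaN R omega homega N).
Qed.

Lemma weighted_LnormE q n f :
  weighted_Lnorm omega q n%:Z f = Lnorm leb q (EFin \o weighted n f).
Proof. by rewrite /weighted_Lnorm -pmulrn. Qed.

End weighted_sums.

Section weighted_sum_membership.
Context {R : realType} {N : nat} (omega : R -> R).
Hypothesis homega : nonquasianalytic_weight omega.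
Local Notation C := R[i].
Local Notation Rn := 'rV[R]_N.
Local Notation mI := (multi_index N).
Local Notation ls := (leb_space R N).
Local Notation cw := (cw omega).
Local Notation leb := (@lebesgueN R N).
Local Notation we n := (@wexp R omega N n).

Lemma wexp_le1 n t : we n t <= 1.
Proof. by rewrite /wexp expR_le1 oppr_le0 mulr_ge0 ?(omegaN_ge0 homega). Qed.

Lemma wexpD n k t : we (n + k)%N t = we n t * we k t.
Proof. by rewrite /wexp natrD mulrDl opprD expRD. Qed.

Lemma weighted_wexp n f t : weighted omega n f t * we n t = cabs (f (vec t)).
Proof. by rewrite /weighted /wexp expRN mulrAC divff ?mul1r// gt_eqF ?expR_gt0. Qed.

Lemma conjugate_exponent (p : R) : 1 < p -> exists r : R,
  [/\ hoelder_conjugate p%:E = r%:E, 1 <= r & r^-1 + p^-1 = 1].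
Proof.
move=> p1; have p0 : p != 0 by rewrite gt_eqF// (lt_trans _ p1).
have := @hoelder_conj_ge1 R p%:E; have := @hoelder_conjugate_eq1 R p%:E.
have -> : hoelder_conjugate p%:E = (p / (p - 1))%:E.
  by rewrite /hoelder_conjugate/= eqe (negbTE p0) inver subr_eq0 gt_eqF.
move=> _ h; exists (p / (p - 1)); split=> //.
  by rewrite -lee_fin; apply: h; rewrite lee_fin ltW.
by field; rewrite p0 subr_eq0 gt_eqF.
Qed.

(** Passing from [M] to [m] gains 2^-|a|, which makes the sum over multi-indices finite; the n0
    spare exponents of the weight make each norm finite. *)
Lemma in_oplusL_of_pointwise (p : R) M : 1 <= p -> (0 < M)%N ->
  exists2 m, (0 < m)%N & exists n0, forall n (f : mI -> Rn -> C) (A : R), 0 <= A ->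
    (forall a, cmeasurable (f a)) ->
    (forall a x, cabs (f a x) <=
       A * cw M (mlen a) * expR (- ((n + n0)%:R * omegaN omega x))) ->
    in_oplusL omega (hoelder_conjugate p%:E) m n%:Z f.
Proof.
move=> p1 M0; have [m [B [Mm B0 HB]]] := cw_geom homega M0.
exists m; first exact: leq_trans Mm.
have [n0 _ n0oo] := wexp_integrable homega N; exists n0 => n f A A0 mf fA.
have ABc (a : mI) : A * cw M (mlen a) <= A * B * 2 ^- mlen a * cw m (mlen a).
  have p2 : (0 : R) < 2 ^+ mlen a by rewrite exprn_gt0.
  rewrite -!mulrA ler_wpM2l// mulrCA -ler_pdivrMl ?invr_gt0// invrK.
  exact: HB.
have AB0 (a : mI) : 0 <= A * B * 2 ^- mlen a.
  by rewrite !mulr_ge0 ?(ltW B0)// invr_ge0 exprn_ge0.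
have h1 (a : mI) : 2 ^- mlen a <= 1 :> R.
  by rewrite invf_le1 ?exprn_gt0// exprn_ege1// ler1n.
have fw a t : weighted omega n (f a) t <= A * cw M (mlen a) * we n0 t.
  have wp : 0 < we n t by exact: expR_gt0.
  rewrite -(ler_pM2r wp) weighted_wexp.
  have -> : A * cw M (mlen a) * we n0 t * we n t =
    A * cw M (mlen a) * (we n t * we n0 t) by ring.
  rewrite -wexpD.
  exact: fA.
have Ac0 (a : mI) : 0 <= A * cw M (mlen a) by rewrite mulr_ge0 ?cw_ge0.
split=> //; move: p1; rewrite le_eqVlt => /predU1P[<-|p1].
  rewrite hoelder_conjugate1; apply: le_lt_trans (ltry (A * B)).
  apply: ge_ereal_sup => _ [a _ <-]; rewrite weighted_LnormE.
  apply/mule_young_weight_le => //; [exact: Lnorm_ge0|by rewrite mulr_ge0// ltW|].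
  rewrite unlock; case: ifP => _; last first.
    by rewrite lee_fin !mulr_ge0 ?cw_ge0// ltW.
  apply/ess_supP/aeW => t; rewrite /= lee_fin ger0_norm ?weighted_ge0//.
  apply: le_trans (fw a t) _; apply: le_trans (_ : _ <= A * cw M (mlen a)) _.
    by rewrite ler_piMr// wexp_le1.
  apply: le_trans (ABc a) _; rewrite ler_wpM2r ?cw_ge0// ler_piMr//.
  by rewrite mulr_ge0// ltW.
have [r [-> r1 _]] := conjugate_exponent p1.
have r0 : 0 < r by exact: lt_le_trans r1.
pose I := fine (\int[leb]_(t in [set: ls]) (we n0 t)%:E)%E.
have IE : (\int[leb]_(t in [set: ls]) (we n0 t)%:E = I%:E)%E.
  rewrite /I fineK// ge0_fin_numE// integral_ge0// => t _.
  by rewrite lee_fin wexp_ge0.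
have I0 : 0 <= I.
  by rewrite -lee_fin -IE integral_ge0// => t _; rewrite lee_fin wexp_ge0.
pose J := I `^ r^-1; have J0 : 0 <= J by exact: powR_ge0.
have L a : (weighted_Lnorm omega r%:E n%:Z (f a) <=
    (A * B * 2 ^- mlen a * J * cw m (mlen a))%:E)%E.
  rewrite weighted_LnormE unlock.
  apply: le_trans (_ : _ <= (((A * cw M (mlen a)) `^ r * I) `^ r^-1)%:E)%E _.
    rewrite -poweR_EFin gt0_ler_poweR ?invr_ge0 ?(ltW r0)//.
    - rewrite in_itv/= leey andbT integral_ge0// => t _; exact: poweR_ge0.
    - by rewrite in_itv/= leey andbT lee_fin mulr_ge0 ?powR_ge0.
    have mw := @measurable_wexp R omega homega N n0.
    rewrite EFinM -IE -(@ge0_integralZl _ _ _ leb _ measurableT); last 3 first.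
    - by apply/measurable_EFinP; exact: mw.
    - by move=> t _; rewrite lee_fin wexp_ge0.
    - by rewrite lee_fin powR_ge0.
    apply: (@ge0_le_integral _ _ _ leb _ measurableT).
    - by move=> t _; exact: poweR_ge0.
    - have -> : (fun t => `|(EFin \o weighted omega n (f a)) t| `^ r)%E =
          EFin \o (fun t => weighted omega n (f a) t `^ r).
        by apply/funext => t; rewrite /= ger0_norm ?weighted_ge0.
      apply/measurable_EFinP; apply: (@measurableT_comp _ _ _ _ _ _ (@powR R ^~ r)).
        exact: measurable_powR.
      exact: measurable_weighted.
    - apply/measurable_EFinP; apply: measurable_funM; last exact: mw.
      exact: measurable_cst.
    move=> t _; rewrite /= lee_fin ger0_norm ?weighted_ge0//.
    apply: le_trans (_ : _ <= (A * cw M (mlen a) * we n0 t) `^ r) _.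
      rewrite ge0_ler_powR ?nnegrE ?(ltW r0)// ?weighted_ge0//.
      by rewrite mulr_ge0// wexp_ge0.
    rewrite powRM ?wexp_ge0// ler_wpM2l ?powR_ge0//.
    (* The weight is at most 1 and [r >= 1], so its r-th power is dominated by the weight itself,
       which is integrable. *)
    by rewrite ge1r_powR// expR_gt0 wexp_le1.
  rewrite lee_fin powRM ?powR_ge0// -powRrM divff ?gt_eqF// powRr1//.
  by rewrite [leRHS]mulrAC -/J ler_wpM2r.
pose K := (A * B * J) `^ r.
have K0 : 0 <= K by exact: powR_ge0.
have termle a : (weighted_Lnorm omega r%:E n%:Z (f a) `^ r *
    expeR (r%:E * young_weight omega m a) <= (K * 2 ^- mlen a)%:E)%E.
  have AJ : 0 <= A * B * 2 ^- mlen a * J by rewrite mulr_ge0.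
  rewrite expeR_Myoung_weight// -poweRM ?expeR_ge0//; last exact: Lnorm_ge0.
  apply: le_trans (_ : _ <= ((A * B * 2 ^- mlen a * J) `^ r)%:E)%E _.
    rewrite -poweR_EFin gt0_ler_poweR ?(ltW r0)//.
    - by rewrite in_itv/= leey andbT mule_ge0 ?expeR_ge0//; exact: Lnorm_ge0.
    - by rewrite in_itv/= leey andbT lee_fin.
    by apply/mule_young_weight_le => //; exact: Lnorm_ge0.
  rewrite lee_fin mulrAC powRM ?invr_ge0 ?exprn_ge0// ?mulr_ge0 ?(ltW B0)//.
  by rewrite ler_wpM2l// ge1r_powR// h1 andbT invr_gt0 exprn_gt0.
apply: le_lt_trans (ltry (K * 2 ^+ N)).
apply: ge_ereal_sup => _ [X [finX _] <-]; rewrite fsbig_finite//=.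
apply: le_trans (_ : _ <= \sum_(a <- fset_set X) (K * 2 ^- mlen a)%:E)%E _.
  by apply: lee_sum => a _; exact: termle.
by rewrite sumEFin lee_fin -mulr_sumr ler_wpM2l// sum_half_mlen_le.
Qed.

End weighted_sum_membership.

(** * From sums of derivatives back to the estimate on test functions *)

Section boundedness_of_sums.
Context {R : realType} {N : nat} (omega : R -> R).
Hypothesis homega : nonquasianalytic_weight omega.
Local Notation C := R[i].
Local Notation Rn := 'rV[R]_N.
Local Notation mI := (multi_index N).
Local Notation ls := (leb_space R N).
Local Notation cw := (cw omega).
Local Notation leb := (@lebesgueN R N).
Local Notation we n := (@wexp R omega N n).

Lemma normr_Rintegral_le d (X : measurableType d) (mu : {measure set X -> \bar R})
    (u v : X -> R) (V : R) :
  measurable_fun [set: X] u -> measurable_fun [set: X] v ->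
  (forall t, `|u t| <= v t) -> (\int[mu]_t (v t)%:E <= V%:E)%E ->
  `|\int[mu]_t u t| <= V.
Proof.
move=> mu_ mv uv vV; have h : (`|\int[mu]_t (u t)%:E| <= V%:E)%E.
  apply: le_trans (le_abse_integral _ measurableT _) _.
    exact/measurable_EFinP.
  apply: le_trans vV; apply: (@ge0_le_integral _ _ _ mu _ measurableT).
  - by move=> t _; exact: abse_ge0.
  - by apply/measurable_EFinP; apply: measurableT_comp; [exact: normr_measurable|].
  - exact/measurable_EFinP.
  - by move=> t _; rewrite /= lee_fin.
by move: h; rewrite /Rintegral; case: (integral _ _ _).
Qed.

Lemma weightedD n k (f : Rn -> C) t :
  weighted omega (n + k)%N f t * we k t = weighted omega n f t.
Proof.
rewrite /weighted /wexp natrD mulrDl expRD expRN.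
by field; rewrite gt_eqF ?expR_gt0.
Qed.

(** Each term is at most the whole sum, or the supremum; then take r-th roots. *)
Lemma in_oplusL_Lnorm_le (p : R) m n (f : mI -> Rn -> C) : 1 <= p ->
  in_oplusL omega (hoelder_conjugate p%:E) m n%:Z f -> exists2 L, 0 <= L &
  forall a, (weighted_Lnorm omega (hoelder_conjugate p%:E) n%:Z (f a) <=
             (L * cw m (mlen a))%:E)%E.
Proof.
rewrite le_eqVlt => /predU1P[<-|p1]; last first.
  have [r [-> r1 _]] := conjugate_exponent p1; move=> [_].
  have r0 : 0 < r by exact: lt_le_trans r1.
  have rn0 : r != 0 by rewrite gt_eqF.
  set S := (\esum_(a in _) _)%E => Soo.
  have tS a : (weighted_Lnorm omega r%:E n%:Z (f a) `^ r *
      expeR (r%:E * young_weight omega m a) <= S)%E.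
    by apply: esum_ge; exists [set a]; rewrite ?fsbig_set1//; split.
  have S0 : (0 <= S)%E.
    by apply: esum_ge0 => a _; rewrite mule_ge0 ?poweR_ge0 ?expeR_ge0.
  exists (fine S `^ r^-1) => [|a]; first exact: powR_ge0.
  have Ln0 := Lnorm_ge0 leb r%:E (EFin \o weighted omega n (f a)).
  apply/mule_young_weight_le => //.
    exact: powR_ge0.
  rewrite -poweR_EFin fineK ?ge0_fin_numE//.
  set E := (_ * expeR _)%E.
  have E0 : (0 <= E)%E by rewrite mule_ge0 ?expeR_ge0// weighted_LnormE.
  rewrite -[leLHS]poweRe1// -(divff rn0) poweRrM.
  rewrite gt0_ler_poweR ?invr_ge0 ?(ltW r0)//.
  - by rewrite in_itv/= leey andbT poweR_ge0.
  - by rewrite in_itv/= leey andbT.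
  rewrite /E poweRM ?expeR_ge0//.
  by rewrite -expeR_Myoung_weight.
rewrite hoelder_conjugate1 => -[_]; set S := ereal_sup _ => Soo.
have tS a : (weighted_Lnorm omega +oo n%:Z (f a) *
    expeR (young_weight omega m a) <= S)%E.
  by apply: ereal_sup_ubound; exists a.
have Ln0 a : (0 <= weighted_Lnorm omega +oo n%:Z (f a))%E.
  by rewrite weighted_LnormE; exact: Lnorm_ge0.
have S0 : (0 <= S)%E.
  by apply: le_trans (tS [ffun=> 0%N]); rewrite mule_ge0 ?expeR_ge0.
exists (fine S) => [|a]; first exact: fine_ge0.
apply/mule_young_weight_le => //; first exact: fine_ge0.
by rewrite fineK ?ge0_fin_numE.
Qed.

(** Hoelder's inequality after splitting off exp (- k omega), whose p-th power is integrable because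
    it is at most the function itself. *)
Lemma weighted_integral_le (p : R) : 1 <= p -> exists k J, 0 <= J /\
  forall n (f : Rn -> C) (l : R), cmeasurable f -> 0 <= l ->
  (weighted_Lnorm omega (hoelder_conjugate p%:E) (n + k)%N%:Z f <= l%:E)%E ->
  (\int[leb]_(t in [set: ls]) (weighted omega n f t)%:E <= (J * l)%:E)%E.
Proof.
move=> p1; have [k _ koo] := wexp_integrable homega N; exists k.
have mw := @measurable_wexp R omega homega N k.
have mW n f := @measurable_weighted R N omega homega n f.
move: p1; rewrite le_eqVlt => /predU1P[<-|p1].
  pose J := fine (\int[leb]_(t in [set: ls]) (we k t)%:E)%E.
  have JE : (\int[leb]_(t in [set: ls]) (we k t)%:E = J%:E)%E.
    rewrite /J fineK// ge0_fin_numE// integral_ge0// => t _.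
    by rewrite lee_fin wexp_ge0.
  have J0 : 0 <= J.
    by rewrite -lee_fin -JE integral_ge0// => t _; rewrite lee_fin wexp_ge0.
  exists J; split=> // n f l mf l0; rewrite hoelder_conjugate1 weighted_LnormE => Hl.
  (* The norm of exponent [+oo] is 0 by definition on a space of measure 0, so it bounds the
     essential supremum only when the measure is positive. *)
  have [mu0|mu0] := eqVneq (leb [set: ls]) 0%E.
    rewrite (null_set_integral measurableT _ mu0); first by rewrite lee_fin mulr_ge0.
    by apply/measurable_EFinP; exact: mW.
  rewrite mulrC EFinM -JE -(@ge0_integralZl _ _ _ leb _ measurableT); last 3 first.
  - by apply/measurable_EFinP; exact: mw.
  - by move=> t _; rewrite lee_fin wexp_ge0.
  - by rewrite lee_fin.
  apply: (@ae_ge0_le_integral _ _ _ leb _ measurableT).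
  - by move=> t _; rewrite lee_fin weighted_ge0.
  - by apply/measurable_EFinP; exact: mW.
  - by move=> t _; rewrite -EFinM lee_fin mulr_ge0 ?wexp_ge0.
  - by apply/measurable_EFinP; apply: measurable_funM; [exact: measurable_cst|exact: mw].
  move: Hl; rewrite unlock lt_neqAle eq_sym mu0 measure_ge0 /= => /ess_supP.
  apply: filterS => t; rewrite /= lee_fin ger0_norm ?weighted_ge0// => H _.
  by rewrite -(weightedD n k) -EFinM lee_fin ler_wpM2r// wexp_ge0.
have [r [rE r1 rp]] := conjugate_exponent p1; rewrite rE.
have r0 : 0 < r by exact: lt_le_trans r1.
have p0 : 0 < p by exact: lt_trans p1.
pose J := fine (Lnorm leb p%:E (EFin \o we k)).
have JE : Lnorm leb p%:E (EFin \o we k) = J%:E.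
  rewrite /J fineK// ge0_fin_numE ?Lnorm_ge0// unlock poweR_lty//.
  apply: le_lt_trans koo; apply: (@ge0_le_integral _ _ _ leb _ measurableT).
  - by move=> t _; exact: poweR_ge0.
  - have -> : (fun t => `|(EFin \o we k) t| `^ p)%E = EFin \o (fun t => we k t `^ p).
      by apply/funext => t; rewrite /= ger0_norm ?wexp_ge0.
    apply/measurable_EFinP; apply: (@measurableT_comp _ _ _ _ _ _ (@powR R ^~ p)).
      exact: measurable_powR.
    exact: mw.
  - by apply/measurable_EFinP; exact: mw.
  move=> t _; rewrite /= lee_fin ger0_norm ?wexp_ge0//.
  by rewrite ge1r_powR ?(ltW p1)// expR_gt0 (wexp_le1 homega).
have J0 : 0 <= J by rewrite fine_ge0// Lnorm_ge0.
exists J; split=> // n f l mf l0; rewrite weighted_LnormE => Hl.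
have := hoelder leb (mW (n + k)%N f mf) mw r0 p0 rp; rewrite JE Lnorm1 => H.
apply: le_trans (_ : _ <= \int[leb]_t `|((weighted omega (n + k) f \* we k) t)%:E|)%E _.
  rewrite le_eqVlt; apply/orP; left; apply/eqP; apply: eq_integral => t _.
  by rewrite /= weightedD ger0_norm ?weighted_ge0.
apply: le_trans H _; rewrite mulrC EFinM.
by apply: lee_pmul => //; rewrite ?Lnorm_ge0 ?lee_fin.
Qed.

End boundedness_of_sums.

Section sufficiency.
Context {R : realType} {N : nat} (omega : R -> R).
Hypothesis homega : nonquasianalytic_weight omega.
Local Notation C := R[i].
Local Notation Rn := 'rV[R]_N.
Local Notation mI := (multi_index N).
Local Notation ls := (leb_space R N).
Local Notation cw := (cw omega).
Local Notation leb := (@lebesgueN R N).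

Lemma cabs_cintegral_le n (f phi : Rn -> C) a (c V : R) : cmeasurable f ->
  elements (D_omega omega) phi -> 0 <= c ->
  (forall x, cabs (partials a phi x) <= c * expR (n%:R * omegaN omega x)) ->
  (\int[leb]_(t in [set: ls]) (weighted omega n f t)%:E <= V%:E)%E ->
  cabs (cintegral (fun x => f x * partials a phi x)) <= 2 * (c * V).
Proof.
move=> mf Dphi c0 pc fV; have [m1 m2] := mf.
have mj b : measurable_fun [set: ls] (fun t => jet phi ((a, b), t)).
  by have [] := bmeas_jet homega (a, b) Dphi.
have mW : measurable_fun [set: ls] (fun t => c * weighted omega n f t).
  apply: measurable_funM; first exact: measurable_cst.
  exact: measurable_weighted.
have WV : (\int[leb]_(t in [set: ls]) (c * weighted omega n f t)%:E <= (c * V)%:E)%E.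
  apply: le_trans (_ : _ <= c%:E * \int[leb]_(t in [set: ls]) (weighted omega n f t)%:E)%E _;
    last by rewrite EFinM lee_wpmul2l ?lee_fin.
  rewrite -(@ge0_integralZl _ _ _ leb _ measurableT).
  - exact: lexx.
  - by apply/measurable_EFinP; exact: measurable_weighted.
  - by move=> t _; rewrite lee_fin weighted_ge0.
  - by rewrite lee_fin.
have le z t : `|z| <= cabs (f (vec t) * partials a phi (vec t)) ->
    `|z| <= c * weighted omega n f t.
  move/le_trans; apply; rewrite cabsM /weighted mulrA [leRHS]mulrC ler_wpM2l//.
    exact: cabs_ge0.
have pE t : partials a phi (vec t) =
    Complex (jet phi ((a, true), t)) (jet phi ((a, false), t)).
  by rewrite /jet /=; case: (partials a phi (vec t)).
apply: le_trans (cabs_le _) _; rewrite mulr_natl mulr2n; apply: lerD => /=.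
- apply: (normr_Rintegral_le _ mW _ WV); last by move=> t; apply: le; exact: Re_le_cabs.
  have -> : (fun t : ls => re_part (fun x => f x * partials a phi x) (vec t)) =
    (fun t => re_part f (vec t) * jet phi ((a, true), t) -
              im_part f (vec t) * jet phi ((a, false), t)).
    by apply/funext => t; rewrite /re_part /im_part pE cReM.
  by apply: measurable_funB; apply: measurable_funM.
- apply: (normr_Rintegral_le _ mW _ WV); last by move=> t; apply: le; exact: Im_le_cabs.
  have -> : (fun t : ls => im_part (fun x => f x * partials a phi x) (vec t)) =
    (fun t => re_part f (vec t) * jet phi ((a, false), t) +
              im_part f (vec t) * jet phi ((a, true), t)).
    by apply/funext => t; rewrite /re_part /im_part pE cImM.
  by apply: measurable_funD; apply: measurable_funM.
Qed.

(** The passage from [m] to [M] leaves a factor 2^-|a| in the term of index a, so the terms add up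
    to at most a multiple of 2^N. *)
Lemma O_bounded_of_sums (T : (Rn -> C) -> C) (p : R) m : 1 <= p -> (0 < m)%N ->
  (forall n, (0 < n)%N -> exists f,
     in_oplusL omega (hoelder_conjugate p%:E) m n%:Z f /\ is_sum_of_derivatives omega T f) ->
  exists2 M, (0 < M)%N & O_bounded omega T M.
Proof.
move=> p1 m0 HT; have [M [B [mM B0 HB]]] := cw_geom homega m0.
have [k [J [J0 HJ]]] := @weighted_integral_le R N _ homega p p1.
exists M => [|n n0]; first exact: leq_trans mM.
have [|f [fL fT]] := HT (n + k)%N; first by rewrite ltn_addr.
have mf a : cmeasurable (f a) by case: fL.
have [L L0 HL] := in_oplusL_Lnorm_le homega p1 fL.
have fV a : (\int[leb]_(t in [set: ls]) (weighted omega n (f a) t)%:E <=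
    (J * (L * cw m (mlen a)))%:E)%E.
  by apply: HJ => //; rewrite mulr_ge0 ?cw_ge0.
exists (2 * (J * L * B) * 2 ^+ N); first by rewrite !mulr_ge0 ?exprn_ge0// ltW.
move=> phi K Dphi phiK; have [sphi _ _] := (elements_D_omega homega _).1 Dphi.
have K0 : 0 <= K.
  by apply: le_trans (phiK [::] 0); rewrite !mulr_ge0 ?cabs_ge0 ?expR_ge0 ?cw_ge0.
have term a : cabs ((-1) ^+ mlen a * cintegral (fun x => f a x * partials a phi x)) <=
    2 * (J * L * B) * K * 2 ^- mlen a.
  have p2 : (0 : R) < 2 ^+ mlen a by rewrite exprn_gt0.
  have cB : cw m (mlen a) <= B * cw M (mlen a) * 2 ^- mlen a.
    by rewrite ler_pdivlMr// mulrC.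
  (* If [cw M] is 0 at this order, the hypothesis does not bound this derivative of [phi]. But then
     [cw m] is 0 as well, so the integral of the weighted coefficient is 0, and any bound on the
     derivative will do. *)
  rewrite cabsM cabs_sign mul1r; have [cM0|cM0] := eqVneq (cw M (mlen a)) 0.
    have c0 : cw m (mlen a) = 0.
      by apply/eqP; rewrite eq_le cw_ge0 andbT (le_trans cB)// cM0 mulr0 mul0r.
    have [_ [B1 H1]] := bmeas_jet homega (a, true) Dphi.
    have [_ [B2 H2]] := bmeas_jet homega (a, false) Dphi.
    have B10 : 0 <= B1 by apply: le_trans (H1 (unvec 0)).
    have B20 : 0 <= B2 by apply: le_trans (H2 (unvec 0)).
    have pb x : cabs (partials a phi x) <= (B1 + B2) * expR (n%:R * omegaN omega x).
      apply: le_trans (_ : _ <= B1 + B2) _.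
        apply: le_trans (cabs_le _) _; rewrite -(unvecK x).
        by rewrite lerD//; [exact: (H1 (unvec x))|exact: (H2 (unvec x))].
      rewrite ler_peMr ?addr_ge0// -expR0 ler_expR mulr_ge0//.
      exact: omegaN_ge0.
    apply: le_trans (cabs_cintegral_le (mf a) Dphi (addr_ge0 B10 B20) pb (fV a)) _.
    by rewrite c0 !mulr0 !mulr_ge0 ?(ltW B0)// invr_ge0 exprn_ge0.
  have cM : 0 < cw M (mlen a) by rewrite lt_neqAle eq_sym cM0 cw_ge0.
  have pb x : cabs (partials a phi x) <= K / cw M (mlen a) * expR (n%:R * omegaN omega x).
    have := phiK (mseq a) x; rewrite -partialsE size_mseq.
    by rewrite -ler_pdivlMr// expRN ler_pdivrMr ?expR_gt0.
  have Kc : 0 <= K / cw M (mlen a) by rewrite divr_ge0// ltW.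
  apply: le_trans (cabs_cintegral_le (mf a) Dphi Kc pb (fV a)) _.
  apply: le_trans (_ : _ <= 2 * (K / cw M (mlen a) *
    (J * (L * (B * cw M (mlen a) * 2 ^- mlen a))))) _.
    by rewrite !ler_wpM2l.
  rewrite le_eqVlt; apply/orP; left; apply/eqP; field.
  by rewrite cM0 gt_eqF.
apply/ler_addgt0Pr => e e0; have [F HF] := fT phi Dphi e e0.
have := HF F (fsubset_refl F); set S := \sum_(a <- _) _ => Se.
have ST : cabs (T phi) <= cabs S + e.
  have -> : T phi = S + - (S - T phi) by ring.
  by apply: le_trans (cabsD _ _) _; rewrite cabsN lerD2l ltW.
apply: le_trans ST _; rewrite lerD2r; apply: le_trans (cabs_sum _ _) _.
apply: le_trans (_ : _ <= \sum_(a <- F) 2 * (J * L * B) * K * 2 ^- mlen a) _.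
  by apply: ler_sum => a _; exact: term.
rewrite -mulr_sumr mulrAC ler_wpM2r//.
rewrite ler_wpM2l ?sum_half_mlen_le// !mulr_ge0//; exact: ltW.
Qed.

End sufficiency.

Theorem theorem3p19 (R : realType) (N : nat) (hN : (0 < N)%N)
    (omega : R -> R) (homega : nonquasianalytic_weight omega)
    (T : ('rV[R]_N -> R[i]) -> R[i]) (hT : in_dual (D_omega omega) T)
    (p : R) (hp : 1 <= p) :
  in_dual_O_M omega T <->
  exists m : nat, (0 < m)%N /\
    forall n : nat, (0 < n)%N ->
      exists f : multi_index N -> 'rV[R]_N -> R[i],
        in_oplusL omega (hoelder_conjugate p%:E) m n%:Z f /\
        is_sum_of_derivatives omega T f.
Proof.
split=> [HT|[m [m0 Hm]]].
  have [k k0 Tk] := in_dual_O_bounded homega HT.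
  have [M M0 HM] := O_bounded_representation homega k0 hT Tk.
  have [m m0 [n0 Hn]] := @in_oplusL_of_pointwise R N omega homega p M hp M0.
  exists m; split=> // n _.
  (* The densities are taken at the exponent n + n0, whose surplus n0 is spent on integrability; [m]
     was fixed before [n]. *)
  have [f [A [A0 mf fA fT]]] := HM (n + n0)%N.
  by exists f; split=> //; exact: Hn fA.
have [M M0 TM] := O_bounded_of_sums homega hp m0 Hm.
exact: O_bounded_in_dual TM.
Qed.
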